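(* Suppose that $\phi\in C^\infty(\mathbb P^1)$ is a real-valued function satisfying 1. $\omega_{FS}+dd^c\phi>0$; 2. on $\mathbb C_w\subset\mathbb P^1$ it holds that $\phi\ge-\ln(1+|w|^2)$, with equality precisely on an arc in $\mathbb C_w$. Set $\phi_\tau(z):=\phi(\tau z)$ for $\tau\in\partial\mathbb D$. Then the weak solution $\Phi$ on $\mathbb P^1\times\overline{\mathbb D}$ to the Dirichlet problem for the complex Homogeneous Monge-Ampère Equation $$\Phi(\cdot,\tau)=\phi_\tau(\cdot)\ \text{ for }\tau\in\partial\mathbb D,\qquad \pi_{\mathbb P^1}^*\omega_{FS}+dd^c\Phi\ge 0,\qquad (\pi_{\mathbb P^1}^*\omega_{FS}+dd^c\Phi)^{2}=0$$ does not have maximal rank. In fact there is a non-empty open subset $S\subset\mathbb P^1\times\mathbb D$ such that $$\pi_{\mathbb P^1}^*\omega_{FS}+dd^c\Phi\,|_S=0 .$$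
   Context: $\mathbb D\subset\mathbb C$ is the open unit disc and $\overline{\mathbb D}$ its closure. $\mathbb P^1$ is covered by two charts equal to the complex plane, with coordinates $z$ and $w=1/z$, denoted $\mathbb C_z$ and $\mathbb C_w$. For $\tau\neq0$, $z\mapsto\tau z$ denotes the automorphism of $\mathbb P^1$ given by multiplication by $\tau$ in $\mathbb C_z$ and fixing $z=\infty$. The operator $dd^c$ is normalised so that $dd^c\log|z|^2=\delta_0$ on $\mathbb C$ (i.e. $dd^c=\frac{i}{2\pi}\partial\bar\partial$). The Fubini-Study form $\omega_{FS}$ is normalised so that $\int_{\mathbb P^1}\omega_{FS}=1$; thus $\omega_{FS}=dd^c\log(1+|z|^2)$ on $\mathbb C_z$. The map $\pi_{\mathbb P^1}:\mathbb P^1\times\overline{\mathbb D}\to\mathbb P^1$ is the projection. An arc in $\mathbb C$ is the image of a smooth map $[0,1]\to\mathbb C$ that does not intersect itself. The weak solution of the Dirichlet problem is the envelope $$\Phi=\sup\{\psi:\mathbb P^1\times\overline{\mathbb D}\to\mathbb R\cup\{-\infty\}\ :\ \psi\text{ upper semicontinuous},\ \pi_{\mathbb P^1}^*\omega_{FS}+dd^c\psi\ge0,\ \psi(z,\tau)\le\phi(\tau z)\text{ for }(z,\tau)\in\mathbb P^1\times\partial\mathbb D\},$$ where $\pi_{\mathbb P^1}^*\omega_{FS}+dd^c\psi\ge0$ is meant in the sense of currents on $\mathbb P^1\times\mathbb D$. The solution $\Phi$ is said to have maximal rank if the current $\omega_{FS}+dd^c\Phi(\cdot,\tau)$ on $\mathbb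 P^1$ is strictly positive for each $\tau\in\overline{\mathbb D}$.
   Formalization: In the envelope Φ the competitors ψ are also required to be the quasi-plurisubharmonic representatives (bounded on open sets by their essential supremum); otherwise ψ could be raised at one interior point and Φ would be +∞. *)

(* Defs.v *)
From HB Require Import structures.
From mathcomp Require Import all_boot all_order all_algebra.
From mathcomp Require Import all_classical all_reals all_analysis.
From mathcomp Require Import complex.

Set Implicit Arguments.
Unset Strict Implicit.
Unset Printing Implicit Defensive.

Import Order.TTheory GRing.Theory Num.Theory.
Import numFieldNormedType.Exports.

Local Open Scope classical_set_scope.
Local Open Scope ring_scope.

Section smooth.
Context {R : realType}.

Definition iter_derive (V W : normedModType R) (vs : seq V) (f : V -> W) : V -> W :=
  foldr (fun v (g : V -> W) x => 'D_v g x) f vs.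

Definition smooth (V W : normedModType R) (f : V -> W) : Prop :=
  forall (vs : seq V) (x : V), differentiable (iter_derive vs f) x.

Definition test_function (V : normedModType R) (U : set V) (f : V -> R) : Prop :=
  smooth f /\
  exists K : set V, [/\ compact K, K `<=` U & forall x, ~ K x -> f x = 0].

End smooth.

Section projective_line.
Context {R : realType}.

(* The coercion to [numFieldType] selects the topology of the modulus on R[i],
   which has no topological structure of its own. *)
Definition Cplx (R : realType) : numFieldType := R[i].

Definition P1 (R : realType) := one_point_compactification (Cplx R).

Definition cplx (p : R * R) : Cplx R := (p.1 +i* p.2)%C.

Definition chart_z (z : Cplx R) : P1 R := Some z.

Definition chart_w (w : Cplx R) : P1 R := if w == 0 then None else Some w^-1.

Definition atlas : set (Cplx R -> P1 R) := [set chart_z; chart_w].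

Definition rotate (tau : Cplx R) (p : P1 R) : P1 R := omap ( *%R tau) p.

Definition disc : set (Cplx R) := [set tau | `|tau| < 1].
Definition closed_disc : set (Cplx R) := [set tau | `|tau| <= 1].
Definition circle : set (Cplx R) := [set tau | `|tau| = 1].

(* Local potential of the Fubini-Study form: it is the same function in the
   coordinate z and in the coordinate w = 1/z. *)
Definition fs_potential (z : Cplx R) : R := ln (1 + complex.ComplexField.Normc.normc z ^+ 2).

(* A smooth map on [0, 1] is the restriction of a smooth map on the line. *)
Definition is_arc (A : set (Cplx R)) : Prop :=
  exists gamma : R -> R * R,
    [/\ smooth gamma,
        {in `[0, 1] &, injective gamma} &
        A = [set cplx (gamma t) | t in [set` `[0, 1]]]].

Definition smooth_P1 (phi : P1 R -> R) : Prop :=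
  forall c, atlas c -> smooth (fun p : R * R => phi (c (cplx p))).

End projective_line.

Section currents.
Context {R : realType}.

Let C1 := (R * R)%type.
Let C2 := ((R * R) * (R * R))%type.

Definition leb2 := (@lebesgue_measure R \x @lebesgue_measure R)%E.
Definition leb4 := (leb2 \x leb2)%E.

Definition locally_integrable2 (U : set C1) (u : C1 -> \bar R) : Prop :=
  forall K, compact K -> K `<=` U -> leb2.-integrable K u.

Definition locally_integrable4 (U : set C2) (u : C2 -> \bar R) : Prop :=
  forall K, compact K -> K `<=` U -> leb4.-integrable K u.

(* dd^c = (i / 2 pi) d dbar on functions of z = x + i y is
   (4 pi)^-1 (d_x^2 + d_y^2), as a density with respect to dx dy. *)
Definition ddc_fun (f : C1 -> R) (p : C1) : R :=
  let ex : C1 := (1, 0) in let ey : C1 := (0, 1) in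
  (4 * pi)^-1 * (iter_derive [:: ex; ex] f p + iter_derive [:: ey; ey] f p).

(* The real (1,1)-form with coordinates (z, tau) on C^2
     i (h11 dz dzbar + h12 dz dtaubar + conj(h12) dtau dzbar + h22 dtau dtaubar),
   where h12 = h12re + i h12im. *)
Record form11 := Form11 { h11 : C2 -> R; h22 : C2 -> R;
                          h12re : C2 -> R; h12im : C2 -> R }.

Definition test_form (U : set C2) (eta : form11) : Prop :=
  [/\ test_function U (h11 eta), test_function U (h22 eta),
      test_function U (h12re eta) & test_function U (h12im eta)].

Definition positive_form (eta : form11) : Prop :=
  forall (p : C2) (a b : R[i]),
    0 <= h11 eta p * complex.ComplexField.Normc.normc a ^+ 2
         + 2 * complex.Re ((h12re eta p +i* h12im eta p) * a * b^*)%C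
         + h22 eta p * complex.ComplexField.Normc.normc b ^+ 2.

(* Density with respect to dx dy ds dt (z = x + i y, tau = s + i t) of
     dd^c eta = (i / 2 pi) d dbar eta
       = (2 / pi) (d_z d_zbar h22 + d_tau d_taubar h11
                   - 2 Re (d_z d_taubar conj(h12))) dx dy ds dt,
   with 4 d_z d_taubar = (d_x d_s + d_y d_t) + i (d_x d_t - d_y d_s). *)
Definition ddc_form (eta : form11) (p : C2) : R :=
  let ex : C2 := ((1, 0), (0, 0)) in let ey : C2 := ((0, 1), (0, 0)) in
  let es : C2 := ((0, 0), (1, 0)) in let et : C2 := ((0, 0), (0, 1)) in
  (2 * pi)^-1 *
    (iter_derive [:: ex; ex] (h22 eta) p + iter_derive [:: ey; ey] (h22 eta) p
     + iter_derive [:: es; es] (h11 eta) p + iter_derive [:: et; et] (h11 eta) p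
     - 2 * (iter_derive [:: ex; es] (h12re eta) p
            + iter_derive [:: ey; et] (h12re eta) p
            + iter_derive [:: ex; et] (h12im eta) p
            - iter_derive [:: ey; es] (h12im eta) p)).

Definition ddc_current2 (u : C1 -> \bar R) (chi : C1 -> R) : \bar R :=
  (\int[leb2]_p (u p * (ddc_fun chi p)%:E))%E.

Definition ddc_current4 (u : C2 -> \bar R) (eta : form11) : \bar R :=
  (\int[leb4]_p (u p * (ddc_form eta p)%:E))%E.

End currents.

Section monge_ampere.
Context {R : realType}.
Implicit Types (c : Cplx R -> P1 R) (psi : P1 R * Cplx R -> \bar R).
Implicit Types (phi : P1 R -> R) (g : P1 R -> \bar R).

Definition omega_ddc_gt0 phi : Prop :=
  forall c, atlas c -> forall p : R * R,
    0 < ddc_fun (fun q => fs_potential (cplx q) + phi (c (cplx q))) p.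

Definition prod_chart c (p : (R * R) * (R * R)) : P1 R * Cplx R :=
  (c (cplx p.1), cplx p.2).

(* As omega_FS = dd^c fs_potential in either chart, the current
   pi^* omega_FS + dd^c psi is dd^c of this function. *)
Definition prod_potential c psi (p : (R * R) * (R * R)) : \bar R :=
  ((fs_potential (cplx p.1))%:E + psi (prod_chart c p))%E.

Definition current_ge0 (S : set (P1 R * Cplx R)) psi : Prop :=
  forall c, atlas c ->
    locally_integrable4 (prod_chart c @^-1` S) (prod_potential c psi) /\
    forall eta, test_form (prod_chart c @^-1` S) eta -> positive_form eta ->
      (0 <= ddc_current4 (prod_potential c psi) eta)%E.

Definition current_eq0 (S : set (P1 R * Cplx R)) psi : Prop :=
  forall c, atlas c ->
    locally_integrable4 (prod_chart c @^-1` S) (prod_potential c psi) /\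
    forall eta, test_form (prod_chart c @^-1` S) eta ->
      ddc_current4 (prod_potential c psi) eta = 0%E.

(* On open sets psi is bounded by its essential supremum. A current only sees
   psi up to null sets: an upper semicontinuous psi with
   pi^* omega_FS + dd^c psi >= 0 is the quasi-plurisubharmonic representative
   of its class exactly when this holds. Without it, psi could be raised
   arbitrarily at a single interior point and the envelope would be +oo. *)
Definition le_ess_sup (S : set (P1 R * Cplx R)) psi : Prop :=
  forall c, atlas c -> forall U : set ((R * R) * (R * R)),
    open U -> U `<=` prod_chart c @^-1` S ->
    forall a : R, {ae leb4, forall p, U p -> (psi (prod_chart c p) <= a%:E)%E} ->
    forall p, U p -> (psi (prod_chart c p) <= a%:E)%E.

Definition upper_semicontinuous_on (S : set (P1 R * Cplx R)) psi : Prop :=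
  lower_semicontinuous (fun p : subspace S => - psi p)%E.

(* The values of psi outside P^1 x closed_disc are irrelevant. *)
Definition subsolution phi psi : Prop :=
  [/\ forall p, (setT `*` closed_disc) p -> psi p != +oo%E,
      upper_semicontinuous_on (setT `*` closed_disc) psi,
      current_ge0 (setT `*` disc) psi,
      le_ess_sup (setT `*` disc) psi &
      forall z tau, circle tau -> (psi (z, tau) <= (phi (rotate tau z))%:E)%E].

Definition weak_solution phi (p : P1 R * Cplx R) : \bar R :=
  ereal_sup [set psi p | psi in subsolution phi].

Definition potential c g (p : R * R) : \bar R :=
  ((fs_potential (cplx p))%:E + g (c (cplx p)))%E.

(* omega_FS + dd^c g >= eps omega_FS for some eps > 0. *)
Definition strictly_positive g : Prop :=
  (forall c, atlas c -> locally_integrable2 setT (potential c g)) /\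
  exists2 eps : R, 0 < eps &
    forall c, atlas c -> forall chi : R * R -> R,
      test_function setT chi -> (forall p, 0 <= chi p) ->
      (eps%:E * ddc_current2 (fun p => (fs_potential (cplx p))%:E) chi
         <= ddc_current2 (potential c g) chi)%E.

Definition maximal_rank psi : Prop :=
  forall tau, closed_disc tau -> strictly_positive (fun z => psi (z, tau)).

End monge_ampere.

(* Main.v *)
(* In the coordinate w the solution u = fs_potential + Phi vanishes for small
   (w, tau), so that its current vanishes there.

   Upper bound. On |tau| = 1 a subsolution satisfies u(w, tau) <= v(w / tau), where
   v = fs_potential + phi >= 0 vanishes exactly on the arc. The barrier is
   B = K |prod_j (w - a_j tau)|^2 with n points a_j of the arc. Its Levi form is
   degenerate, and for small (w, tau) it is at most K q^n. If some coordinate of the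
   points a_j is equally spaced, then prod_j |zeta - a_j|^2 >= nu r^n whenever zeta
   stays at distance sqrt nu from the arc, so K can be taken of size r^(-n) with r
   independent of n, and the maximum principle gives u <= B + eta. For q < r,
   letting n go to infinity gives u <= 0. The maximum principle is applied to
   mollifications of u, whose four-point differences are at least - o(t^2).

   Lower bound. ln (1 + d |w|^2) - ln (1 + d A) defines a subsolution for small d > 0,
   because strict positivity of v off the arc gives room near w = oo; let d -> 0.

   In the coordinate z the potential near infinity is ln |z|^2, the limit of
   ln (|z|^2 + d), whose current has density 4 d / (|z|^2 + d)^2 -> 0. At tau = 0 the
   current omega_FS + dd^c Phi vanishes near w = 0, where omega_FS does not. *)

From HB Require Import structures.
Require Import Defs.
From mathcomp Require Import all_boot all_order all_algebra.
From mathcomp Require Import all_classical all_reals all_analysis.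
From mathcomp Require Import measurable_realfun complex.
From mathcomp Require Import lra ring zify.
Import Order.TTheory GRing.Theory Num.Theory.
Import numFieldNormedType.Exports ComplexField.Normc.
Local Open Scope classical_set_scope.
Local Open Scope ring_scope.

Set Implicit Arguments.
Unset Strict Implicit.
Unset Printing Implicit Defensive.

(** For holomorphic h on C^2 the Levi form of |h|^2 is |dh|^2, of rank at most one, so |h|^2 solves
    the homogeneous Monge-Ampere equation and a plurisubharmonic function below it on the boundary
    of a bidisc stays below it inside. The barrier must be large on |tau| = 1 off the arc and tiny
    at the origin; homogeneity of h makes the two scales comparable, since on |tau| = 1 its modulus
    is that of a monic polynomial in w / tau with roots on the arc. That such polynomials can decay
    no faster than geometrically away from their roots reflects the positive logarithmic capacity of
    an arc. Equally spaced coordinates make this explicit: projection to an axis shrinks distances,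
    which leaves a product of distances on a line.

    The order of choices matters: q depends on the arc alone, while n and K also depend on an upper
    bound of the subsolution, so the estimate passes to the supremum.

    The obstacle is regularity: a subsolution is only upper semicontinuous and its current is tested
    only inside |tau| < 1. Second derivatives therefore fall on the mollifying kernel, and pointwise
    bounds come back from almost everywhere bounds through the essential-supremum condition. *)

Local Notation M1 R := (measurableTypeR R).
Local Notation M2 R := (M1 R * M1 R)%type.
Local Notation M4 R := (M2 R * M2 R)%type.
Local Notation C1 R := (R * R)%type.
Local Notation C2 R := ((R * R) * (R * R))%type.

(** * Lebesgue measure on C^2 *)

Lemma sigma_finite_product d1 d2 (T1 : measurableType d1)
    (T2 : measurableType d2) (R : realType)
    (m1 : {sigma_finite_measure set T1 -> \bar R})
    (m2 : {sigma_finite_measure set T2 -> \bar R}) :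
  sigma_finite setT (product_measure1 m1 m2).
Proof.
have /sigma_finiteP[F [TF ndF Foo]] := sigma_finiteT m1.
have /sigma_finiteP[G [TG ndG Goo]] := sigma_finiteT m2.
exists (fun n => F n `*` G n).
  apply/esym/seteqP; split => // -[x y] _.
  have [i _ Fx] : (\bigcup_n F n) x by rewrite -TF.
  have [j _ Gy] : (\bigcup_n G n) y by rewrite -TG.
  exists (maxn i j) => //; split.
    by move: x Fx; exact/subsetPset/ndF/leq_maxl.
  by move: y Gy; exact/subsetPset/ndG/leq_maxr.
move=> k; have [mF Fk] := Foo k; have [mG Gk] := Goo k.
split; first exact: measurableX.
by rewrite product_measure1E// lte_mul_pinfty// ge0_fin_numE.
Qed.

(** Fubini and the uniqueness of product measures are applied to [leb2] and [leb4] under these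
    names, hence the explicit measure and sigma-finite structures. *)
HB.instance Definition _ (R : realType) := Measure.copy (@leb2 R)
  ((@lebesgue_measure R \x @lebesgue_measure R)%E : {measure set M2 R -> \bar R}).
HB.instance Definition _ (R : realType) := Measure_isSigmaFinite.Build _ _ _ (@leb2 R)
  (sigma_finite_product (@lebesgue_measure R) (@lebesgue_measure R)).
HB.instance Definition _ (R : realType) := Measure.copy (@leb4 R)
  ((@leb2 R \x @leb2 R)%E : {measure set M4 R -> \bar R}).
HB.instance Definition _ (R : realType) := Measure_isSigmaFinite.Build _ _ _ (@leb4 R)
  (sigma_finite_product (@leb2 R) (@leb2 R)).

Section borel_product.

(** Bridge between topology and measure: when every neighbourhood of a point contains, around that
    point, a member of one countable measurable family, open sets are countable unions of such
    members. *)
Definition measurable_base (T : topologicalType) (M : set (set T)) : Prop :=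
  exists B : nat -> set T, (forall n, M (B n)) /\
    forall x (O : set T), nbhs x O -> exists n, B n x /\ B n `<=` O.

Lemma measurable_base_prod (T U : topologicalType) (M : set (set T))
    (N : set (set U)) (K : set (set (T * U))) :
  (forall A B, M A -> N B -> K (A `*` B)) ->
  measurable_base M -> measurable_base N -> measurable_base K.
Proof.
move=> MNK [B [MB hB]] [D [ND hD]].
exists (fun n => if @unpickle (nat * nat)%type n is Some (i, j)
                 then B i `*` D j else B 0%N `*` D 0%N); split.
  by move=> n; case: unpickle => [[i j]|]; exact: MNK.
move=> [x y] O [[P Q] /= [Px Qy] PQO].
have [i [Bx BP]] := hB _ _ Px; have [j [Dy DQ]] := hD _ _ Qy.
exists (pickle (i, j)); rewrite pickleK; split => // -[a b] [/= Ba Db].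
by apply: PQO; split; [exact: BP|exact: DQ].
Qed.

Lemma measurable_base_real (R : realType) :
  measurable_base (@measurable _ (M1 R) : set (set R)).
Proof.
exists (fun n => if @unpickle (rat * rat)%type n is Some (a, b)
                 then `]ratr a, ratr b[%classic else set0); split.
  by move=> n; case: unpickle => [[i j]|//]; exact: measurable_itv.
move=> x O /nbhs_ballP[e /= e0 eO].
have /rat_in_itvoo[a /itvP ha] : x - e < x by rewrite ltrBlDr ltrDl.
have /rat_in_itvoo[b /itvP hb] : x < x + e by rewrite ltrDl.
exists (pickle (a, b)); rewrite pickleK; split.
  by rewrite /= in_itv/= ha hb.
move=> y /=; rewrite in_itv/= => /andP[ay yb]; apply: eO.
rewrite /ball/= ltr_distlC; apply/andP; split.
  by apply: lt_trans ay; rewrite ha.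
by apply: lt_trans yb _; rewrite hb.
Qed.

Lemma open_measurable_base (U : topologicalType) (M : set (set U)) :
  M set0 -> (forall F : nat -> set U, (forall n, M (F n)) -> M (\bigcup_n F n)) ->
  measurable_base M -> forall O : set U, open O -> M O.
Proof.
move=> M0 MU [B [MB hB]] O oO.
rewrite (_ : O = \bigcup_n (if `[< B n `<=` O >] then B n else set0)).
  by apply: MU => n; case: ifP.
apply/seteqP; split=> [x Ox|x [n _]].
  have [n [Bx BO]] := hB x O (open_nbhs_nbhs (conj oO Ox)).
  by exists n => //; case: ifPn => // /asboolPn.
by case: ifPn => // /asboolP BO /BO.
Qed.

Variable R : realType.

Lemma measurable_base2 : measurable_base (@measurable _ (M2 R) : set (set (C1 R))).
Proof.
apply: measurable_base_prod; [|exact: measurable_base_real..].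
by move=> A B mA mB; exact: measurableX.
Qed.

Lemma measurable_base4 : measurable_base (@measurable _ (M4 R) : set (set (C2 R))).
Proof.
apply: measurable_base_prod; [|exact: measurable_base2..].
by move=> A B mA mB; exact: measurableX.
Qed.

Lemma open_measurable4 (O : set (C2 R)) : open O -> measurable (O : set (M4 R)).
Proof.
move=> oO; have := open_measurable_base _ _ measurable_base4 oO; apply.
  exact: measurable0.
by move=> F mF; exact: bigcupT_measurable.
Qed.

Lemma closed_measurable4 (O : set (C2 R)) : closed O -> measurable (O : set (M4 R)).
Proof. by move=> /closed_openC/open_measurable4/measurableC; rewrite setCK. Qed.

Lemma continuous_measurable4 (f : C2 R -> R) :
  continuous f -> measurable_fun setT (f : M4 R -> M1 R).
Proof.
move=> /continuousP cf; apply: (measurability _ (RGenOpens.measurableE R)).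
move=> _ [_ [a [b ->] <-]]; rewrite setTI.
by apply: open_measurable4; apply: cf; exact: interval_open.
Qed.

End borel_product.

Section translation_invariance.

Definition preserves d (T : measurableType d) (R : realType)
    (mu : {measure set T -> \bar R}) (f : T -> T) : Prop :=
  measurable_fun setT f /\
  forall A, measurable A -> pushforward mu f A = mu A.

(** The pushforward agrees with the product measure on rectangles, which determine it by
    sigma-finiteness. *)
Lemma preserves_product d1 d2 (T1 : measurableType d1) (T2 : measurableType d2)
    (R : realType) (m1 : {sigma_finite_measure set T1 -> \bar R})
    (m2 : {sigma_finite_measure set T2 -> \bar R}) (f : T1 -> T1) (g : T2 -> T2) :
  preserves m1 f -> preserves m2 g ->
  preserves (product_measure1 m1 m2) (fun p => (f p.1, g p.2)).
Proof.
move=> [mf fE] [mg gE].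
have mfg : measurable_fun [set: T1 * T2] (fun p => (f p.1, g p.2)).
  by apply: measurable_fun_pair; exact: measurableT_comp.
split=> // A mA.
apply/esym; apply: (product_measure_unique (m' := pushforward _ _)) => // B C mB mC.
rewrite -(fE _ mB) -(gE _ mC) /pushforward.
have mB' : measurable (f @^-1` B) by rewrite -(setTI (f @^-1` B)); exact: mf.
have mC' : measurable (g @^-1` C) by rewrite -(setTI (g @^-1` C)); exact: mg.
by rewrite -product_measure1E.
Qed.

Lemma integral_preserves d (T : measurableType d) (R : realType)
    (mu : {measure set T -> \bar R}) (s : T -> T) (f : T -> \bar R) :
  preserves mu s -> mu.-integrable setT f ->
  mu.-integrable setT (f \o s) /\ (\int[mu]_x (f \o s) x = \int[mu]_x f x)%E.
Proof.
move=> [ms sE] intf; have mf := measurable_int _ intf.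
have E (g : T -> \bar R) : (\int[pushforward mu s]_p g p = \int[mu]_p g p)%E.
  by apply: eq_measure_integral => A mA _; exact: sE.
have ints : mu.-integrable setT (f \o s).
  apply/integrableP; split; first exact: (measurableT_comp mf ms).
  move/integrableP : intf => [_]; apply: le_lt_trans.
  rewrite -(E (fun p => `|f p|%E)) ge0_integral_pushforward//.
  exact: measurableT_comp.
split=> //.
by rewrite -(E f) integral_pushforward.
Qed.

Variable R : realType.

Lemma preserves_shift1 (a : R) :
  preserves (@lebesgue_measure R) (fun x : M1 R => x + a : M1 R).
Proof.
have mf : measurable_fun setT (fun x : M1 R => x + a : M1 R).
  exact: measurable_funD.
split=> // A mA; apply/esym.
apply: (@lebesgue_measure_unique _ (pushforward _ _)) => // _ [[b c]] _ <-.
rewrite /= /pushforward (_ : _ @^-1` _ = `]b - a, c - a]%classic).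
  rewrite !lebesgue_measure_itv/= !lte_fin ltrD2r.
  by case: ifP => // _; rewrite -!EFinB opprB addrA subrK.
by apply/seteqP; split=> x /=; rewrite !in_itv/= ltrBlDr lerBrDr.
Qed.

Lemma preserves_shift2 (a : C1 R) :
  preserves (@leb2 R) (fun x : M2 R => (x + a : C1 R) : M2 R).
Proof. exact: preserves_product (preserves_shift1 a.1) (preserves_shift1 a.2). Qed.

Lemma preserves_shift4 (a : C2 R) :
  preserves (@leb4 R) (fun x : M4 R => (x + a : C2 R) : M4 R).
Proof. exact: preserves_product (preserves_shift2 a.1) (preserves_shift2 a.2). Qed.

Lemma integral_shift4 (f : M4 R -> \bar R) (a : C2 R) :
  (@leb4 R).-integrable setT f ->
  (@leb4 R).-integrable setT (fun p : M4 R => f (p + a : C2 R)%R) /\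
  (\int[leb4]_p f (p + a : C2 R)%R = \int[leb4]_p f p)%E.
Proof. exact: integral_preserves (preserves_shift4 a). Qed.

End translation_invariance.

Lemma integrable_indic_lty d (T : measurableType d) (R : realType)
    (mu : {measure set T -> \bar R}) (A : set T) :
  measurable A -> (mu A < +oo)%E ->
  mu.-integrable setT (EFin \o \1_A) /\ (\int[mu]_x \1_A x)%R = fine (mu A).
Proof.
move=> mA Af; split; last by rewrite /Rintegral integral_indic// setIT.
apply/integrableP; split; first exact/measurable_EFinP/measurable_indic.
rewrite (eq_integral (fun p => (\1_A p)%:E)); last first.
  by move=> p _ /=; rewrite ger0_norm.
by rewrite integral_indic// setIT.
Qed.

Section real_integral.
Variable R : realType.
Implicit Types f g : C2 R -> R.

(** Real-valued, so that estimates are arithmetic in [R]. An infinite integral is read as 0, which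
    is why [int4] accompanies it in the rules below. *)
Definition I4 f : R := (\int[leb4]_p f p)%R.
Definition int4 f : Prop := (@leb4 R).-integrable setT (EFin \o f).

Lemma eq_I4 f g : f =1 g -> I4 f = I4 g.
Proof. by move=> /funext ->. Qed.

Lemma I4E f : int4 f -> (I4 f)%:E = (\int[leb4]_p (f p)%:E)%E.
Proof. by move=> fi; rewrite fineK//; exact: integrable_fin_num. Qed.

Lemma int4D f g : int4 f -> int4 g -> int4 (fun p => f p + g p).
Proof. by move=> fi gi; exact: (integrableD measurableT fi gi). Qed.

Lemma int4B f g : int4 f -> int4 g -> int4 (fun p => f p - g p).
Proof. by move=> fi gi; exact: (integrableB measurableT fi gi). Qed.

Lemma int4Z k f : int4 f -> int4 (fun p => k * f p).
Proof. by move=> fi; exact: (integrableZl measurableT k fi). Qed.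

Lemma int4_norm f : int4 f -> int4 (fun p => `|f p|).
Proof. by move=> fi; exact: (integrable_abse fi). Qed.

Lemma I4D f g : int4 f -> int4 g -> I4 (fun p => f p + g p) = I4 f + I4 g.
Proof. by move=> fi gi; exact: (RintegralD measurableT fi gi). Qed.

Lemma I4B f g : int4 f -> int4 g -> I4 (fun p => f p - g p) = I4 f - I4 g.
Proof. by move=> fi gi; exact: (RintegralB measurableT fi gi). Qed.

Lemma I4Z k f : int4 f -> I4 (fun p => k * f p) = k * I4 f.
Proof. by move=> fi; exact: (RintegralZl k measurableT fi). Qed.

Lemma I4_le f g : int4 f -> int4 g -> (forall p, f p <= g p) -> I4 f <= I4 g.
Proof. by move=> fi gi fg; exact: (le_Rintegral measurableT fi gi). Qed.

Lemma I4_ge0 f : (forall p, 0 <= f p) -> 0 <= I4 f.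
Proof. by move=> f0; exact: Rintegral_ge0. Qed.

Lemma I4_norm f : int4 f -> `|I4 f| <= I4 (fun p => `|f p|).
Proof. by move=> fi; exact: (le_normr_Rintegral measurableT fi). Qed.

Lemma I4_shift f a : int4 f ->
  int4 (fun p => f (p + a)) /\ I4 (fun p => f (p + a)) = I4 f.
Proof.
by move=> fi; have [ii E] := integral_shift4 a fi; split => //; congr fine.
Qed.

Lemma int4_measurable f : int4 f -> measurable_fun setT (f : M4 R -> M1 R).
Proof. by move=> fi; apply/measurable_EFinP; exact: measurable_int fi. Qed.

Lemma int4_le f g : measurable_fun setT (f : M4 R -> M1 R) -> int4 g ->
  (forall p, `|f p| <= g p) -> int4 f.
Proof.
move=> mf gi fg; apply: (le_integrable measurableT _ _ gi).
  exact/measurable_EFinP.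
by move=> p _ /=; rewrite lee_fin (le_trans (fg p))// ler_norm.
Qed.

Lemma int4M f g C : int4 f -> measurable_fun setT (g : M4 R -> M1 R) ->
  (forall p, `|g p| <= C) -> int4 (fun p => f p * g p).
Proof.
move=> fi mg gC; apply: (@int4_le _ (fun p => C * `|f p|)).
- by apply: measurable_funM => //; exact: int4_measurable.
- exact/int4Z/int4_norm.
- by move=> p; rewrite normrM mulrC ler_wpM2r.
Qed.

Lemma int4_indic (A : set (C2 R)) : measurable (A : set (M4 R)) ->
  (leb4 (A : set (M4 R)) < +oo)%E ->
  int4 (\1_A) /\ I4 (\1_A) = fine (leb4 (A : set (M4 R))).
Proof. exact: integrable_indic_lty. Qed.

End real_integral.

(** * Compactly supported functions and integrals of derivatives *)

Section compact_support.
Variable R : realType.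

Definition csupp (V : topologicalType) (f : V -> R) :=
  exists2 K, compact K & forall x, ~ K x -> f x = 0.

Lemma leb2_box (r : R) (I : set (M1 R) := `[- r, r]%classic) :
  measurable (I `*` I : set (M2 R)) /\ (leb2 (I `*` I : set (M2 R)) < +oo)%E.
Proof.
have mI : measurable I by exact: measurable_itv.
have fI : (lebesgue_measure I < +oo)%E by rewrite lebesgue_measure_itv/=; case: ifP; rewrite -?EFinB ltry.
split; first exact: measurableX.
by rewrite /leb2 product_measure1E// lte_mul_pinfty// ge0_fin_numE.
Qed.

Lemma compact_leb4 (K : set (C2 R)) : compact K ->
  measurable (K : set (M4 R)) /\ (leb4 (K : set (M4 R)) < +oo)%E.
Proof.
move=> cK; have mK : measurable (K : set (M4 R)).
  by apply: closed_measurable4; apply: compact_closed => //; exact: norm_hausdorff.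
split=> //; have [M [_ MK]] := compact_bounded cK.
pose r := `|M| + 1; have Mr : M < r by rewrite ltr_pwDr// ler_norm.
pose I := `[- r, r]%classic : set (M1 R); have [mI2 fI2] := leb2_box r.
have fI4 : (leb4 ((I `*` I) `*` (I `*` I) : set (M4 R)) < +oo)%E.
  by rewrite /leb4 product_measure1E// lte_mul_pinfty// ge0_fin_numE.
apply: le_lt_trans fI4; apply: le_measure; rewrite ?inE//.
  exact: measurableX.
move=> [[a b] [c d]] /(MK _ Mr) /=; rewrite !prod_normE/= !ge_max.
move=> /andP[/andP[ha hb] /andP[hc hd]].
by split; split; rewrite /I /= in_itv/= -ler_norml.
Qed.

Lemma continuous_compact_integrable (f : C2 R -> R) (K : set (C2 R)) :
  continuous f -> compact K -> (@leb4 R).-integrable K (EFin \o f).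
Proof.
move=> cf cK; have [mK Kf] := compact_leb4 cK.
have mf := continuous_measurable4 cf.
apply: measurable_bounded_integrable => //; first exact: measurable_funTS.
have /compact_bounded[M [Mr MK]] : compact (f @` K).
  by apply: continuous_compact => //; exact: continuous_subspaceT.
by exists M; split => // x Mx y Ky; apply: MK => //; exists y.
Qed.

Lemma int4_cc (f : C2 R -> R) : continuous f -> csupp f -> int4 f.
Proof.
move=> cf [K cK fK]; have [mK _] := compact_leb4 cK.
move: (continuous_compact_integrable cf cK) => /(integrable_mkcond _ mK); congr (integrable _ _ _).
apply/funext => p; rewrite /patch; case: ifPn => //= /negP; rewrite inE => /fK ->//.
Qed.

Lemma compact_closed_normed (V : normedModType R) (K : set V) : compact K -> closed K.
Proof. by move=> cK; apply: compact_closed => //; exact: norm_hausdorff. Qed.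

Lemma int4_mulcc (F h : C2 R -> R) : continuous F -> continuous h -> csupp h ->
  int4 (fun p => F p * h p).
Proof.
move=> cF ch [K cK zK]; apply: int4_cc.
  by move=> p; apply: cvgM; [exact: cF|exact: ch].
by exists K => // p /zK ->; rewrite mulr0.
Qed.

Lemma I4_0 : I4 (fun=> 0 : R) = 0.
Proof. by rewrite /I4 /Rintegral integral0. Qed.

(** Heine-Cantor with only [x] confined to [K]: the point [y] may leave [K], as points of a small
    ball around a boundary point do. *)
Lemma compact_unif_continuous (V : normedModType R) (f : V -> R) (K : set V)
    (e : R) : compact K -> (forall x, K x -> {for x, continuous f}) -> 0 < e ->
  exists2 d, 0 < d & forall x y, K x -> `|x - y| < d -> `|f x - f y| < e.
Proof.
move=> cK cf e0.
have := (@compact_near_coveringP _ K).1 cK R (0%R^'+)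
  (fun d x => forall y, `|x - y| < d -> `|f x - f y| < e) _.
case.
  move=> x Kx.
  have /nbhs_ballP[d /= d0 dB] : \forall y \near x, `|f x - f y| < e / 2.
    have /cvgrPdist_lt := cf x Kx; apply; first by rewrite divr_gt0.
  exists (ball x (d / 2), [set t : R | t < d / 2]).
    split; first by apply: nbhsx_ballx; rewrite divr_gt0.
    by apply: nbhs_right_lt; rewrite divr_gt0.
  move=> [y t] /= [xy td] z yz.
  have hy : `|f x - f y| < e / 2.
    by apply: dB; apply: le_ball xy; rewrite ler_pdivrMr// ler_pMr// ler1n.
  have hz : `|f x - f z| < e / 2.
    apply: dB; rewrite -ball_normE/= (splitr d).
    rewrite -(subrKA y) (le_lt_trans (ler_normD _ _))// ltrD//.
      by move: xy; rewrite -ball_normE.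
    exact: lt_trans td.
  rewrite -(subrKA (f x)) (le_lt_trans (ler_normD _ _))// (splitr e) ltrD//.
  by rewrite distrC.
move=> d /= d0 dP; exists (d / 2); first by rewrite divr_gt0.
move=> x y Kx xy; apply: (dP (d / 2)) => //=.
  by rewrite /ball/= sub0r normrN gtr0_norm ?divr_gt0// ltr_pdivrMr// ltr_pMr// ltr1n.
by rewrite divr_gt0.
Qed.

Lemma csupp_unif_continuous (V : normedModType R) (f : V -> R) (e : R) :
  continuous f -> csupp f -> 0 < e ->
  exists2 d, 0 < d & forall x y, `|x - y| < d -> `|f x - f y| < e.
Proof.
move=> cf [K cK fK] e0.
have [d d0 dP] := compact_unif_continuous cK (fun x _ => cf x) e0.
exists d => // x y xy.
have [Kx|nKx] := pselect (K x); first exact: dP.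
have [Ky|nKy] := pselect (K y); last by rewrite !fK// subrr normr0.
by rewrite distrC; apply: dP => //; rewrite distrC.
Qed.

Lemma is_derive_line (V : normedModType R) (f : V -> R) (p v : V) (s : R) :
  (forall x, differentiable f x) ->
  is_derive s 1 (fun t => f (p + t *: v)) ('D_v f (p + s *: v)).
Proof.
move=> df; have dv := @diff_derivable _ _ _ f (p + s *: v) v (df _).
suff E : (fun h : R => h^-1 *: (((fun t => f (p + t *: v)) \o shift s) (h *: 1) - f (p + s *: v))) =
    (fun h : R => h^-1 *: ((f \o shift (p + s *: v)) (h *: v) - f (p + s *: v))).
  by split; rewrite /derivable /derive E.
by apply/funext => h /=; rewrite [h%:A]mulr1 scalerDl addrCA.
Qed.

Lemma mean_value_line (V : normedModType R) (f : V -> R) (p v : V) (t : R) :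
  (forall x, differentiable f x) -> 0 < t ->
  exists2 c, 0 < c < t & f (p + t *: v) - f p = t * 'D_v f (p + c *: v).
Proof.
move=> df t0.
have [||c] := @MVT R (fun s => f (p + s *: v)) (fun s => 'D_v f (p + s *: v)) 0 t t0.
- by move=> x _; exact: is_derive_line.
- apply: derivable_within_continuous => x _.
  by have [] := is_derive_line p v x df.
- by rewrite in_itv/= => ct; rewrite scale0r addr0 subr0 mulrC; exists c.
Qed.

Lemma supp_derive (V : normedModType R) (f : V -> R) (K : set V) (v : V) :
  closed K -> (forall x, ~ K x -> f x = 0) -> forall x, ~ K x -> 'D_v f x = 0.
Proof.
move=> clK fK x nKx.
have : \forall y \near x, f y = cst 0 y.
  have /open_nbhs_nbhs : open_nbhs x (~` K) by split; [exact: closed_openC|].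
  by apply: filterS => y /fK.
by move=> /near_eq_derive ->; rewrite derive_cst.
Qed.

(** Contains the support of every difference quotient in direction [v] with step at most 1; it is
    the image of [K] times the unit interval under [(q, s) -> q - s *: v]. *)
Lemma compact_sweep (v : C2 R) (K : set (C2 R)) : compact K ->
  compact [set p | exists2 s : R, s \in `[0, 1] & K (p + s *: v)].
Proof.
move=> cK; pose F (q : C2 R * R) : C2 R := q.1 - q.2 *: v.
have cKI : compact (K `*` (`[0, 1]%classic : set R)) by apply: compact_setX => //; exact: segment_compact.
have : compact (F @` (K `*` (`[0, 1]%classic : set R))).
  apply: continuous_compact => //; apply: continuous_subspaceT => q.
  apply: cvgB; first exact: cvg_fst.
  apply: cvgZ; [exact: cvg_snd|exact: cvg_cst].
congr (compact _); apply/seteqP; split => [_ [[p s] [/= Kp sI] <-]|p [s sI Kp]].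
  by exists s => //; rewrite /F subrK.
by exists (p + s *: v, s) => //; rewrite /F/= addrK.
Qed.

(** By translation invariance the difference quotients of [k] have integral 0, and they converge
    uniformly to the derivative with supports in one compact set. All integration by parts rests on
    this. *)
Lemma I4_derive0 (k : C2 R -> R) (v : C2 R) :
  (forall x, differentiable k x) -> continuous ('D_v k) -> csupp k ->
  int4 ('D_v k) /\ I4 ('D_v k) = 0.
Proof.
move=> dk cDk [K cK kK].
have clK := compact_closed_normed cK.
have ck : continuous k by move=> x; exact: differentiable_continuous.
have sk : csupp k by exists K.
have sDk : csupp ('D_v k).
  by exists K => // x /(supp_derive v clK kK).
have iDk := int4_cc cDk sDk.
split=> //; apply/eqP; rewrite -normr_eq0 eq_le normr_ge0 andbT.
pose K1 : set (C2 R) := [set p | exists2 s : R, s \in `[0, 1] & K (p + s *: v)].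
have [mK1 fK1] := compact_leb4 (compact_sweep cK : compact K1).
have [i1 I1] := int4_indic mK1 fK1.
set m := fine _ in I1.
have m0 : 0 <= m by exact: fine_ge0.
apply/ler_addgt0Pl => e e0; rewrite addr0.
have e1 : 0 < e / (m + 1) by rewrite divr_gt0// ltr_wpDl.
have [d d0 dP] := csupp_unif_continuous cDk sDk e1.
(* The bound [t <= 1] makes the difference quotient vanish off [K1], [t * |v| < d] gives uniform
   closeness to the derivative, and the [+ 1] covers [v = 0]. *)
pose t := Num.min 1 (d / 2 / (`|v| + 1)).
have v1 : 0 < `|v| + 1 by rewrite ltr_wpDl.
have t0 : 0 < t by rewrite lt_min ltr01/= !divr_gt0.
have t1 : t <= 1 by rewrite ge_min lexx.
have td : t * `|v| < d.
  apply: (@le_lt_trans _ _ (d / 2)); last by rewrite ltr_pdivrMr// ltr_pMr// ltr1n.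
  apply: (@le_trans _ _ (d / 2 / (`|v| + 1) * (`|v| + 1))).
    by apply: ler_pM => //; [exact: ltW|rewrite ge_min lexx orbT|rewrite lerDl].
  by rewrite divfK// gt_eqF.
pose q p := t^-1 * (k (p + t *: v) - k p).
have ik := int4_cc ck sk.
have [iks Iks] := I4_shift (t *: v) ik.
have iq : int4 q by exact/int4Z/int4B.
have Iq : I4 q = 0 by rewrite I4Z ?I4B//; [rewrite Iks subrr mulr0|exact: int4B].
rewrite -[I4 _]subr0 -Iq -I4B//; apply: le_trans (I4_norm (int4B iDk iq)) _.
apply: (@le_trans _ _ (I4 (fun p => e / (m + 1) * \1_K1 p))).
  apply: I4_le; [exact/int4_norm/int4B|exact: int4Z|move=> p].
  have [c /andP[c0 ct] E] := mean_value_line p v dk t0.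
  have qE : q p = 'D_v k (p + c *: v) by rewrite /q E mulrA mulVf ?gt_eqF// mul1r.
  rewrite indicE; case: (boolP (p \in K1)) => pK.
    rewrite mulr1 qE; apply/ltW/dP.
    rewrite opprD addrA subrr sub0r normrN normrZ gtr0_norm//.
    by apply: le_lt_trans td; rewrite ler_wpM2r// ltW.
  have nK s : s \in `[0, 1] -> ~ K (p + s *: v).
    by move=> sI Ks; move/negP : pK; apply; rewrite inE; exists s.
  rewrite qE !(supp_derive v clK kK) ?subr0 ?normr0 ?mulr0//.
    by apply: nK; rewrite in_itv/= (ltW c0) (le_trans (ltW ct)).
  by rewrite -[p]addr0 -(scale0r v); apply: nK; rewrite in_itv/= lexx ler01.
rewrite I4Z// I1 -mulrA ler_piMr ?(ltW e0)// mulrC ler_pdivrMr ?mul1r ?lerDl//.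
by rewrite ltr_wpDl.
Qed.

End compact_support.

(** * Smooth bump functions *)

Section flat_function.
Variable R : realType.
Implicit Types (p q : {poly R}) (x y : R).

(** The polynomial factor makes the family stable under differentiation; [flat 1] is the classical
    flat function [exp (- 1 / x)]. *)
Definition flat p x : R := if 0 < x then p.[x^-1] * expR (- x^-1) else 0.

(** The extra power [y ^+ k] serves the induction: one Horner step trades the factor ['X] of the
    polynomial for a larger [k]. *)
Lemma horner_expRN_bounded p k :
  exists2 C, 0 <= C & forall y, 0 <= y -> `|p.[y]| * y ^+ k * expR (- y) <= C.
Proof.
elim/poly_ind: p k => [|p c IH] k.
  by exists 0 => // y y0; rewrite horner0 normr0 !mul0r.
have [C C0 hC] := IH k.+1.
exists (C + `|c| * k`!%:R) => [|y y0]; first by rewrite addr_ge0// mulr_ge0.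
rewrite hornerMXaddC.
have hk : y ^+ k * expR (- y) <= k`!%:R.
  rewrite expRN ler_pdivrMr ?expR_gt0//.
  case: k {IH C C0 hC} => [|k].
    by rewrite expr0 mul1r (le_trans _ (expR_ge1Dx y))// lerDl.
  have h := expR_ge1Dxn k y0.
  have k0 : 0 < (k.+1)`!%:R :> R by rewrite ltr0n fact_gt0.
  rewrite mulrC -ler_pdivrMr//; apply: le_trans h.
  by rewrite lerDr.
apply: (@le_trans _ _ ((`|p.[y]| * y + `|c|) * y ^+ k * expR (- y))).
  rewrite -!mulrA ler_wpM2r ?mulr_ge0 ?exprn_ge0 ?expR_ge0//.
  by rewrite (le_trans (ler_normD _ _))// normrM (ger0_norm y0).
rewrite !mulrDl lerD//; first by rewrite -[_ * y * _]mulrA -exprS hC.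
by rewrite -mulrA ler_wpM2l.
Qed.

Lemma flat_le p : exists2 C, 0 <= C & forall x, `|flat p x| <= C * `|x|.
Proof.
have [C C0 hC] := horner_expRN_bounded p 1; exists C => // x.
rewrite /flat; case: ifPn => x0; last by rewrite normr0 mulr_ge0.
have y0 : 0 <= x^-1 by rewrite invr_ge0 ltW.
rewrite normrM [`|expR _|]ger0_norm ?expR_ge0// (gtr0_norm x0) -ler_pdivrMr//.
by rewrite mulrAC -[x^-1]expr1 hC.
Qed.

(** Exhibits [flat (p * 'X)] as the difference quotient of [flat p] at 0, which is what the
    Caratheodory criterion asks for there. *)
Lemma flatMX p x : flat (p * 'X) x * x = flat p x.
Proof.
rewrite /flat; case: ifPn => x0; last by rewrite mul0r.
by rewrite hornerMX mulrAC mulrVK// unitfE gt_eqF.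
Qed.

Lemma flat0 p : flat p 0 = 0. Proof. by rewrite /flat ltxx. Qed.

Lemma continuous_flat0 p : {for 0, continuous (flat p)}.
Proof.
have [C C0 hC] := flat_le p.
apply/cvgrPdist_lt => e e0; near=> x; rewrite flat0 sub0r normrN.
apply: le_lt_trans (hC x) _.
apply: (@le_lt_trans _ _ ((C + 1) * `|x|)); first by rewrite ler_wpM2r// lerDl.
rewrite mulrC -ltr_pdivlMr ?ltr_wpDl//.
near: x; apply/nbhs_ballP; exists (e / (C + 1)) => /=.
  by rewrite divr_gt0// ltr_wpDl.
by move=> x; rewrite /ball/= sub0r normrN.
Unshelve. all: by end_near. Qed.

Lemma is_derive_flat p x :
  is_derive x 1 (flat p) (flat ('X^2 * (p - p^`())) x).
Proof.
have [x0|x0|->] := ltgtP x 0.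
- rewrite [flat _ x]/flat lt_gtF//.
  apply: (@near_eq_is_derive _ _ _ (cst 0)).
  near=> y; rewrite /flat lt_gtF//.
  by near: y; exact: lt_nbhsl.
- pose h (y : R) : R := p.[y^-1] * expR (- y^-1).
  apply: (@near_eq_is_derive _ _ _ h).
    near=> y; rewrite /flat ifT//.
    by near: y; exact: lt_nbhsr.
  have dV : is_derive x 1 (fun y : R => y^-1) (- x ^- 2).
    have := @is_deriveV R id x 1 1 (lt0r_neq0 x0) (is_derive_id _ _).
    by rewrite scaler1.
  have dp : is_derive x^-1 1 (horner p) p^`().[x^-1].
    by rewrite derivE derive1E; apply: derivableP; exact: derivable_horner.
  have dh := is_deriveM (is_derive1_comp dp dV)
    (is_derive1_comp (is_derive_expR _) (is_deriveN dV)).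
  apply: is_derive_eq dh _.
  rewrite /flat x0 !hornerE /= /GRing.scale/=.
  by rewrite exprVn; ring.
- rewrite flat0; apply/is_derive1_caratheodory; exists (flat (p * 'X)).
  split; [|exact: continuous_flat0|exact: flat0].
  by move=> z; rewrite flat0 !subr0 flatMX.
Unshelve. all: by end_near. Qed.

End flat_function.

Section infinitely_derivable.
Variable R : realType.
Implicit Types f g : R -> R.

Definition cinf f : Prop := forall n (x : R), derivable (derive1n n f) x 1.

(** Coinduction principle: a class of derivable functions stable under derivation consists of smooth
    functions. The several-variable analogue is [smooth_class]. *)
Lemma cinf_class (P : (R -> R) -> Prop) :
  (forall f, P f -> forall x : R, derivable f x 1) ->
  (forall f, P f -> P f^`()%classic) -> forall f, P f -> cinf f.
Proof.
move=> Pd PD f Pf n; elim: n f Pf => [|n IH] f Pf x; first exact: Pd.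
by rewrite derive1Sn; apply: IH; exact: PD.
Qed.

Lemma cinf_derivable f (x : R) : cinf f -> derivable f x 1.
Proof. by move=> /(_ 0%N). Qed.

Lemma cinf_derive1 f : cinf f -> cinf f^`()%classic.
Proof. by move=> cf n x; rewrite -derive1Sn. Qed.

Lemma cinf_continuous f : cinf f -> continuous f.
Proof.
by move=> cf x; apply/differentiable_continuous/derivable1_diffP/cinf_derivable.
Qed.

Definition bump (a b : R) (x : R) : R := flat 1 (b - x) * flat 1 (x - a).

Inductive bump_class (a b : R) : (R -> R) -> Prop :=
| bump_prod p q : bump_class a b (fun x => flat p (b - x) * flat q (x - a))
| bump_add f g : bump_class a b f -> bump_class a b g ->
    bump_class a b (fun x => f x + g x).

Lemma flatN (p : {poly R}) x : flat (- p) x = - flat p x.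
Proof. by rewrite /flat; case: ifP; rewrite ?oppr0// hornerN mulNr. Qed.

Lemma bump_class_derive (a b : R) f : bump_class a b f ->
  exists2 g, bump_class a b g & forall x : R, is_derive x 1 f (g x).
Proof.
elim=> [p q|f1 f2 _ [g1 cg1 dg1] _ [g2 cg2 dg2]].
  pose d (r : {poly R}) := 'X^2 * (r - r^`()).
  exists (fun x => flat (- d p) (b - x) * flat q (x - a) +
                   flat p (b - x) * flat (d q) (x - a)).
    by apply: bump_add; exact: bump_prod.
  move=> x.
  have d1 : is_derive x 1 (fun x => flat p (b - x)) (flat (- d p) (b - x)).
    have db := is_deriveB (is_derive_cst b x 1) (is_derive_id x 1).
    apply: is_derive_eq (is_derive1_comp (is_derive_flat p _) db) _.
    by rewrite sub0r mulrN1 flatN.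
  have d2 : is_derive x 1 (fun x => flat q (x - a)) (flat (d q) (x - a)).
    have da := is_deriveB (is_derive_id x 1) (is_derive_cst a x 1).
    apply: is_derive_eq (is_derive1_comp (is_derive_flat q _) da) _.
    by rewrite subr0 mulr1.
  apply: is_derive_eq (is_deriveM d1 d2) _.
  by rewrite /GRing.scale/= addrC mulrC [flat p _ * _]mulrC mulrC; ring.
exists (fun x => g1 x + g2 x); first exact: bump_add.
by move=> x; exact: is_deriveD.
Qed.

Lemma cinf_bump a b : cinf (bump a b).
Proof.
apply: (@cinf_class (bump_class a b)) (bump_prod a b 1 1).
  by move=> f /bump_class_derive[g _ dg] x; have [] := dg x.
move=> f /bump_class_derive[g cg dg]; suff -> : f^`()%classic = g by [].
by apply/funext => x; rewrite derive1E; have [_ ->] := dg x.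
Qed.

Lemma bump_ge0 a b x : 0 <= bump a b x.
Proof.
have h (y : R) : 0 <= flat 1 y by rewrite /flat; case: ifP => // _; rewrite hornerC mul1r expR_ge0.
by rewrite mulr_ge0.
Qed.

Lemma bump_gt0 a b x : a < x < b -> 0 < bump a b x.
Proof.
move=> /andP[ax xb].
have h (y : R) : 0 < y -> 0 < flat 1 y by rewrite /flat => ->; rewrite hornerC mul1r expR_gt0.
by rewrite mulr_gt0// h// subr_gt0.
Qed.

Lemma bump_out a b x : ~~ (a < x < b) -> bump a b x = 0.
Proof.
rewrite negb_and -!leNgt => /orP[xa|bx]; rewrite /bump /flat.
  by rewrite (ltNge 0 (x - a)) subr_le0 xa/= mulr0.
by rewrite (ltNge 0 (b - x)) subr_le0 bx/= mul0r.
Qed.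

End infinitely_derivable.

Section smooth_functions.
Variable R : realType.

Lemma smooth_class (V W : normedModType R) (P : (V -> W) -> Prop) :
  (forall f, P f -> forall x, differentiable f x) ->
  (forall f v, P f -> P ('D_v f)) -> forall f, P f -> smooth f.
Proof.
move=> Pd PD f Pf vs x; apply: Pd.
by elim: vs => //= v vs IH; exact: PD.
Qed.

Lemma smooth_differentiable (V W : normedModType R) (f : V -> W) x :
  smooth f -> differentiable f x.
Proof. by move=> /(_ [::] x). Qed.

Lemma smooth_derive (V W : normedModType R) (f : V -> W) v :
  smooth f -> smooth ('D_v f).
Proof. by move=> sf vs x; have := sf (rcons vs v) x; rewrite /iter_derive foldr_rcons. Qed.

Lemma smooth_continuous (V W : normedModType R) (f : V -> W) :
  smooth f -> continuous f.
Proof. by move=> sf x; exact/differentiable_continuous/smooth_differentiable. Qed.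

Lemma derive_comp (V : normedModType R) (f : V -> R) (g : R -> R) (x v : V) (df dg : R) :
  differentiable f x -> is_derive x v f df -> is_derive (f x) 1 g dg ->
  differentiable (fun y => g (f y)) x /\ is_derive x v (fun y => g (f y)) (df * dg).
Proof.
move=> dif [_ <-] [derg <-].
have dig : differentiable g (f x) by exact/derivable1_diffP.
have digf : differentiable (g \o f) x by exact: differentiable_comp.
split; first exact: digf.
apply: DeriveDef; first exact: diff_derivable.
by rewrite (deriveE v digf) (diff_comp dif dig) /= diff1E// derive1E (deriveE v dif).
Qed.

Definition coord4 (i : 'I_4) (p : C2 R) : R :=
  [:: p.1.1; p.1.2; p.2.1; p.2.2]`_i.

Lemma coord4_linear i : linear (coord4 i).
Proof. by case: i => -[|[|[|[|//]]]] ?. Qed.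

HB.instance Definition _ i :=
  GRing.isLinear.Build R (C2 R) R *:%R (coord4 i) (coord4_linear i).

Lemma coord4_continuous i : continuous (coord4 i).
Proof.
case: i => -[|[|[|[|//]]]] ? p; rewrite /coord4/=.
- by apply: (@cvg_comp _ _ _ fst fst _ (nbhs p.1)); exact: cvg_fst.
- by apply: (@cvg_comp _ _ _ fst snd _ (nbhs p.1)); [exact: cvg_fst|exact: cvg_snd].
- by apply: (@cvg_comp _ _ _ snd fst _ (nbhs p.2)); [exact: cvg_snd|exact: cvg_fst].
- by apply: (@cvg_comp _ _ _ snd snd _ (nbhs p.2)); exact: cvg_snd.
Qed.

Lemma coord_derive (i : 'I_4) (p v : C2 R) :
  differentiable (coord4 i) p /\ is_derive p v (coord4 i) (coord4 i v).
Proof.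
have dl : differentiable (coord4 i) p by by apply: linear_differentiable; exact: coord4_continuous.
split; first exact: dl.
apply: DeriveDef; first exact: diff_derivable.
by rewrite (deriveE v dl) diff_lin//; exact: coord4_continuous.
Qed.

Lemma cinf_coord_derive (g : R -> R) i x v : cinf g ->
  differentiable (fun y => g (coord4 i y)) x /\
  is_derive x v (fun y => g (coord4 i y)) (coord4 i v * g^`()%classic (coord4 i x)).
Proof.
move=> cg; have [d D] := coord_derive i x v; apply: (derive_comp d D).
by rewrite derive1E; apply: derivableP; exact: cinf_derivable.
Qed.

Lemma coord_continuous :
  [/\ continuous (fun p : C2 R => p.1.1), continuous (fun p : C2 R => p.1.2),
      continuous (fun p : C2 R => p.2.1) & continuous (fun p : C2 R => p.2.2)].
Proof.
have c := coord4_continuous; split.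
- exact: (c (@Ordinal 4 0 isT)). - exact: (c (@Ordinal 4 1 isT)).
- exact: (c (@Ordinal 4 2 isT)). - exact: (c (@Ordinal 4 3 isT)).
Qed.

Definition prod4 (g : R -> R) (h : R -> R) (k : R -> R) (l : R -> R) (p : C2 R) : R :=
  g p.1.1 * h p.1.2 * k p.2.1 * l p.2.2.

Lemma prod4_derive g h k l x (v : C2 R) :
  cinf g -> cinf h -> cinf k -> cinf l ->
  differentiable (prod4 g h k l) x /\
  'D_v (prod4 g h k l) x =
    v.1.1 * prod4 g^`()%classic h k l x + v.1.2 * prod4 g h^`()%classic k l x +
    v.2.1 * prod4 g h k^`()%classic l x + v.2.2 * prod4 g h k l^`()%classic x.
Proof.
move=> cg ch ck cl.
pose i0 : 'I_4 := @Ordinal 4 0 isT; pose i1 : 'I_4 := @Ordinal 4 1 isT.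
pose i2 : 'I_4 := @Ordinal 4 2 isT; pose i3 : 'I_4 := @Ordinal 4 3 isT.
have [dg Dg] := cinf_coord_derive i0 x v cg.
have [dh Dh] := cinf_coord_derive i1 x v ch.
have [dk Dk] := cinf_coord_derive i2 x v ck.
have [dl Dl] := cinf_coord_derive i3 x v cl.
split.
  exact: (differentiableM (differentiableM (differentiableM dg dh) dk) dl).
have [_ D] := is_deriveM (is_deriveM (is_deriveM Dg Dh) Dk) Dl.
transitivity ('D_v ((((fun y => g (coord4 i0 y)) * (fun y => h (coord4 i1 y))) *
  (fun y => k (coord4 i2 y))) * (fun y => l (coord4 i3 y))) x); first by [].
by rewrite D !fctE /prod4 /coord4 /GRing.scale/=; ring.
Qed.

Lemma prod4_deriveE g h k l (v : C2 R) : cinf g -> cinf h -> cinf k -> cinf l ->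
  'D_v (prod4 g h k l) = fun x =>
    v.1.1 * prod4 g^`()%classic h k l x + v.1.2 * prod4 g h^`()%classic k l x +
    v.2.1 * prod4 g h k^`()%classic l x + v.2.2 * prod4 g h k l^`()%classic x.
Proof. by move=> cg ch ck cl; apply/funext => x; have [] := prod4_derive x v cg ch ck cl. Qed.

(** Contains the product bumps and is stable under all directional derivatives: the product rule
    produces exactly the scalings and sums allowed here. *)
Inductive prod4_class : (C2 R -> R) -> Prop :=
| prod4_prod g h k l : cinf g -> cinf h -> cinf k -> cinf l ->
    prod4_class (prod4 g h k l)
| prod4_scale c f : prod4_class f -> prod4_class (fun p => c * f p)
| prod4_add f1 f2 : prod4_class f1 -> prod4_class f2 ->
    prod4_class (fun p => f1 p + f2 p).

Lemma prod4_class_derive f : prod4_class f ->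
  (forall x, differentiable f x) /\ forall v, prod4_class ('D_v f).
Proof.
elim=> [g h k l cg ch ck cl|c f1 _ [d1 D1]|f1 f2 _ [d1 D1] _ [d2 D2]].
- split=> [x|v]; first by have [] := prod4_derive x 0 cg ch ck cl.
  rewrite (prod4_deriveE v cg ch ck cl).
  have [cg' ch'] := (cinf_derive1 cg, cinf_derive1 ch).
  have [ck' cl'] := (cinf_derive1 ck, cinf_derive1 cl).
  exact: (prod4_add (prod4_add (prod4_add
    (prod4_scale _ (prod4_prod cg' ch ck cl)) (prod4_scale _ (prod4_prod cg ch' ck cl)))
    (prod4_scale _ (prod4_prod cg ch ck' cl))) (prod4_scale _ (prod4_prod cg ch ck cl'))).
- split=> [x|v]; first exact: differentiableZ.
  have -> : 'D_v (fun p => c * f1 p) = fun x => c * 'D_v f1 x.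
    by apply/funext => x; rewrite (deriveZ c (diff_derivable (d1 x))).
  exact: prod4_scale.
- split=> [x|v]; first exact: differentiableD.
  have -> : 'D_v (fun p => f1 p + f2 p) = fun x => 'D_v f1 x + 'D_v f2 x.
    by apply/funext => x; rewrite (deriveD (diff_derivable (d1 x)) (diff_derivable (d2 x))).
  exact: prod4_add.
Qed.

Lemma prod4_class_smooth f : prod4_class f -> smooth f.
Proof.
apply: smooth_class => g.
  by move=> /prod4_class_derive[].
by move=> v /prod4_class_derive[].
Qed.

(** Second-order Taylor formula with an error uniform in [x]: the mean value theorem is used twice,
    and the second derivative is uniformly continuous because its support is compact. *)
Lemma second_difference (V : normedModType R) (f : V -> R) (v : V) (e : R) :
  smooth f -> csupp f -> 0 < e ->
  exists2 d, 0 < d & forall x t, 0 < t < d ->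
    `|f (x + t *: v) + f (x - t *: v) - 2 * f x - t ^+ 2 * 'D_v ('D_v f) x|
      <= e * t ^+ 2.
Proof.
move=> sf [K cK fK] e0.
have clK := compact_closed_normed cK.
have sD := smooth_derive v sf; have sDD := smooth_derive v sD.
have e2 : 0 < e / 2 by rewrite divr_gt0.
have cDD : csupp ('D_v ('D_v f)).
  by exists K => // x; apply: supp_derive => // y; exact: supp_derive.
have [d d0 dP] := csupp_unif_continuous (smooth_continuous sDD) cDD e2.
have v1 : 0 < `|v| + 1 by rewrite ltr_wpDl.
exists (d / (`|v| + 1)) => [|x t /andP[t0 td]]; first by rewrite divr_gt0.
have [A AE] : {A : R | 'D_v ('D_v f) x = A} by exists ('D_v ('D_v f) x).
rewrite AE.
pose g (s : R) : R := f (x + s *: v) + f (x - s *: v) - 2 * f x - s ^+ 2 * A.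
pose g' (s : R) : R := 'D_v f (x + s *: v) - 'D_v f (x - s *: v) - 2 * s * A.
have df y := smooth_differentiable y sf.
have dg (s : R) : is_derive s 1 g (g' s).
  have D1 := is_derive_line x v s df.
  have D2 : is_derive s 1 (fun s => f (x - s *: v)) (- 'D_v f (x - s *: v)).
    have := is_derive1_comp (is_derive_line x v (- s) df) (is_deriveN (is_derive_id s 1)).
    rewrite mulrN1 /comp scaleNr.
    by under eq_fun do rewrite scaleNr.
  have D3 : is_derive s 1 (fun s => s ^+ 2 * A) (2 * s * A).
    have di := is_derive_id s (1 : R).
    apply: is_derive_eq (is_deriveM (is_deriveM di di) (is_derive_cst A s 1)) _.
    by rewrite /GRing.scale/=; ring.
  apply: is_derive_eq (is_deriveB (is_deriveB (is_deriveD D1 D2)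
    (is_derive_cst (2 * f x) s 1)) D3) _.
  by rewrite subr0.
have [|c] := @MVT R g g' 0 t t0 (fun s _ => dg s).
  apply: derivable_within_continuous => s _.
  by have [] := dg s.
rewrite in_itv/= => /andP[c0 ct]; rewrite subr0.
have -> : g 0 = 0 by rewrite /g scale0r addr0 subr0 expr0n mul0r subr0; ring.
rewrite subr0 -/(g t) => ->.
have cc : 0 < 2 * c by rewrite mulr_gt0.
(* Second use of the mean value theorem, on the segment from [x - c *: v] to [x + c *: v], for the
   difference of first derivatives in [g' c]. *)
have [b /andP[b0 bc] E] := mean_value_line (x - c *: v) v (fun y => smooth_differentiable y sD) cc.
have -> : g' c = 2 * c * ('D_v ('D_v f) (x - c *: v + b *: v) - A).
  have xe : x - c *: v + (2 * c) *: v = x + c *: v.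
    by rewrite mulrDl mul1r scalerDl addrA subrK.
  by rewrite mulrBr -E xe.
rewrite !normrM (gtr0_norm t0) (gtr0_norm c0) ger0_norm//.
have : `|'D_v ('D_v f) (x - c *: v + b *: v) - A| <= e / 2.
  rewrite -AE distrC; apply/ltW/dP.
  have -> : x - (x - c *: v + b *: v) = (c - b) *: v.
    by rewrite scalerBl !opprD opprK !addrA subrr add0r.
  rewrite normrZ.
  apply: (@le_lt_trans _ _ (t * `|v|)).
    rewrite ler_wpM2r// ler_norml.
    by move: b0 bc c0 ct; clear; move=> *; apply/andP; split; lra.
  apply: (@le_lt_trans _ _ (t * (`|v| + 1))); first by rewrite ler_wpM2l ?ltW// ltrDl.
  by rewrite -ltr_pdivlMr.
move=> /(ler_wpM2l (ltW c0)) h.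
have : c * (e / 2) <= t * (e / 2) by rewrite ler_wpM2r// ltW.
move=> /(le_trans h) /(ler_wpM2l (ltW t0)) h2.
by apply: le_trans (_ : _ <= 2 * (t * (t * (e / 2)))) _; move: h2; clear; rewrite ?expr2; lra.
Qed.

End smooth_functions.

Section mollifier.
Variable R : realType.
Implicit Types (p q x y xi : C2 R) (e t : R).

(** Not normalised: the mass [I4 (rho e)] is carried as a factor in the bounds instead. *)
Definition rho e x : R :=
  prod4 (bump (- e) e) (bump (- e) e) (bump (- e) e) (bump (- e) e) x.

Lemma bump_shift e a (y : R) : bump (a - e) (a + e) y = bump (- e) e (y - a).
Proof. by rewrite /bump; congr (flat _ _ * flat _ _); ring. Qed.

Lemma rho_shift e p : (fun y => rho e (y - p)) =
  prod4 (bump (p.1.1 - e) (p.1.1 + e)) (bump (p.1.2 - e) (p.1.2 + e))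
        (bump (p.2.1 - e) (p.2.1 + e)) (bump (p.2.2 - e) (p.2.2 + e)).
Proof. by apply/funext => y; rewrite /prod4 !bump_shift. Qed.

Lemma rho_class e p : prod4_class (fun y => rho e (y - p)).
Proof. by rewrite rho_shift; apply: prod4_prod; exact: cinf_bump. Qed.

Lemma rho_smooth e p : smooth (fun y => rho e (y - p)).
Proof. by apply: prod4_class_smooth; exact: rho_class. Qed.

Lemma rho_continuous e : continuous (rho e).
Proof.
have := smooth_continuous (@rho_smooth e 0).
by under [X in continuous X]eq_fun do rewrite subr0.
Qed.

Lemma rho_ge0 e x : 0 <= rho e x.
Proof. by have b := bump_ge0 (- e) e; exact: mulr_ge0 (mulr_ge0 (mulr_ge0 (b _) (b _)) (b _)) (b _). Qed.

Lemma rhoN e x : rho e (- x) = rho e x.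
Proof.
have bN (y : R) : bump (- e) e (- y) = bump (- e) e y.
  by rewrite /bump mulrC; congr (flat _ _ * flat _ _); ring.
by rewrite /rho /prod4 /= !bN.
Qed.

Lemma norm4_lt x e : (`|x| < e) =
  [&& `|x.1.1| < e, `|x.1.2| < e, `|x.2.1| < e & `|x.2.2| < e].
Proof. by rewrite !prod_normE !gt_max -!andbA. Qed.

Lemma norm4_le x e : (`|x| <= e) =
  [&& `|x.1.1| <= e, `|x.1.2| <= e, `|x.2.1| <= e & `|x.2.2| <= e].
Proof. by rewrite !prod_normE !ge_max -!andbA. Qed.

Lemma rho_out e x : e <= `|x| -> rho e x = 0.
Proof.
rewrite leNgt norm4_lt /rho /prod4 => h.
have bo (y : R) : ~~ (`|y| < e) -> bump (- e) e y = 0.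
  by move=> ye; apply: bump_out; rewrite -ltr_norml.
by move: h; rewrite !negb_and => /or4P[] /bo ->; rewrite ?(mulr0, mul0r).
Qed.

Lemma rho_gt0 e x : `|x| < e -> 0 < rho e x.
Proof.
have b (y : R) : `|y| < e -> 0 < bump (- e) e y by rewrite ltr_norml; exact: bump_gt0.
rewrite norm4_lt => /and4P[/b b1 /b b2 /b b3 /b b4].
exact: mulr_gt0 (mulr_gt0 (mulr_gt0 b1 b2) b3) b4.
Qed.

Definition cball4 p e : set (C2 R) := [set y | `|y - p| <= e].

Lemma compact_ball4 p e : compact (cball4 p e).
Proof.
pose I (a : R) : set R := `[a - e, a + e]%classic.
have cI a : compact (I a) by exact: segment_compact.
have := compact_setX (compact_setX (cI p.1.1) (cI p.1.2))
  (compact_setX (cI p.2.1) (cI p.2.2)).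
congr (compact _); apply/seteqP; split => y /=.
  move=> [[]]; rewrite /I/= !in_itv/= => h1 h2 [h3 h4].
  by rewrite /cball4/= norm4_le/= !ler_distl h1 h2 h3 h4.
rewrite /cball4/= norm4_le/= !ler_distl => /and4P[h1 h2 h3 h4].
by split; split; rewrite /I/= in_itv/=.
Qed.

Lemma rho_csupp e p : csupp (fun y => rho e (y - p)).
Proof.
exists (cball4 p e); first exact: compact_ball4.
by move=> y; rewrite /cball4/= => /negP; rewrite -ltNge => /ltW; exact: rho_out.
Qed.

Lemma leb4_ball_gt0 p e : 0 < e -> (0 < leb4 (cball4 p e : set (M4 R)))%E.
Proof.
move=> e0; pose I (a : R) : set (M1 R) := `[a - e, a + e]%classic.
have mI a : measurable (I a) by exact: measurable_itv.
have lI a : (0 < lebesgue_measure (I a))%E.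
  rewrite lebesgue_measure_itv/= lte_fin ifT; last by rewrite ltrD2l gtrN.
  by rewrite -EFinB lte_fin subr_gt0 ltrD2l gtrN.
have mI2 a b : measurable (I a `*` I b : set (M2 R)) by exact: measurableX.
have lI2 a b : (0 < leb2 (I a `*` I b : set (M2 R)))%E.
  by rewrite /leb2 (product_measure1E _ _ (mI a) (mI b)) mule_gt0 ?lI.
suff -> : cball4 p e =
    (I p.1.1 `*` I p.1.2) `*` (I p.2.1 `*` I p.2.2) :> set (M4 R).
  by rewrite /leb4 (product_measure1E _ _ (mI2 _ _) (mI2 _ _)) mule_gt0 ?lI2.
apply/seteqP; split => y /=.
  rewrite /cball4/= norm4_le/= !ler_distl => /and4P[h1 h2 h3 h4].
  by split; split; rewrite /I/= in_itv/=.
move=> [[]]; rewrite /I/= !in_itv/= => h1 h2 [h3 h4].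
by rewrite /cball4/= norm4_le/= !ler_distl h1 h2 h3 h4.
Qed.

Lemma open_not_negligible (O : set (C2 R)) p : open O -> O p ->
  ~ (@leb4 R).-negligible (O : set (M4 R)).
Proof.
move=> oO Op [N [mN N0 ON]].
have /nbhs_ballP[r /= r0 rO] : nbhs p O by exact: open_nbhs_nbhs.
have r2 : 0 < r / 2 by rewrite divr_gt0.
have := leb4_ball_gt0 p r2; rewrite ltNge => /negP; apply.
rewrite -N0; apply: le_measure; rewrite ?inE//.
  apply: closed_measurable4; apply: compact_closed; last exact: compact_ball4.
  exact: norm_hausdorff.
move=> y; rewrite /cball4/= => yp; apply: ON; apply: rO; rewrite -ball_normE/= distrC.
by apply: le_lt_trans yp _; rewrite ltr_pdivrMr// ltr_pMr// ltr1n.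
Qed.

Lemma int4_rho e p : int4 (fun y => rho e (y - p)).
Proof. by apply: int4_cc; [exact/smooth_continuous/rho_smooth|exact: rho_csupp]. Qed.

Lemma rho_csupp0 e : csupp (rho e).
Proof. by have := rho_csupp e 0; under [X in csupp X]eq_fun do rewrite subr0. Qed.

Lemma int4_rho0 e : int4 (rho e).
Proof. exact: int4_cc (@rho_continuous e) (rho_csupp0 e). Qed.

Lemma I4_rho_shift e p : I4 (fun y => rho e (y - p)) = I4 (rho e).
Proof. by have [_ ->] := I4_shift (- p) (int4_rho0 e). Qed.

Lemma I4_rho_gt0 e : 0 < e -> 0 < I4 (rho e).
Proof.
move=> e0; have e2 : 0 < e / 2 by rewrite divr_gt0.
pose K : set (C2 R) := cball4 0 (e / 2).
have cK : compact K by exact: compact_ball4.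
have [mK fK] := compact_leb4 cK.
have [iK IK] := int4_indic mK fK.
have K0 : K !=set0 by exists 0; rewrite /K/cball4/= subr0 normr0 ltW.
have [c /set_mem Kc cmin] := compact_EVT_min K0 cK (continuous_subspaceT (@rho_continuous e)).
have rc : 0 < rho e c.
  apply: rho_gt0; move: Kc; rewrite /K/cball4/= subr0 => /le_lt_trans; apply.
  by rewrite ltr_pdivrMr// ltr_pMr// ltr1n.
apply: (@lt_le_trans _ _ (rho e c * I4 (\1_K))).
  rewrite mulr_gt0// IK fine_gt0// fK andbT; exact: leb4_ball_gt0.
rewrite -I4Z//; apply: I4_le; [exact: int4Z|exact: int4_rho0|].
move=> y; rewrite indicE; case: (boolP (y \in K)) => yK; last by rewrite mulr0 rho_ge0.
by rewrite mulr1 cmin.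
Qed.

End mollifier.

(** * Mollification and positivity of the Levi form *)

Section levi.
Variable R : realType.
Implicit Types (p q x y xi : C2 R) (e t : R).

Definition mulI xi : C2 R := ((- xi.1.2, xi.1.1), (- xi.2.2, xi.2.1)).

(** Four times the Levi form of [f] evaluated on [xi]. *)
Definition levi_lap xi (f : C2 R -> R) y : R :=
  'D_xi ('D_xi f) y + 'D_(mulI xi) ('D_(mulI xi) f) y.

(* [f] times [i alpha /\ conj alpha], where the covector
   [alpha = xi_2 dz - xi_1 dtau] annihilates [xi]; applying [dd^c] to it leaves
   only the Laplacian of [f] along the complex line of [xi]. *)
Definition levi_form xi (f : C2 R -> R) : form11 := Form11
  (fun y => (xi.2.1 ^+ 2 + xi.2.2 ^+ 2) * f y)
  (fun y => (xi.1.1 ^+ 2 + xi.1.2 ^+ 2) * f y)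
  (fun y => - (xi.1.1 * xi.2.1 + xi.1.2 * xi.2.2) * f y)
  (fun y => - (xi.1.1 * xi.2.2 - xi.1.2 * xi.2.1) * f y).

Lemma normcE (a : R[i]) : complex.ComplexField.Normc.normc a ^+ 2 =
  complex.Re a ^+ 2 + complex.Im a ^+ 2.
Proof. by case: a => a b /=; rewrite sqr_sqrtr// addr_ge0// sqr_ge0. Qed.

(** The Hermitian form at [(a, b)] is [f y * |xi_2 a - xi_1 b|^2], expanded below as a sum of two
    squares. *)
Lemma levi_form_positive xi f : (forall y, 0 <= f y) ->
  positive_form (levi_form xi f).
Proof.
move=> f0 y [a1 a2] [b1 b2]; rewrite !normcE /levi_form /=.
case: xi => [[x1 x2] [x3 x4]] /=.
suff -> : (x3 ^+ 2 + x4 ^+ 2) * f y * (a1 ^+ 2 + a2 ^+ 2) +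
  2 * complex.Re ((- (x1 * x3 + x2 * x4) * f y +i* (- (x1 * x4 - x2 * x3) * f y)) *
       (a1 +i* a2) * (b1 +i* b2)^*)%C +
  (x1 ^+ 2 + x2 ^+ 2) * f y * (b1 ^+ 2 + b2 ^+ 2) =
  f y * ((x3 * a1 - x4 * a2 - x1 * b1 + x2 * b2) ^+ 2 +
         (x3 * a2 + x4 * a1 - x1 * b2 - x2 * b1) ^+ 2) :> R.
  by rewrite mulr_ge0// addr_ge0// sqr_ge0.
by simpc; rewrite /=; ring.
Qed.

Lemma deriveZE (c : R) (f : C2 R -> R) v : (forall x, differentiable f x) ->
  'D_v (fun y => c * f y) = fun y => c * 'D_v f y.
Proof. by move=> df; apply/funext => x; rewrite (deriveZ c (diff_derivable (df x))). Qed.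

Lemma prod4_derive2 g h k l (u v : C2 R) x : cinf g -> cinf h -> cinf k -> cinf l ->
  let g' := g^`()%classic in let h' := h^`()%classic in
  let k' := k^`()%classic in let l' := l^`()%classic in
  'D_u ('D_v (prod4 g h k l)) x =
    v.1.1 * (u.1.1 * prod4 g'^`()%classic h k l x + u.1.2 * prod4 g' h' k l x +
             u.2.1 * prod4 g' h k' l x + u.2.2 * prod4 g' h k l' x) +
    v.1.2 * (u.1.1 * prod4 g' h' k l x + u.1.2 * prod4 g h'^`()%classic k l x +
             u.2.1 * prod4 g h' k' l x + u.2.2 * prod4 g h' k l' x) +
    v.2.1 * (u.1.1 * prod4 g' h k' l x + u.1.2 * prod4 g h' k' l x +
             u.2.1 * prod4 g h k'^`()%classic l x + u.2.2 * prod4 g h k' l' x) +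
    v.2.2 * (u.1.1 * prod4 g' h k l' x + u.1.2 * prod4 g h' k l' x +
             u.2.1 * prod4 g h k' l' x + u.2.2 * prod4 g h k l'^`()%classic x).
Proof.
move=> cg ch ck cl g' h' k' l'.
have [cg' ch'] := (cinf_derive1 cg, cinf_derive1 ch).
have [ck' cl'] := (cinf_derive1 ck, cinf_derive1 cl).
rewrite (prod4_deriveE v cg ch ck cl) -/g' -/h' -/k' -/l'.
have Z (c : R) a1 a2 a3 a4 : cinf a1 -> cinf a2 -> cinf a3 -> cinf a4 ->
    is_derive x u (fun y => c * prod4 a1 a2 a3 a4 y)
                  (c * 'D_u (prod4 a1 a2 a3 a4) x).
  move=> c1 c2 c3 c4; have [d _] := prod4_derive x u c1 c2 c3 c4.
  exact: (is_deriveZ c (derivableP (diff_derivable d))).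
have [_ E] := is_deriveD (is_deriveD (is_deriveD
  (Z v.1.1 _ _ _ _ cg' ch ck cl) (Z v.1.2 _ _ _ _ cg ch' ck cl))
  (Z v.2.1 _ _ _ _ cg ch ck' cl)) (Z v.2.2 _ _ _ _ cg ch ck cl').
apply: etrans E _.
have [_ ->] := prod4_derive x u cg' ch ck cl.
have [_ ->] := prod4_derive x u cg ch' ck cl.
have [_ ->] := prod4_derive x u cg ch ck' cl.
by have [_ ->] := prod4_derive x u cg ch ck cl'.
Qed.

Lemma ddc_formE (eta : form11) x (zxx zyy tss ttt rxs ryt ixt iys : R) :
  'D_((1, 0), (0, 0)) ('D_((1, 0), (0, 0)) (h22 eta)) x = zxx ->
  'D_((0, 1), (0, 0)) ('D_((0, 1), (0, 0)) (h22 eta)) x = zyy ->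
  'D_((0, 0), (1, 0)) ('D_((0, 0), (1, 0)) (h11 eta)) x = tss ->
  'D_((0, 0), (0, 1)) ('D_((0, 0), (0, 1)) (h11 eta)) x = ttt ->
  'D_((1, 0), (0, 0)) ('D_((0, 0), (1, 0)) (h12re eta)) x = rxs ->
  'D_((0, 1), (0, 0)) ('D_((0, 0), (0, 1)) (h12re eta)) x = ryt ->
  'D_((1, 0), (0, 0)) ('D_((0, 0), (0, 1)) (h12im eta)) x = ixt ->
  'D_((0, 1), (0, 0)) ('D_((0, 0), (1, 0)) (h12im eta)) x = iys ->
  ddc_form eta x = (2 * pi)^-1 *
    (zxx + zyy + tss + ttt - 2 * (rxs + ryt + ixt - iys)).
Proof. by move=> <- <- <- <- <- <- <- <-. Qed.

(** For a function with separated variables the mixed second derivatives are explicit and visibly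
    symmetric, so the cancellation of the terms transverse to [xi] is a ring identity. *)
Lemma ddc_levi_form g h k l xi x : cinf g -> cinf h -> cinf k -> cinf l ->
  ddc_form (levi_form xi (prod4 g h k l)) x =
  (2 * pi)^-1 * levi_lap xi (prod4 g h k l) x.
Proof.
move=> cg ch ck cl.
have Z (c : R) (u v : C2 R) :
    'D_u ('D_v (fun y => c * prod4 g h k l y)) x = c * 'D_u ('D_v (prod4 g h k l)) x.
  have sf := prod4_class_smooth (prod4_prod cg ch ck cl).
  rewrite deriveZE => [|y]; last exact: smooth_differentiable.
  exact: (deriveZ c (diff_derivable (smooth_differentiable x (smooth_derive v sf)))).
have P u v := prod4_derive2 u v x cg ch ck cl.
have ZP c u v := etrans (Z c u v) (congr1 ( *%R c) (P u v)).
pose ex : C2 R := ((1, 0), (0, 0)); pose ey : C2 R := ((0, 1), (0, 0)).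
pose es : C2 R := ((0, 0), (1, 0)); pose et : C2 R := ((0, 0), (0, 1)).
pose c2 := xi.1.1 ^+ 2 + xi.1.2 ^+ 2; pose c1 := xi.2.1 ^+ 2 + xi.2.2 ^+ 2.
pose cr := - (xi.1.1 * xi.2.1 + xi.1.2 * xi.2.2).
pose ci := - (xi.1.1 * xi.2.2 - xi.1.2 * xi.2.1).
have := @ddc_formE (levi_form xi (prod4 g h k l)) x _ _ _ _ _ _ _ _
  (ZP c2 ex ex) (ZP c2 ey ey) (ZP c1 es es) (ZP c1 et et)
  (ZP cr ex es) (ZP cr ey et) (ZP ci ex et) (ZP ci ey es).
move=> ->.
have L : levi_lap xi (prod4 g h k l) x = _ := congr2 +%R (P xi xi) (P (mulI xi) (mulI xi)).
rewrite L.
congr (_ * _); rewrite /mulI /ex /ey /es /et /c1 /c2 /cr /ci /=.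
ring.
Qed.

End levi.

Section positivity.
Variable R : realType.
Implicit Types (U : C2 R -> R) (p q x y xi : C2 R) (e t : R).

Definition moll U e p : R := I4 (fun y => U y * rho e (y - p)).

(* four points of a circle in the complex line through [p] spanned by [xi] *)
Definition fourpt (f : C2 R -> R) p xi t : R :=
  f (p + t *: xi) + f (p - t *: xi) +
  (f (p + t *: mulI xi) + f (p - t *: mulI xi)) - 4 * f p.

Definition psh_dist (O : set (C2 R)) U : Prop :=
  forall eta, test_form O eta -> positive_form eta ->
    0 <= I4 (fun y => U y * ddc_form eta y).

Lemma test_functionZ (V : normedModType R) (O : set V) (f : V -> R) (c : R) :
  smooth (fun y : V => c * f y) -> test_function O f ->
  test_function O (fun y : V => c * f y).
Proof.
move=> sf [_ [K [cK KO fK]]]; split=> //.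
by exists K; split => // x /fK ->; rewrite mulr0.
Qed.

Lemma csupp_bounded (f : C2 R -> R) : continuous f -> csupp f ->
  exists M, forall y, `|f y| <= M.
Proof.
move=> cf [K cK fK].
have /compact_bounded[M [_ MK]] : compact (f @` K).
  by apply: continuous_compact => //; exact: continuous_subspaceT.
exists (`|M| + 1) => y; have [Ky|nKy] := pselect (K y).
  by apply: MK; [rewrite ltr_pwDr// ler_norm|exists y].
by rewrite fK// normr0 addr_ge0.
Qed.

Lemma int4M_cc U f : int4 U -> continuous f -> csupp f -> int4 (fun y => U y * f y).
Proof.
move=> iU cf sf; have [M hM] := csupp_bounded cf sf.
exact: int4M iU (continuous_measurable4 cf) hM.
Qed.

Lemma continuous_levi_lap xi (f : C2 R -> R) : smooth f -> continuous (levi_lap xi f).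
Proof.
move=> sf y.
have c v : continuous ('D_v ('D_v f)) := smooth_continuous (smooth_derive v (smooth_derive v sf)).
exact: cvgD (c xi y) (c (mulI xi) y).
Qed.

Lemma csupp_levi_lap xi (f : C2 R -> R) : csupp f -> csupp (levi_lap xi f).
Proof.
move=> [K cK fK]; exists K => // x nKx.
have clK := compact_closed_normed cK.
have s v : 'D_v ('D_v f) x = 0 := supp_derive v clK (supp_derive v clK fK) nKx.
exact: etrans (congr2 +%R (s xi) (s (mulI xi))) (addr0 0).
Qed.

(** The current is tested against [levi_form xi f] with [f] the kernel centred at [p], so that all
    derivatives fall on the kernel. *)
Lemma moll_laplacian_ge0 O U e p xi : int4 U -> psh_dist O U -> cball4 p e `<=` O ->
  0 <= I4 (fun y => U y * levi_lap xi (fun y => rho e (y - p)) y).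
Proof.
move=> iU pU bO; set f := fun y => rho e (y - p).
have Zc c : prod4_class (fun y => c * f y) by apply/prod4_scale/rho_class.
have tf : test_function O f.
  split; first exact: rho_smooth.
  exists (cball4 p e); split => //; first exact: compact_ball4.
  by move=> y; rewrite /cball4/= => /negP; rewrite -ltNge => /ltW; exact: rho_out.
have tF : test_form O (levi_form xi f).
  by split; apply: test_functionZ tf; apply: prod4_class_smooth; exact: Zc.
have := pU _ tF (levi_form_positive xi (fun y => rho_ge0 e (y - p))).
have E y : U y * ddc_form (levi_form xi f) y =
    (2 * pi)^-1 * (U y * levi_lap xi f y).
  rewrite /f rho_shift ddc_levi_form; [|exact: cinf_bump..].
  by rewrite mulrCA.
rewrite (eq_I4 E) I4Z ?pmulr_rge0 ?invr_gt0 ?mulr_gt0 ?pi_gt0//.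
apply: int4M_cc => //; first exact: continuous_levi_lap (rho_smooth e p).
exact: csupp_levi_lap (rho_csupp e p).
Qed.

(** Displacing [p] by [v] displaces the argument of the kernel by [- v], and the four displacements
    come in opposite pairs, so the difference passes to the kernel. *)
Lemma fourpt_moll U e p xi t : int4 U ->
  int4 (fun y => U y * fourpt (fun z => rho e (z - p)) y xi t) /\
  fourpt (moll U e) p xi t =
  I4 (fun y => U y * fourpt (fun z => rho e (z - p)) y xi t).
Proof.
move=> iU.
have iUr q : int4 (fun y => U y * rho e (y - q)).
  by apply: int4M_cc => //; [exact/smooth_continuous/rho_smooth|exact: rho_csupp].
have comm (a b c d m : R) : a + b + (c + d) - 4 * m = b + a + (d + c) - 4 * m.
  by rewrite (addrC a) (addrC c).
pose r q y := U y * rho e (y - q).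
have E y : U y * fourpt (fun z => rho e (z - p)) y xi t =
    r (p - t *: xi) y + r (p + t *: xi) y +
    (r (p - t *: mulI xi) y + r (p + t *: mulI xi) y) - 4 * r p y.
  rewrite /fourpt /r !opprD !opprK !addrA ![y + _ *: _ - p]addrAC ![y - _ *: _ - p]addrAC.
  ring.
have i1 := iUr (p - t *: xi); have i2 := iUr (p + t *: xi).
have i3 := iUr (p - t *: mulI xi); have i4 := iUr (p + t *: mulI xi).
have i5 := int4Z 4 (iUr p).
have i12 := int4D i1 i2; have i34 := int4D i3 i4; have i14 := int4D i12 i34.
rewrite (funext E); split; first exact: int4B i14 i5.
rewrite (I4B i14 i5) (I4D i12 i34) (I4D i1 i2) (I4D i3 i4) (I4Z 4 (iUr p)).
exact: comm (moll U e _) (moll U e _) (moll U e _) (moll U e _) (moll U e _).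
Qed.

(** The second differences of the kernel approximate its second derivatives up to a uniform multiple
    of [t ^+ 2]. Integrated against [U], the error is governed by the integral [N] of [|U|], whence
    the denominator [N + 1]. *)
Lemma fourpt_moll_ge O U e p xi (th : R) : int4 U -> psh_dist O U ->
  cball4 p e `<=` O -> 0 < th ->
  exists2 d, 0 < d & forall t, 0 < t < d -> - th * t ^+ 2 <= fourpt (moll U e) p xi t.
Proof.
move=> iU pU bO th0; set f := fun y => rho e (y - p).
have sf : smooth f := rho_smooth e p; have cf : csupp f := rho_csupp e p.
pose N := I4 (fun y => `|U y|); have N0 : 0 <= N by apply: I4_ge0 => y.
have N1 : 0 < N + 1 by rewrite ltr_wpDl.
have th2 : 0 < th / 2 / (N + 1) by rewrite !divr_gt0.
have [d1 d10 h1] := second_difference xi sf cf th2.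
have [d2 d20 h2] := second_difference (mulI xi) sf cf th2.
exists (Num.min d1 d2) => [|t]; first by rewrite lt_min d10.
rewrite lt_min => /andP[t0 /andP[td1 td2]].
have [i4 ->] := fourpt_moll e p xi t iU.
pose L y := U y * levi_lap xi f y.
have iL : int4 L by apply: int4M_cc => //; [exact: continuous_levi_lap|exact: csupp_levi_lap].
have L0 : 0 <= I4 L := moll_laplacian_ge0 xi iU pU bO.
have iN := int4_norm iU.
have it := int4Z (t ^+ 2) iL.
have iE := int4Z (th / (N + 1) * t ^+ 2) iN.
apply: (@le_trans _ _ (I4 (fun y => t ^+ 2 * L y - th / (N + 1) * t ^+ 2 * `|U y|))).
  rewrite (I4B it iE) (I4Z _ iL) (I4Z _ iN) -/N.
  apply: (@le_trans _ _ (- (th / (N + 1) * t ^+ 2 * N))).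
    rewrite mulNr lerN2 mulrAC ler_wpM2r ?sqr_ge0// mulrAC ler_pdivrMr//.
    by rewrite ler_wpM2l ?(ltW th0)// lerDl.
  by rewrite -[leLHS]add0r lerD2r mulr_ge0 ?sqr_ge0.
apply: I4_le => //; first exact: int4B it iE.
move=> y.
have k1 := h1 y t (introT andP (conj t0 td1)).
have k2 := h2 y t (introT andP (conj t0 td2)).
have split4 (a b c d m s A B : R) : a + b + (c + d) - 4 * m =
    s * (A + B) + (a + b - 2 * m - s * A + (c + d - 2 * m - s * B)) by ring.
have E : fourpt f y xi t = t ^+ 2 * levi_lap xi f y + _ :=
  split4 _ _ _ _ _ (t ^+ 2) ('D_xi ('D_xi f) y) ('D_(mulI xi) ('D_(mulI xi) f) y).
rewrite E; move: k1 k2 {E}; set X := _ - _ - _; set Y := _ - _ - _ => k1 k2.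
rewrite mulrDr /L mulrCA lerD2l -lerN2 opprK.
apply: le_trans (ler_norm _) _; rewrite normrN normrM mulrC ler_wpM2r//.
apply: le_trans (ler_normD _ _) _; apply: le_trans (lerD k1 k2) _.
rewrite -mulrDl ler_wpM2r ?sqr_ge0//.
by rewrite -mulrDl -splitr.
Qed.

End positivity.

(** * Approximation of indicators by continuous functions *)

Section density.
Variables (R : realType) (f : C2 R -> R).
Hypothesis fi : int4 f.
Implicit Types (A B : set (C2 R)) (g h : C2 R -> R).

Let unit_valued g := forall p, 0 <= g p <= 1.

Let mble g := measurable_fun setT (g : M4 R -> M1 R).

Let dist1 g h := I4 (fun p => `|f p| * `|g p - h p|).

Lemma int4_dist1 g h : mble g -> mble h -> unit_valued g -> unit_valued h ->
  int4 (fun p => `|f p| * `|g p - h p|).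
Proof.
move=> mg mh ug uh; apply: (@int4M _ _ _ 1).
- exact: int4_norm.
- by apply: measurableT_comp => //; exact: measurable_funB.
- move=> p; rewrite normr_id.
  have /andP[g0 g1] := ug p; have /andP[h0 h1] := uh p.
  by rewrite ler_distl; apply/andP; split; lra.
Qed.

Lemma dist1_trans g h k : mble g -> mble h -> mble k ->
  unit_valued g -> unit_valued h -> unit_valued k ->
  dist1 g k <= dist1 g h + dist1 h k.
Proof.
move=> mg mh mk ug uh uk; rewrite /dist1 -I4D; [|exact: int4_dist1..].
apply: I4_le; [exact: int4_dist1|apply: int4D; exact: int4_dist1|].
by move=> p; rewrite -mulrDr ler_wpM2l// -(subrKA (h p)) ler_normD.
Qed.

Lemma dist1_cvg0 (g : (C2 R -> R)^nat) h : (forall n, mble (g n)) -> mble h ->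
  (forall n, unit_valued (g n)) -> unit_valued h ->
  (forall p, g ^~ p @ \oo --> h p) ->
  forall e, 0 < e -> exists n, dist1 (g n) h < e.
Proof.
move=> mg mh ug uh gh e e0.
pose F n (p : M4 R) : \bar R := (`|f p| * `|g n p - h p|)%:E.
have D1 n : measurable_fun setT (F n).
  by apply/measurable_EFinP; exact: int4_measurable (int4_dist1 (mg n) mh (ug n) uh).
have D2 p : setT p -> F ^~ p @ \oo --> 0%E.
  move=> _; apply/cvg_EFin; first by near=> n.
  rewrite [X in _ --> X](_ : _ = `|f p| * `|h p - h p|); last first.
    by rewrite subrr normr0 mulr0.
  apply: cvgMr; apply: cvg_norm; apply: cvgB; [exact: gh|exact: cvg_cst].
have D3 p : setT p -> `|f p|%:E \is a fin_num by [].
have D4 n p : setT p -> (`|F n p| <= `|f p|%:E)%E.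
  move=> _; rewrite /F lee_fin ger0_norm ?mulr_ge0// ler_piMr//.
  have /andP[g0 g1] := ug n p; have /andP[h0 h1] := uh p.
  by rewrite ler_distl; apply/andP; split; lra.
have := dominated_cvg measurableT D1 D2 D3 (int4_norm fi) D4.
rewrite integral0 => /fine_cvgP[_] /cvgrPdist_lt /(_ e e0)[N _ /(_ N (leqnn N))].
rewrite sub0r normrN => /(le_lt_trans (ler_norm _)) ?; by exists N.
Unshelve. all: by end_near. Qed.

(** Here [f] is a weight and the distance is that of L^1(|f|). The sets with this property form a
    sigma-algebra, so it suffices to reach half-lines in each coordinate. *)
Let approx A := mble (\1_A) /\ forall e, 0 < e ->
  exists2 g, continuous g /\ unit_valued g & dist1 (\1_A) g < e.

Let unit_indic A : unit_valued (\1_A).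
Proof. by move=> p; rewrite indicE; case: (p \in A) => /=; rewrite ?lexx ?ler01. Qed.

Lemma approxC A : approx A -> approx (~` A).
Proof.
have E p : \1_(~` A) p = 1 - \1_A p :> R.
  by rewrite !indicE in_setC; case: (p \in A); rewrite /= ?subrr ?subr0.
move=> [mA hA]; split.
  have -> : \1_(~` A) = (fun p => 1 - \1_A p) :> (C2 R -> R) by apply/funext.
  exact: measurable_funB.
move=> e e0; have [g [cg ug] ge] := hA e e0; exists (fun p => 1 - g p).
  split; first by move=> p; apply: cvgB; [exact: cvg_cst|exact: cg].
  by move=> p; have /andP[? ?] := ug p; apply/andP; split; lra.
rewrite (_ : dist1 _ _ = dist1 (\1_A) g)//; apply: eq_I4 => p.
rewrite E; move: (\1_A p) (g p) => a b; rewrite -[X in _ * X = _]normrN.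
by congr (_ * `|_|); ring.
Qed.

Lemma approxI A B : approx A -> approx B -> approx (A `&` B).
Proof.
move=> [mA hA] [mB hB].
have E : \1_(A `&` B) = (fun p => \1_A p * \1_B p) :> (C2 R -> R).
  by apply/funext => p; rewrite indicI.
have mAB : mble (\1_(A `&` B)) by rewrite E; exact: measurable_funM.
split=> // e e0; have e2 : 0 < e / 2 by rewrite divr_gt0.
have [g [cg ug] ge] := hA _ e2; have [h [ch uh] he] := hB _ e2.
have mg := continuous_measurable4 cg; have mh := continuous_measurable4 ch.
have cgh : continuous (fun p => g p * h p) by move=> p; apply: cvgM; [exact: cg|exact: ch].
have ugh : unit_valued (fun p => g p * h p).
  move=> p; have /andP[? ?] := ug p; have /andP[? ?] := uh p.
  by rewrite mulr_ge0//= mulr_ile1.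
exists (fun p => g p * h p) => //.
rewrite (splitr e); apply: le_lt_trans (ltrD ge he).
have i1 := int4_dist1 mA mg (unit_indic A) ug.
have i2 := int4_dist1 mB mh (unit_indic B) uh.
rewrite /dist1 -(I4D i1 i2); apply: I4_le.
- apply: int4_dist1 => //; exact: continuous_measurable4.
- exact: int4D.
- move=> p; rewrite -mulrDr ler_wpM2l// E.
  have := unit_indic A p; have := ug p; have := unit_indic B p.
  move: (\1_A p) (\1_B p) (g p) (h p) => a b c d /andP[b0 b1] /andP[c0 c1] /andP[a0 a1].
  rewrite (_ : a * b - c * d = (a - c) * b + c * (b - d)); last by ring.
  rewrite (le_trans (ler_normD _ _))// !normrM (ger0_norm b0) (ger0_norm c0).
  by rewrite lerD// ?ler_piMr// ?ler_piMl.
Qed.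

Lemma approxU A B : approx A -> approx B -> approx (A `|` B).
Proof.
by move=> hA hB; rewrite -(setCK (A `|` B)) setCU; apply/approxC/approxI; exact: approxC.
Qed.

Lemma approx0 : approx set0.
Proof.
have m0 : mble (\1_set0) by rewrite indic0; exact: measurable_cst.
split=> // e e0; exists (cst 0); first by split; [move=> p; exact: cvg_cst|move=> p /=; rewrite lexx ler01].
rewrite (_ : dist1 _ _ = 0)//; rewrite /dist1 (@eq_I4 _ _ (cst 0)).
  by rewrite /I4 Rintegral_cst// mul0r.
by move=> p; rewrite indic0 /= subrr normr0 mulr0.
Qed.

Lemma approx_cvg (B : (set (C2 R))^nat) A : (forall n, approx (B n)) ->
  (forall p, A p -> \forall n \near \oo, B n p) ->
  (forall p, ~ A p -> \forall n \near \oo, ~ B n p) -> approx A.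
Proof.
move=> hB inA outA.
have BA p : \1_(B n) p @[n --> \oo] --> (\1_A p : R).
  apply: cvg_near_cst; have [pA|pA] := pselect (A p).
    by apply: filterS (inA _ pA) => n Bp; rewrite /indic !mem_set.
  by apply: filterS (outA _ pA) => n Bp; rewrite /indic !memNset.
have mA : mble (\1_A).
  apply: (measurable_fun_cvg (fun n => (hB n).1)) => p _; exact: BA.
split=> // e e0; have e2 : 0 < e / 2 by rewrite divr_gt0.
have [n hn] := dist1_cvg0 (fun n => (hB n).1) mA (fun n => unit_indic (B n)) (unit_indic A) BA e2.
have [g [cg ug] ge] := (hB n).2 _ e2.
exists g => //; have mg := continuous_measurable4 cg.
have := dist1_trans mA (hB n).1 mg (unit_indic A) (unit_indic _) ug.
move/le_lt_trans; apply; rewrite (splitr e) ltrD//.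
rewrite (_ : dist1 _ _ = dist1 (\1_(B n)) (\1_A))//.
by apply: eq_I4 => p; rewrite distrC.
Qed.

Lemma approx_bigcup (B : (set (C2 R))^nat) :
  (forall n, approx (B n)) -> approx (\bigcup_n B n).
Proof.
move=> hB; apply: (@approx_cvg (fun n => \big[setU/set0]_(i < n) B i)).
- elim=> [|n IH]; first by rewrite big_ord0; exact: approx0.
  by rewrite big_ord_recr/=; exact: approxU.
- move=> p [n _ Bp]; exists n.+1 => // m /= nm.
  by rewrite -bigcup_mkord; exists n.
- move=> p nB; apply: nearW => n; rewrite -bigcup_mkord => -[m _ Bp].
  by apply: nB; exists m.
Qed.

Lemma approx_sigma (T : Type) (phi : C2 R -> T) :
  sigma_algebra setT [set A : set T | approx (phi @^-1` A)].
Proof.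
split=> [|A hA|F hF]; rewrite /mkset.
- by rewrite preimage_set0; exact: approx0.
- by rewrite setTD preimage_setC; exact: approxC.
- by rewrite preimage_bigcup; exact: approx_bigcup.
Qed.

Lemma approx_coord (c : C2 R -> R) : continuous c ->
  forall S : set (M1 R), measurable S -> approx (c @^-1` S).
Proof.
move=> cc S; rewrite RGenOInfty.measurableE.
apply: (smallest_sub (approx_sigma c)) => _ [x ->]; rewrite /mkset.
have mc := continuous_measurable4 cc.
have mA : mble (\1_(c @^-1` `]x, +oo[)).
  apply: measurable_indic; rewrite -[X in measurable X]setTI; apply: mc => //.
(* Ramps that converge pointwise to the indicator of [c p > x]; dominated convergence does the
   rest. *)
pose g n p : R := Num.min 1 (Num.max 0 (n%:R * (c p - x))).
have cg n : continuous (g n).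
  move=> p; apply: (@continuous_min _ _ (cst 1) _ p); first exact: cst_continuous.
  apply: (@continuous_max _ _ (cst 0) _ p); first exact: cst_continuous.
  by apply: cvgM; [exact: cvg_cst|apply: cvgB; [exact: cc|exact: cvg_cst]].
have ug n : unit_valued (g n).
  by move=> p; rewrite /g le_min ler01 le_max lexx /= ge_min lexx.
have gA p : g n p @[n --> \oo] --> (\1_(c @^-1` `]x, +oo[) p : R).
  apply: cvg_near_cst; rewrite /indic; case: (boolP (p \in _)) => pA.
    move: pA; rewrite inE/= in_itv/= andbT => xc.
    have c0 : 0 < c p - x by rewrite subr_gt0.
    near=> n; rewrite /g max_r ?mulr_ge0 ?(ltW c0)// min_l//.
    rewrite -ler_pdivrMr// mul1r; near: n; exact: nbhs_infty_ger.
  have {}pA : c p <= x.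
    by rewrite leNgt; apply/negP => xc; move/negP: pA; apply; rewrite inE/= in_itv/= xc.
  apply: nearW => n; rewrite /g max_l ?min_r//.
  by rewrite mulr_ge0_le0// subr_le0.
split=> // e e0.
have [n hn] := dist1_cvg0 (fun n => continuous_measurable4 (cg n)) mA ug (unit_indic _) gA e0.
exists (g n) => //.
rewrite (_ : dist1 _ _ = dist1 (g n) (\1_(c @^-1` `]x, +oo[)))//.
by apply: eq_I4 => p; rewrite distrC.
Unshelve. all: by end_near. Qed.

Lemma approx_pair d1 d2 (T1 : measurableType d1) (T2 : measurableType d2)
    (phi : C2 R -> T1 * T2) :
  (forall S : set T1, measurable S -> approx ((fst \o phi) @^-1` S)) ->
  (forall S : set T2, measurable S -> approx ((snd \o phi) @^-1` S)) ->
  forall S : set (T1 * T2), measurable S -> approx (phi @^-1` S).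
Proof.
move=> h1 h2 S; rewrite measurable_prod_measurableType.
apply: (smallest_sub (approx_sigma phi)) => _ [B mB [C mC <-]].
by have := approxI (h1 _ mB) (h2 _ mC).
Qed.

Lemma approx_measurable A : measurable (A : set (M4 R)) -> approx A.
Proof.
have [c1 c2 c3 c4] := @coord_continuous R.
apply: (@approx_pair _ _ (M2 R) (M2 R) id).
- by apply: (@approx_pair _ _ (M1 R) (M1 R) fst); exact: approx_coord.
- by apply: (@approx_pair _ _ (M1 R) (M1 R) snd); exact: approx_coord.
Qed.

Lemma I4_indic_le0 A : measurable (A : set (M4 R)) ->
  (forall g, continuous g -> (forall p, 0 <= g p <= 1) ->
     I4 (fun p => f p * g p) <= 0) ->
  I4 (fun p => f p * \1_A p) <= 0.
Proof.
move=> /approx_measurable[mA hA] fg.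
apply/ler_addgt0Pl => e e0; rewrite addr0.
have [g [cg ug] ge] := hA e e0; have mg := continuous_measurable4 cg.
have b1 h : unit_valued h -> forall p, `|h p| <= 1.
  by move=> uh p; have /andP[? ?] := uh p; rewrite ger0_norm.
have iA := int4M fi mA (b1 _ (unit_indic A)).
have ig := int4M fi mg (b1 _ ug).
rewrite -(subrK (I4 (fun p => f p * g p)) (I4 _)) -[e]addr0.
apply: lerD; last exact: fg.
rewrite -(I4B iA ig); apply: le_trans (ltW ge).
apply: le_trans (ler_norm _) _; apply: le_trans (I4_norm (int4B iA ig)) _.
apply: I4_le; [exact/int4_norm/int4B|exact: int4_dist1 mA mg (unit_indic A) ug|].
by move=> p; rewrite -mulrBr normrM.
Qed.

(** Continuous tests approximate the indicator of [f > 0] in L^1(|f|), so the positive part of [f]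
    has integral 0. *)
Lemma ae_le0 : (forall g, continuous g -> (forall p, 0 <= g p <= 1) ->
     I4 (fun p => f p * g p) <= 0) ->
  {ae leb4, forall p : M4 R, f p <= 0}.
Proof.
move=> fg; pose A : set (C2 R) := [set p | 0 < f p].
have mf := int4_measurable fi.
have mA : measurable (A : set (M4 R)).
  rewrite (_ : A = f @^-1` `]0, +oo[%classic).
    by rewrite -[X in measurable X]setTI; exact: mf.
  by apply/seteqP; split => p; rewrite /A/= in_itv/= andbT.
have h := I4_indic_le0 mA fg.
have F0 p : 0 <= f p * \1_A p.
  rewrite indicE; case: (boolP (p \in A)) => pA; last by rewrite mulr0.
  by move: pA; rewrite inE mulr1 => /ltW.
have iF : int4 (fun p => f p * \1_A p).
  have b1 p : `|\1_A p| <= 1 :> R.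
    by have /andP[? ?] := unit_indic A p; rewrite ger0_norm.
  exact: int4M fi (approx_measurable mA).1 b1.
have : (\int[leb4]_(p in setT) `|(f p * \1_A p)%:E| = 0)%E.
  under eq_integral do rewrite gee0_abs ?lee_fin//.
  by rewrite -(I4E iF); congr EFin; apply/le_anti; rewrite h I4_ge0.
have /measurable_EFinP mF := int4_measurable iF.
move/(ae_eq_integral_abs (@leb4 R) measurableT mF); apply: filterS => p /(_ I) [].
rewrite indicE; case: (boolP (p \in A)) => pA.
  by rewrite mulr1 => ->.
by move=> _; rewrite leNgt; apply/negP => fp; move/negP: pA; apply; rewrite inE.
Qed.

End density.

(** * From bounds on mollifications to bounds almost everywhere *)

Section mollified_bound.
#[local] Opaque I4 rho.
Variable R : realType.
Implicit Types (U chi : C2 R -> R) (p q y : C2 R) (e : R).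

Lemma measurable_diff4 : measurable_fun setT
  (fun q : M4 R * M4 R => ((q.2 : C2 R) - q.1) : M4 R).
Proof.
have sub1 d (T : measurableType d) (f g : T -> M1 R) : measurable_fun setT f ->
    measurable_fun setT g -> measurable_fun setT (fun x => f x - g x : M1 R).
  by move=> mf mg; exact: measurable_funB.
have sub2 d (T : measurableType d) (f g : T -> M2 R) : measurable_fun setT f ->
    measurable_fun setT g ->
    measurable_fun setT (fun x => ((f x : C1 R) - g x) : M2 R).
  move=> /measurable_fun_pairP[f1 f2] /measurable_fun_pairP[g1 g2].
  exact: (measurable_fun_pair (sub1 _ _ _ _ f1 g1) (sub1 _ _ _ _ f2 g2)).
have m1 : measurable_fun setT (fun q : M4 R * M4 R => q.1) by exact: measurable_fst.
have m2 : measurable_fun setT (fun q : M4 R * M4 R => q.2) by exact: measurable_snd.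
move/measurable_fun_pairP : m1 => [a1 a2]; move/measurable_fun_pairP : m2 => [b1 b2].
exact: (measurable_fun_pair (sub2 _ _ _ _ b1 a1) (sub2 _ _ _ _ b2 a2)).
Qed.

Lemma int4_moll_ker U e p : int4 U -> int4 (fun y => U y * rho e (y - p)).
Proof.
by move=> iU; apply: int4M_cc => //; [exact/smooth_continuous/rho_smooth|exact: rho_csupp].
Qed.

Lemma rho_bounded e : exists2 M, 0 <= M & forall x, rho e x <= M.
Proof.
have [M hM] := csupp_bounded (@rho_continuous _ e) (rho_csupp0 e).
exists M; first by rewrite (le_trans _ (hM 0)).
by move=> x; rewrite (le_trans _ (hM x))// ler_norm.
Qed.

(** Mollification is self-adjoint because the kernel is even. *)
Lemma moll_fubini U chi e : int4 U -> continuous chi -> csupp chi ->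
  [/\ int4 (fun p => chi p * moll U e p),
      int4 (fun y => U y * I4 (fun p => chi p * rho e (p - y))) &
      I4 (fun p => chi p * moll U e p) =
      I4 (fun y => U y * I4 (fun p => chi p * rho e (p - y)))].
Proof.
move=> iU cchi schi.
have ichi := int4_cc cchi schi.
pose F (q : M4 R * M4 R) : R := chi q.1 * (U q.2 * rho e ((q.2 : C2 R) - q.1)).
have mF : measurable_fun setT F.
  apply: measurable_funM.
    exact: (measurableT_comp (continuous_measurable4 cchi) measurable_fst).
  apply: measurable_funM.
    exact: (measurableT_comp (int4_measurable iU) measurable_snd).
  exact: (measurableT_comp (continuous_measurable4 (@rho_continuous _ e)) measurable_diff4).
have [M M0 hM] := rho_bounded e.
pose N := I4 (fun y => `|U y|).
have inner p : int4 (fun y => F (p, y)) := (int4Z (chi p) (int4_moll_ker e p iU)).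
have iF : (@leb4 R \x @leb4 R)%E.-integrable setT (EFin \o F).
  apply/integrable12ltyP; first exact/measurable_EFinP.
  have iG := int4Z (M * N) (int4_norm ichi).
  apply: (@le_lt_trans _ _ (\int[leb4]_p (M * N * `|chi p|)%:E)%E); last first.
    by rewrite -(I4E iG) ltry.
  apply: ge0_le_integral => //.
  - by move=> p _; exact: integral_ge0.
  - have mabs : measurable_fun setT (fun z : M4 R * M4 R => `|(EFin \o F) z|%E).
      by apply: measurableT_comp => //; exact/measurable_EFinP.
    exact: (@measurable_fun_fubini_tonelli_F _ _ (M4 R) (M4 R) R (@leb4 R) _ mabs
      (fun z => abse_ge0 _)).
  - exact: measurable_int iG.
  - move=> p _; rewrite -(I4E (int4_norm (inner p))) lee_fin.
    rewrite mulrAC -(I4Z _ (int4_norm iU)); apply: I4_le.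
    + exact/int4_norm/inner.
    + exact/int4Z/int4_norm.
    + move=> y; rewrite /F/= (normrM (chi p)) (normrM (U y)) (ger0_norm (rho_ge0 _ _)) (_ : M * _ * _ = `|chi p| * (`|U y| * M)).
        by do 2 apply: ler_wpM2l => //.
      by rewrite mulrAC mulrC [M * _]mulrC.
have iker y : int4 (fun p => chi p * rho e (p - y)).
  by apply: int4M_cc => //; [exact/smooth_continuous/rho_smooth|exact: rho_csupp].
have FE p : fubini_F (@leb4 R) (EFin \o F) p = (chi p * moll U e p)%:E.
  rewrite /fubini_F -(I4E (inner p)); congr EFin.
  exact: (I4Z (chi p) (int4_moll_ker e p iU)).
have GE y : fubini_G (@leb4 R) (EFin \o F) y =
    (U y * I4 (fun p => chi p * rho e (p - y)))%:E.
  rewrite /fubini_G -(I4Z _ (iker y)) (I4E (int4Z _ (iker y))).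
  by apply: eq_integral => p _; rewrite /F/= -rhoN opprB mulrCA.
have i1 : int4 (fun p => chi p * moll U e p).
  have := integrable_fubini_F iF; congr (integrable _ _ _); exact/funext.
have i2 : int4 (fun y => U y * I4 (fun p => chi p * rho e (p - y))).
  apply: (@int4_le _ _ (fun y => I4 (fun p => `|chi p|) * M * `|U y|)).
  - have := measurable_fubini_G iF; by rewrite (funext GE) => /measurable_EFinP.
  - exact: (int4Z (I4 (fun p => `|chi p|) * M) (int4_norm iU)).
  - move=> y; rewrite normrM mulrC ler_wpM2r//.
    apply: le_trans (I4_norm (iker y)) _; rewrite mulrC -(I4Z _ (int4_norm ichi)).
    apply: I4_le; [exact: int4_norm|exact: (int4Z M (int4_norm ichi))|move=> p].
    by rewrite normrM mulrC ler_wpM2r// ger0_norm ?rho_ge0.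
split; [exact: i1|exact: i2|apply: EFin_inj].
have A1 : (I4 (fun p => chi p * moll U e p)%R)%:E = (\int[leb4]_p fubini_F (@leb4 R) (EFin \o F) p)%E.
  by apply: etrans (I4E i1) _; apply: eq_integral => p _; exact: esym (FE p).
have A2 : (I4 (fun y => U y * I4 (fun p => chi p * rho e (p - y)))%R)%:E = (\int[leb4]_y fubini_G (@leb4 R) (EFin \o F) y)%E.
  by apply: etrans (I4E i2) _; apply: eq_integral => y _; exact: esym (GE y).
apply: etrans A1 _; apply: etrans _ (esym A2).
exact: etrans (integral12_prod_meas1 iF) (esym (integral21_prod_meas1 iF)).
Qed.

Lemma rho_average_close chi e (w : R) y : 0 < e -> continuous chi -> csupp chi ->
  (forall x z, `|x - z| < e -> `|chi x - chi z| <= w) ->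
  `|I4 (fun p => chi p * rho e (p - y)) - chi y * I4 (rho e)| <= w * I4 (rho e).
Proof.
move=> e0 cchi schi hw; have ichi := int4_cc cchi schi.
have ir := int4_rho e y.
have iker : int4 (fun p => chi p * rho e (p - y)).
  by apply: int4M_cc => //; [exact/smooth_continuous/rho_smooth|exact: rho_csupp].
rewrite -(I4_rho_shift e y) -(I4Z _ ir) -(I4Z w ir) -(I4B iker (int4Z _ ir)).
apply: le_trans (I4_norm (int4B iker (int4Z _ ir))) _.
apply: I4_le; [exact: int4_norm (int4B iker (int4Z _ ir))|exact: int4Z|move=> p].
rewrite -mulrBl normrM [`|rho _ _|]ger0_norm ?rho_ge0//.
have [py|py] := ltP `|p - y| e; last by rewrite (rho_out py) !mulr0.
by rewrite ler_wpM2r ?rho_ge0// hw.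
Qed.

(** The mollifier is moved onto [chi], whose uniform continuity makes its average over a small ball
    close to [chi] times the mass of the kernel. *)
Lemma moll_le_weak U chi (a e0 : R) (S : set (C2 R)) : int4 U -> 0 < e0 ->
  continuous chi -> csupp chi -> (forall p, 0 <= chi p) ->
  (forall p, ~ S p -> chi p = 0) ->
  (forall e p, 0 < e < e0 -> S p -> moll U e p <= a * I4 (rho e)) ->
  I4 (fun p => U p * chi p) <= a * I4 chi.
Proof.
move=> iU e00 cchi schi chi0 chiS; have ichi := int4_cc cchi schi.
pose N := I4 (fun y => `|U y|); have N0 : 0 <= N by exact: I4_ge0.
have N1 : 0 < N + 1 by rewrite ltr_wpDl.
move=> hU; apply/ler_addgt0Pr => w w0; move: hU.
have w1 : 0 < w / (N + 1) by rewrite divr_gt0.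
have [d d0 dP] := csupp_unif_continuous cchi schi w1.
pose e := Num.min d (e0 / 2).
have e_gt0 : 0 < e by rewrite lt_min d0 divr_gt0.
have ee0 : e < e0.
  by rewrite gt_min ltr_pdivrMr// ltr_pMr// ltr1n orbT.
have c0 : 0 < I4 (rho e) := I4_rho_gt0 e_gt0.
have hw x z : `|x - z| < e -> `|chi x - chi z| <= w / (N + 1).
  by rewrite lt_min => /andP[xz _]; exact/ltW/dP.
have [i1 i2 E] := moll_fubini e iU cchi schi.
have iUc := int4M_cc iU cchi schi.
have B2 : I4 (fun p => U p * chi p) * I4 (rho e) -
    I4 (fun y => U y * I4 (fun p => chi p * rho e (p - y))) <= w * I4 (rho e).
  rewrite mulrC -(I4Z _ iUc) -(I4B (int4Z _ iUc) i2).
  apply: (@le_trans _ _ (I4 (fun p => w / (N + 1) * I4 (rho e) * `|U p|))).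
    apply: I4_le; [exact: int4B (int4Z _ iUc) i2|exact: (int4Z (w / (N + 1) * I4 (rho e)) (int4_norm iU))|move=> y].
    apply: le_trans (ler_norm _) _.
    rewrite mulrCA -mulrBr normrM mulrC; apply: ler_wpM2r; first exact: normr_ge0.
    by rewrite distrC [I4 _ * chi y]mulrC; exact: rho_average_close.
  rewrite (I4Z _ (int4_norm iU)) -/N mulrAC; apply: ler_wpM2r; first exact: ltW c0.
  rewrite mulrAC (ler_pdivrMr _ _ N1); apply: ler_wpM2l; first exact: ltW w0.
  by rewrite lerDl; exact: ler01.
move=> hU; have B1 : I4 (fun p => chi p * moll U e p) <= a * I4 (rho e) * I4 chi.
  rewrite -(I4Z _ ichi); apply: I4_le; [exact: i1|exact: int4Z|move=> p].
  rewrite mulrC; have [Sp|nSp] := pselect (S p).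
    apply: ler_wpM2r; first exact: chi0.
    exact: hU (introT andP (conj e_gt0 ee0)) Sp.
  by rewrite (chiS _ nSp) mulr0 mulr0.
rewrite -(ler_pM2r c0) mulrDl; move: B1 B2; rewrite -E.
set X := I4 (fun p => chi p * _); set Y := I4 (fun p => U p * _).
move: (I4 (rho e)) (I4 chi) X Y => c b X Y; clear.
rewrite lerBlDr => B1 B2; apply: le_trans B2 _.
by rewrite addrC lerD2r mulrAC.
Qed.

(** The kernel [k] of radius [r] is a weight positive exactly on the ball; it localises the weak
    bound before [ae_le0] is applied. *)
Lemma moll_le_ae U (a e0 r : R) (q : C2 R) (S : set (C2 R)) : int4 U -> 0 < e0 ->
  (forall p, `|p - q| < r -> S p) ->
  (forall e p, 0 < e < e0 -> S p -> moll U e p <= a * I4 (rho e)) ->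
  {ae leb4, forall y : M4 R, `|(y : C2 R) - q| < r -> U y <= a}.
Proof.
move=> iU e00 rS hU; pose k y := rho r (y - q).
have ck : continuous k := smooth_continuous (rho_smooth r q).
have sk : csupp k := rho_csupp r q.
have ik := int4_rho r q.
have iUk := int4M_cc iU ck sk.
have fi : int4 (fun y => (U y - a) * k y).
  have := int4B iUk (int4Z a ik); congr (integrable _ _ _).
  by apply/funext => y /=; rewrite mulrBl.
have : {ae leb4, forall p : M4 R, (U p - a) * k p <= 0}.
  apply: ae_le0 fi _ => g cg g01.
  have cgk : continuous (fun p => k p * g p).
    by move=> p; apply: cvgM; [exact: ck|exact: cg].
  have sgk : csupp (fun p => k p * g p).
    by case: sk => K cK hK; exists K => // x /hK ->; rewrite mul0r.
  have k0 p : 0 <= k p * g p.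
    by have /andP[g0 _] := g01 p; rewrite mulr_ge0// rho_ge0.
  have kS p : ~ S p -> k p * g p = 0.
    move=> nS; rewrite /k rho_out ?mul0r// leNgt; apply/negP => /rS; exact: nS.
  have := moll_le_weak iU e00 cgk sgk k0 kS hU.
  rewrite -subr_le0 -(I4Z _ (int4_cc cgk sgk)) -(I4B (int4M_cc iU cgk sgk)); last exact/int4Z/int4_cc.
  by apply: le_trans; rewrite le_eqVlt; apply/orP; left; apply/eqP/eq_I4 => p; ring.
apply: filterS => y /= h yr.
by move: h; rewrite pmulr_lle0 ?subr_le0// rho_gt0.
Qed.

End mollified_bound.

(** * Maximum principle *)

Section maximum_principle.
Variable R : realType.
Implicit Types (U B : C2 R -> R) (p q y xi : C2 R) (e t : R).

Definition sqn (z : C1 R) : R := z.1 ^+ 2 + z.2 ^+ 2.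

(** The parameters bound squared radii. *)
Definition bidisc (a b : R) : set (C2 R) := [set p | sqn p.1 <= a /\ sqn p.2 <= b].

Lemma sqn_ge0 z : 0 <= sqn z.
Proof. by rewrite addr_ge0// sqr_ge0. Qed.

Lemma sqn_continuous : continuous sqn.
Proof.
move=> z; have [c1 c2] : fst @ z --> z.1 /\ snd @ z --> z.2 by split; [exact: cvg_fst|exact: cvg_snd].
exact: (cvgD (cvgM c1 c1) (cvgM c2 c2)).
Qed.

Lemma sqn1_continuous : continuous (fun p : C2 R => sqn p.1).
Proof. by move=> p; apply: (@cvg_comp _ _ _ fst sqn _ (nbhs p.1)); [exact: cvg_fst|exact: sqn_continuous]. Qed.

Lemma sqn2_continuous : continuous (fun p : C2 R => sqn p.2).
Proof. by move=> p; apply: (@cvg_comp _ _ _ snd sqn _ (nbhs p.2)); [exact: cvg_snd|exact: sqn_continuous]. Qed.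

Lemma le_sqrt_sqn (x y a : R) : x ^+ 2 + y ^+ 2 <= a -> `|x| <= Num.sqrt a.
Proof.
move=> h; rewrite -sqrtr_sqr ler_wsqrtr//.
by apply: le_trans h; rewrite lerDl sqr_ge0.
Qed.

Lemma closed_sublevel (T : topologicalType) (f : T -> R) (a : R) :
  continuous f -> closed [set x | f x <= a].
Proof. by move=> /continuous_closedP h; exact: (h [set x | x <= a] (@closed_le R a)). Qed.

Lemma open_sublevel (T : topologicalType) (f : T -> R) (a : R) :
  continuous f -> open [set x | f x < a].
Proof. by move=> /continuousP h; exact: (h [set x | x < a] (@open_lt R a)). Qed.

Lemma nbhs_sublevel (T : topologicalType) (f : T -> R) (a : R) (x : T) :
  continuous f -> f x < a -> nbhs x [set y | f y < a].
Proof. by move=> cf fa; apply: open_nbhs_nbhs; split => //; exact: (open_sublevel a cf). Qed.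

Lemma bidisc_closed a b : closed (bidisc a b).
Proof.
exact: closedI (closed_sublevel sqn1_continuous) (closed_sublevel sqn2_continuous).
Qed.

Lemma bidisc_compact a b : compact (bidisc a b).
Proof.
pose r := Num.max (Num.sqrt a) (Num.sqrt b).
suff sub : bidisc a b `<=` cball4 0 r.
  exact: subclosed_compact (@bidisc_closed a b) (@compact_ball4 R 0 r) sub.
move=> [[x y] [s t]] [/= h1 h2].
rewrite /cball4/= subr0 norm4_le/= !le_max (le_sqrt_sqn h1) (le_sqrt_sqn h2).
move: h1 h2; rewrite /sqn/= addrC => /le_sqrt_sqn ->.
by rewrite addrC => /le_sqrt_sqn ->; rewrite !orbT.
Qed.

Lemma moll_continuous U e : int4 U -> continuous (moll U e).
Proof.
move=> iU p; apply/cvgrPdist_lt => w w0.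
pose N := I4 (fun y => `|U y|); have N0 : 0 <= N by exact: I4_ge0.
have N1 : 0 < N + 1 by rewrite ltr_wpDl.
have w1 : 0 < w / 2 / (N + 1) by rewrite !divr_gt0.
have [d d0 dP] := csupp_unif_continuous (@rho_continuous _ e) (rho_csupp0 e) w1.
have := @nbhsx_ballx _ _ p d d0; apply: filterS => q; rewrite -ball_normE/= => pq.
have ip := int4_moll_ker e p iU; have iq := int4_moll_ker e q iU.
rewrite /moll -(I4B ip iq); apply: le_lt_trans (I4_norm (int4B ip iq)) _.
apply: (@le_lt_trans _ _ (I4 (fun y => w / 2 / (N + 1) * `|U y|))).
  apply: I4_le; [exact: int4_norm (int4B ip iq)|exact: (int4Z _ (int4_norm iU))|move=> y].
  rewrite -mulrBr normrM mulrC; apply: ler_wpM2r; first exact: normr_ge0.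
  apply/ltW/dP; rewrite (_ : y - p - (y - q) = q - p); first by rewrite distrC.
  by rewrite opprB addrC addrA subrK.
rewrite (I4Z _ (int4_norm iU)) -/N.
apply: (@le_lt_trans _ _ (w / 2)); last by rewrite ltr_pdivrMr// ltr_pMr// ltr1n.
by rewrite mulrAC ler_pdivrMr// ler_wpM2l ?divr_ge0 ?(ltW w0)// lerDl.
Qed.

(** The Levi form is nonpositive in some nonzero complex direction at every point, stated through
    four-point differences so that it compares directly with [fourpt_moll_ge]. *)
Definition levi_degenerate B : Prop := forall p,
  exists2 xi, 0 < sqn xi.1 + sqn xi.2 &
  forall th, 0 < th -> exists2 d, 0 < d &
    forall t, 0 < t < d -> fourpt B p xi t <= th * t ^+ 2.

Lemma fourpt_sqn p xi t :
  fourpt (fun y => sqn y.1 + sqn y.2) p xi t = 4 * t ^+ 2 * (sqn xi.1 + sqn xi.2).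
Proof.
case: p xi => [[p1 p2] [p3 p4]] [[x1 x2] [x3 x4]].
by rewrite /fourpt /sqn /mulI/= /GRing.scale/=; ring.
Qed.

Lemma fourpt_lin (f g h : C2 R -> R) (b c : R) p xi t :
  fourpt (fun y => f y - b * g y + c * h y) p xi t =
  fourpt f p xi t - b * fourpt g p xi t + c * fourpt h p xi t.
Proof.
rewrite /fourpt.
move: (f _) (f _) (f _) (f _) (f _) (g _) (g _) (g _) (g _) (g _) (h _) (h _) (h _) (h _) (h _).
by move=> *; ring.
Qed.

Lemma moll_le_boundary U B (eta e : R) p : int4 U ->
  (forall y, `|y - p| < e -> U y <= B p + 2 * eta) ->
  moll U e p <= (B p + 2 * eta) * I4 (rho e).
Proof.
move=> iU h; rewrite -(I4_rho_shift e p) -(I4Z _ (int4_rho e p)).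
apply: I4_le; [exact: int4_moll_ker|exact: (int4Z _ (int4_rho e p))|move=> y].
have [ye|ey] := ltP `|y - p| e; last by rewrite (rho_out ey) !mulr0.
by apply: ler_wpM2r; [exact: rho_ge0|exact: h].
Qed.

(* At an interior maximum of [U_e - c B + dl |p|^2] the four-point difference
   along the direction in which [B] degenerates would be positive. *)
Lemma moll_maximum O U B (a b c e bound : R) :
  int4 U -> psh_dist O U -> continuous B -> levi_degenerate B -> 0 < c ->
  (forall p, bidisc a b p -> cball4 p e `<=` O) ->
  (forall p, bidisc a b p -> sqn p.1 = a \/ sqn p.2 = b ->
     moll U e p <= c * B p + bound) ->
  forall p, bidisc a b p -> moll U e p <= c * B p + bound.
Proof.
move=> iU pU cB lB c0 bO bd p0 Qp0.
(* The perturbation [dl * |p|^2] costs at most [dl * (a + b)] on the bidisc and disappears as [dl]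
   tends to 0. *)
suff main dl : 0 < dl -> moll U e p0 - c * B p0 <= bound + dl * (a + b).
  rewrite addrC -lerBlDr; apply/ler_addgt0Pr => w w0.
  have ab : 0 <= a + b.
    by case: Qp0 => h1 h2; rewrite addr_ge0 ?(le_trans _ h1) ?(le_trans _ h2) ?sqn_ge0.
  have ab1 : 0 < a + b + 1 by rewrite ltr_wpDl.
  apply: le_trans (main (w / (a + b + 1)) _) _; first by rewrite divr_gt0.
  by rewrite lerD2l mulrAC ler_pdivrMr// ler_wpM2l ?(ltW w0)// lerDl.
move=> dl0; pose G p := moll U e p - c * B p + dl * (sqn p.1 + sqn p.2).
have cG : continuous G.
  move=> p; apply: cvgD.
    by apply: cvgB; [exact: moll_continuous|apply: cvgM; [exact: cvg_cst|exact: cB]].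
  apply: cvgM; first exact: cvg_cst.
  by apply: cvgD; [exact: sqn1_continuous|exact: sqn2_continuous].
have [p /set_mem Qp pmax] := compact_EVT_max (ex_intro _ p0 Qp0 : bidisc a b !=set0)
  (@bidisc_compact a b) (continuous_subspaceT cG).
have G0 : moll U e p0 - c * B p0 <= G p.
  apply: le_trans (pmax p0 (mem_set Qp0)).
  by rewrite lerDl mulr_ge0 ?(ltW dl0)// addr_ge0// sqn_ge0.
apply: le_trans G0 _.
have [onbd|inside] := pselect (sqn p.1 = a \/ sqn p.2 = b).
  have := bd p Qp onbd; rewrite addrC -lerBlDr => h.
  by apply: lerD => //; case: Qp => h1 h2; rewrite ler_wpM2l ?(ltW dl0)// lerD.
exfalso; have {inside}[pa pb] : sqn p.1 < a /\ sqn p.2 < b.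
  by case: Qp => h1 h2; split; rewrite lt_neqAle ?h1 ?h2 andbT; apply/eqP => E;
    apply: inside; [left|right].
have [xi xi0 hB] := lB p.
set n := sqn _ + sqn _ in xi0.
have th1 : 0 < dl * n by rewrite mulr_gt0.
have th2 : 0 < dl * n / c by rewrite divr_gt0.
have [d1 d10 h1] := fourpt_moll_ge xi iU pU (bO p Qp) th1.
have [d2 d20 h2] := hB _ th2.
have /nbhs_ballP[r /= r0 rQ] : nbhs p (bidisc a b).
  have n1 := nbhs_sublevel sqn1_continuous pa.
  by apply: filterS2 n1 (nbhs_sublevel sqn2_continuous pb) => y /ltW ya /ltW yb; split.
have inQ (v : C2 R) t : 0 < t -> t * (`|v| + 1) < r -> G (p + t *: v) <= G p /\ G (p - t *: v) <= G p.
  move=> t0 tr; have tv : `|t *: v| < r.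
    rewrite normrZ gtr0_norm//; apply: le_lt_trans tr.
    by rewrite ler_wpM2l ?(ltW t0)// lerDl.
  split; apply: pmax; apply/mem_set/rQ; rewrite -ball_normE/=.
    by rewrite opprD addrA subrr sub0r normrN.
  by rewrite opprB addrC subrK.
pose m := Num.min (Num.min d1 d2) (Num.min (r / (`|xi| + 1)) (r / (`|mulI xi| + 1))).
have v1 (v : C2 R) : 0 < `|v| + 1 by rewrite ltr_wpDl.
have m0 : 0 < m by rewrite !lt_min d10 d20 !divr_gt0.
pose t := m / 2; have t0 : 0 < t by rewrite divr_gt0.
have tm : t < m by rewrite ltr_pdivrMr// ltr_pMr// ltr1n.
move: tm; rewrite !lt_min -!andbA => /and4P[td1 td2].
rewrite !ltr_pdivlMr// => tr1 tr2.
have [g1 g2] := inQ _ _ t0 tr1; have [g3 g4] := inQ _ _ t0 tr2.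
have gG : fourpt G p xi t <= 0.
  rewrite /fourpt subr_le0 (_ : 4 * G p = G p + G p + (G p + G p)); last by ring.
  exact: lerD (lerD g1 g2) (lerD g3 g4).
move: gG; apply/negP; rewrite -ltNge fourpt_lin fourpt_sqn -/n.
have k1 := h1 t (introT andP (conj t0 td1)); have k2 := h2 t (introT andP (conj t0 td2)).
have k3 : c * fourpt B p xi t <= dl * n * t ^+ 2.
  apply: le_trans (ler_wpM2l (ltW c0) k2) _.
  by rewrite mulrA [c * _]mulrC divfK ?lexx// gt_eqF.
have T : 0 < dl * n * t ^+ 2 by rewrite mulr_gt0// exprn_gt0.
move: k1 k3 T; rewrite -/t.
move: (fourpt _ _ _ _) (fourpt _ _ _ _) => X Y; clear.
rewrite (_ : dl * (4 * t ^+ 2 * n) = 4 * (dl * n * t ^+ 2)); last by ring.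
rewrite mulNr; move: (dl * n * t ^+ 2) (c * Y) => Z W; clear => *; lra.
Qed.

End maximum_principle.

(** * Barriers vanishing along the arc *)

Section barrier.
Variable R : realType.
Local Notation C := R[i].
Implicit Types (s : seq (C1 R)) (p xi : C2 R) (x y z : C).

Definition cx (z : C1 R) : C := (z.1 +i* z.2)%C.

Definition nsq z : R := complex.Re z ^+ 2 + complex.Im z ^+ 2.

Lemma nsq_ge0 z : 0 <= nsq z. Proof. by rewrite addr_ge0// sqr_ge0. Qed.

Lemma nsqM x y : nsq (x * y) = nsq x * nsq y.
Proof. by case: x y => [a b] [c d]; rewrite /nsq/=; simpc; rewrite /=; ring. Qed.

Lemma nsqD_le x y : nsq (x + y) <= 2 * nsq x + 2 * nsq y.
Proof.
case: x y => [a b] [c d]; rewrite /nsq/=; simpc => /=.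
rewrite -subr_ge0 (_ : _ - _ = (a - c) ^+ 2 + (b - d) ^+ 2); last by ring.
by rewrite addr_ge0// sqr_ge0.
Qed.

Lemma nsq_poly_bounded (q : {poly C}) :
  exists2 M, 0 <= M & forall z, nsq z <= 1 -> nsq q.[z] <= M.
Proof.
elim/poly_ind: q => [|q c [M M0 hM]].
  by exists 0 => // z _; rewrite horner0 /nsq/= expr0n addr0.
exists (2 * M + 2 * nsq c) => [|z z1]; first by rewrite addr_ge0// mulr_ge0// nsq_ge0.
rewrite hornerMXaddC (le_trans (nsqD_le _ _))// lerD2r ler_wpM2l// nsqM.
by rewrite -[M]mulr1 ler_pM ?nsq_ge0// hM.
Qed.

(* Homogeneous in (w, tau): where |tau| = 1 its modulus is the product of the
   distances from w / tau to the points of [s]. *)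
Definition hprod s p : C := \prod_(a <- s) (cx p.1 - cx a * cx p.2).

Lemma hprod_cons a s p : hprod (a :: s) p = (cx p.1 - cx a * cx p.2) * hprod s p.
Proof. by rewrite /hprod big_cons. Qed.

(** Here [cw] and [ct] are the partial derivatives of [hprod s] at [p]. They are quantified before
    the direction [(x, y)], so that a direction killing the first-order term can be chosen
    afterwards. *)
Lemma hprod_line s p : exists cw ct : C, forall x y, exists q : {poly C}, forall l : C,
  \prod_(a <- s) (cx p.1 + l * x - cx a * (cx p.2 + l * y)) =
  hprod s p + l * (x * cw + y * ct) + l ^+ 2 * q.[l].
Proof.
elim: s => [|a s [cw [ct IH]]].
  exists 0, 0 => x y; exists 0 => l.
  by rewrite /hprod !big_nil horner0 !mulr0 !addr0 mulr0 addr0.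
pose f0 := cx p.1 - cx a * cx p.2; pose h := hprod s p.
exists (f0 * cw + h), (f0 * ct - cx a * h) => x y.
have [q hq] := IH x y; pose f1 := x - cx a * y.
exists (f0 *: q + (f1 * (x * cw + y * ct))%:P + (f1 *: q) * 'X) => l.
rewrite big_cons hq hprod_cons -/f0 -/h !hornerE.
rewrite (_ : cx p.1 + l * x - cx a * (cx p.2 + l * y) = f0 + l * f1); last by rewrite /f0 /f1; ring.
by rewrite /f1; move: f0 h (q.[l]) (cx a) => f0 h ql ca; ring.
Qed.

Definition dotC x y : R := complex.Re x * complex.Re y + complex.Im x * complex.Im y.

Lemma nsqD x y : nsq (x + y) = nsq x + 2 * dotC x y + nsq y.
Proof. by case: x y => [a b] [c d]; rewrite /nsq /dotC/=; simpc => /=; ring. Qed.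

Lemma dotCDr x y z : dotC x (y + z) = dotC x y + dotC x z.
Proof. by case: x y z => [a b] [c d] [e f]; rewrite /dotC/=; simpc => /=; ring. Qed.

Lemma dotCN x y : dotC x (- y) = - dotC x y.
Proof. by case: x y => [a b] [c d]; rewrite /dotC/=; simpc => /=; ring. Qed.

Lemma dotC_le x y (k : R) : 0 < k -> 2 * dotC x y <= k * nsq x + k^-1 * nsq y.
Proof.
move=> k0; rewrite -(ler_pM2l k0) [X in _ <= X]mulrDr [X in _ <= _ + X]mulrA mulfV ?gt_eqF// mul1r.
case: x y => [a b] [c d]; rewrite /nsq /dotC/=.
rewrite -subr_ge0 (_ : _ - _ = (k * a - c) ^+ 2 + (k * b - d) ^+ 2); last by ring.
by rewrite addr_ge0// sqr_ge0.
Qed.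

Lemma nsqX x n : nsq (x ^+ n) = nsq x ^+ n.
Proof.
elim: n => [|n IH]; last by rewrite !exprS nsqM IH.
by rewrite !expr0 /nsq/= expr1n expr0n addr0.
Qed.

Lemma nsq_point (c q r l : C) (t M : R) : 0 < t <= 1 -> nsq l = t ^+ 2 -> nsq r <= M ->
  nsq (c + l ^+ 2 * (q + l * r)) <=
  nsq c + 2 * dotC c (l ^+ 2 * q) + t ^+ 3 * (nsq c + 3 * M + 2 * nsq q).
Proof.
move=> /andP[t0 t1] nl rM.
have M0 : 0 <= M := le_trans (nsq_ge0 r) rM.
have t30 : 0 < t ^+ 3 by rewrite exprn_gt0.
rewrite mulrDr mulrA -exprSr nsqD dotCDr.
have k1 := dotC_le c (l ^+ 3 * r) t30.
have k2 : (t ^+ 3)^-1 * nsq (l ^+ 3 * r) <= t ^+ 3 * M.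
  rewrite (nsqM (l ^+ 3) r) (nsqX l 3) nl -exprM mulrA (_ : (t ^+ 3)^-1 * t ^+ (2 * 3) = t ^+ 3).
    by rewrite ler_wpM2l// ltW.
  by rewrite (_ : (2 * 3 = 3 + 3)%N)// exprD mulrA mulVf ?mul1r// gt_eqF.
have k3 := nsqD_le (l ^+ 2 * q) (l ^+ 3 * r).
rewrite (nsqM (l ^+ 2) q) (nsqM (l ^+ 3) r) (nsqX l 2) (nsqX l 3) nl -!exprM in k3.
have t4 : t ^+ (2 * 2) <= t ^+ 3.
  by rewrite (_ : (2 * 2 = 3 + 1)%N)// exprD expr1 ler_piMr// ltW.
have t6 : t ^+ (2 * 3) <= t ^+ 3.
  by rewrite (_ : (2 * 3 = 3 + 3)%N)// exprD ler_piMr ?(ltW t30)// exprn_ile1// ltW.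
have k4 : t ^+ (2 * 2) * nsq q <= t ^+ 3 * nsq q by rewrite ler_wpM2r// nsq_ge0.
have k5 : t ^+ (2 * 3) * nsq r <= t ^+ 3 * M.
  by rewrite ler_pM// ?nsq_ge0// exprn_ge0// ltW.
move: k1 k2 k3 k4 k5.
move: (nsq (_ + _)) (t ^+ (2 * 2) * _) (t ^+ (2 * 3) * _) (_^-1 * _) => X1 X2 X3 X4.
move: (t ^+ 3) (nsq c) (nsq q) (dotC _ _) (dotC _ _) => T N Q D1 D2; clear.
move=> *; nra.
Qed.

(** In use the [l_i] are [t, -t, it, -it], with squares [t^2, t^2, -t^2, -t^2]: the second-order
    terms cancel in the sum and an error of order [t^3] remains. *)
Lemma nsq_fourpt (c q r1 r2 r3 r4 l1 l2 l3 l4 : C) (t M : R) : 0 < t <= 1 ->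
  nsq l1 = t ^+ 2 -> l2 ^+ 2 = l1 ^+ 2 -> l3 ^+ 2 = - l1 ^+ 2 -> l4 ^+ 2 = - l1 ^+ 2 ->
  nsq l2 = t ^+ 2 -> nsq l3 = t ^+ 2 -> nsq l4 = t ^+ 2 ->
  nsq r1 <= M -> nsq r2 <= M -> nsq r3 <= M -> nsq r4 <= M ->
  nsq (c + l1 ^+ 2 * (q + l1 * r1)) + nsq (c + l2 ^+ 2 * (q + l2 * r2)) +
  (nsq (c + l3 ^+ 2 * (q + l3 * r3)) + nsq (c + l4 ^+ 2 * (q + l4 * r4)))
  - 4 * nsq c <= t ^+ 3 * (4 * nsq c + 12 * M + 8 * nsq q).
Proof.
move=> t01 n1 e2 e3 e4 n2 n3 n4 h1 h2 h3 h4.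
have k1 := nsq_point c q t01 n1 h1; have k2 := nsq_point c q t01 n2 h2.
have k3 := nsq_point c q t01 n3 h3; have k4 := nsq_point c q t01 n4 h4.
have d2 : dotC c (l2 ^+ 2 * q) = dotC c (l1 ^+ 2 * q) by rewrite e2.
have d3 : dotC c (l3 ^+ 2 * q) = - dotC c (l1 ^+ 2 * q) by rewrite e3 mulNr dotCN.
have d4 : dotC c (l4 ^+ 2 * q) = - dotC c (l1 ^+ 2 * q) by rewrite e4 mulNr dotCN.
rewrite d2 in k2; rewrite d3 in k3; rewrite d4 in k4; move: k1 k2 k3 k4.
move: (nsq (c + l1 ^+ 2 * _)) (nsq (c + l2 ^+ 2 * _)) (nsq (c + l3 ^+ 2 * _)) (nsq (c + l4 ^+ 2 * _)).
move: (dotC _ _) (t ^+ 3) (nsq c) (nsq q) => D T N Q X1 X2 X3 X4; clear.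
move=> *; nra.
Qed.

(** The Levi form of [|h|^2] with [h] holomorphic is [|dh|^2], which vanishes on the kernel of [dh];
    in C^2 this kernel is never trivial. *)
Lemma nsq_hprod_degenerate s (K : R) : 0 <= K ->
  levi_degenerate (fun p => K * nsq (hprod s p)).
Proof.
move=> K0 p; have [cw [ct Hq]] := hprod_line s p.
(* A nonzero vector in the kernel of the differential: [(- ct, cw)], or [(1, 0)] when [cw = 0]. *)
have [x [y [xy0 xyE]]] : exists x y : C, (0 < nsq x + nsq y) /\ x * cw + y * ct = 0.
  have [c0|cn0] := eqVneq cw 0.
    exists 1, 0; rewrite c0 mulr0 mul0r addr0; split => //.
    by rewrite /nsq/= expr1n expr0n !addr0.
  exists (- ct), cw; split; last by ring.
  rewrite ltr_wpDl ?nsq_ge0// lt_neqAle nsq_ge0 andbT eq_sym.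
  apply: contra cn0; case: (cw) => a b; rewrite /nsq/= paddr_eq0 ?sqr_ge0//.
  by rewrite !sqrf_eq0 => /andP[/eqP-> /eqP->].
have [q hq] := Hq x y.
have [q0 [r qE]] : exists q0 r, q = r * 'X + q0%:P.
  by elim/poly_ind: q {hq} => [|r c _]; [exists 0, 0; rewrite mul0r addr0|exists c, r].
pose xi : C2 R := ((complex.Re x, complex.Im x), (complex.Re y, complex.Im y)).
exists xi => [//|th th0].
have [M M0 hM] := nsq_poly_bounded r.
pose c := hprod s p; pose D := 4 * nsq c + 12 * M + 8 * nsq q0.
have D0 : 0 <= D by rewrite !addr_ge0// ?mulr_ge0// nsq_ge0.
have KD1 : 0 < K * D + 1 by rewrite ltr_wpDl// mulr_ge0.
exists (Num.min 1 (th / (K * D + 1))); first by rewrite lt_min ltr01 divr_gt0.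
move=> t /andP[t0]; rewrite lt_min => /andP[t1 td].
have pt (l : C) (v : C2 R) : cx v.1 = cx p.1 + l * x -> cx v.2 = cx p.2 + l * y ->
    hprod s v = c + l ^+ 2 * (q0 + l * r.[l]).
  move=> E1 E2; rewrite /hprod; under eq_bigr do rewrite E1 E2.
  by rewrite hq xyE mulr0 addr0 qE hornerMXaddC -/c [q0 + _]addrC [l * _]mulrC.
have t01 : 0 < t <= 1 by rewrite t0 ltW.
have nl (l : C) : nsq l = t ^+ 2 -> nsq r.[l] <= M.
  by move=> E; apply: hM; rewrite E exprn_ile1// ltW.
pose l1 : C := (t +i* 0)%C; pose l2 : C := ((- t) +i* 0)%C.
pose l3 : C := (0 +i* t)%C; pose l4 : C := (0 +i* (- t))%C.
have [n1 n2 n3 n4] : [/\ nsq l1 = t ^+ 2, nsq l2 = t ^+ 2, nsq l3 = t ^+ 2 & nsq l4 = t ^+ 2].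
  by split; rewrite /nsq/=; ring.
have [e2 e3 e4] : [/\ l2 ^+ 2 = l1 ^+ 2, l3 ^+ 2 = - l1 ^+ 2 & l4 ^+ 2 = - l1 ^+ 2].
  by split; rewrite !expr2 /l1 /l2 /l3 /l4; simpc; congr (_ +i* _)%C; ring.
have F := nsq_fourpt c q0 t01 n1 e2 e3 e4 n2 n3 n4
  (nl _ n1) (nl _ n2) (nl _ n3) (nl _ n4).
have [P1 P2 P3 P4] : [/\ hprod s (p + t *: xi) = c + l1 ^+ 2 * (q0 + l1 * r.[l1]),
    hprod s (p - t *: xi) = c + l2 ^+ 2 * (q0 + l2 * r.[l2]),
    hprod s (p + t *: mulI xi) = c + l3 ^+ 2 * (q0 + l3 * r.[l3]) &
    hprod s (p - t *: mulI xi) = c + l4 ^+ 2 * (q0 + l4 * r.[l4])].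
  by split; apply: pt; rewrite /cx /l1 /l2 /l3 /l4 /xi /mulI /=; case: (x) => ? ?; case: (y) => ? ? /=;
    simpc; congr (_ +i* _)%C; rewrite /GRing.scale/=; ring.
rewrite /fourpt P1 P2 P3 P4 -/c.
rewrite -!mulrDr mulrCA -mulrBr.
apply: (@le_trans _ _ (K * (t ^+ 3 * D))); first by rewrite ler_wpM2l.
have KDt : K * D * t <= th.
  apply: (@le_trans _ _ ((K * D + 1) * t)); first by rewrite ler_wpM2r ?(ltW t0)// lerDl.
  by rewrite mulrC -ler_pdivlMr// ltW.
rewrite (_ : K * (t ^+ 3 * D) = K * D * t * t ^+ 2); last by ring.
by rewrite ler_wpM2r// sqr_ge0.
Qed.

End barrier.

(** With truncated subtraction [(i - k) + (k - i)] is [|i - k|], and [maxn 1] removes the zero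
    factor at [i = k]. *)
Lemma prod_dist (n k : nat) : (k < n)%N ->
  (\prod_(0 <= i < n) maxn 1 ((i - k) + (k - i)) = k`! * (n.-1 - k)`!)%N.
Proof.
elim: n => // n IH; rewrite ltnS leq_eqVlt => /predU1P[<-{n IH}|kn].
  rewrite /= subnn fact0 muln1 big_nat_recr//= subnn addn0 maxn0 muln1.
  rewrite fact_prod big_nat_rev/= add0n big_add1/=.
  apply: eq_big_nat => i /andP[_ ik]; lia.
rewrite big_nat_recr//= IH//.
have -> : maxn 1 (n - k + (k - n)) = (n.-1 - k).+1 by lia.
by rewrite -mulnA [((_)`! * _.+1)%N]mulnC -factS; congr (_ * _`!)%N; lia.
Qed.

Lemma bin_le2 (n k : nat) : ('C(n, k) <= 2 ^ n)%N.
Proof.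
have [kn|nk] := leqP k n; last by rewrite bin_small.
rewrite -[2%N]/((1 + 1)%N) expnDn (bigD1 (Ordinal (kn : (k < n.+1)%N)))//=.
by rewrite !exp1n !muln1 leq_addr.
Qed.

(** The quotient is [n] times the binomial coefficient of [n - 1] over [k], and each of these two
    factors is at most [2 ^ n]. *)
Lemma fact_split (n k : nat) : (k < n)%N -> (n`! <= 4 ^ n * (k`! * (n.-1 - k)`!))%N.
Proof.
case: n => // n; rewrite ltnS => kn /=.
rewrite factS -(bin_fact kn) mulnA leq_mul2r; apply/orP; right.
rewrite (_ : 4 = 2 * 2)%N// expnMn leq_mul//; first exact/ltnW/ltn_expl.
by rewrite (leq_trans (bin_le2 _ _))// leq_exp2l.
Qed.

Section nodes.
Variable R : realType.

(** The quotient [n^n / n!] is one term of the exponential series of [n]. *)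
Lemma fact_expR (n : nat) : n%:R ^+ n <= n`!%:R * expR n%:R :> R.
Proof.
case: n => [|n]; first by rewrite expr0 fact0 mul1r expR0.
have := @expR_ge1Dxn R n.+1%:R n (ler0n _ _) => h.
have f0 : 0 < (n.+1)`!%:R :> R by rewrite ltr0n fact_gt0.
by rewrite mulrC -ler_pdivrMr//; apply: le_trans h; rewrite lerDr ler01.
Qed.

(* If the node [k] is closest to [x], node [j] has distance at least [|j - k| l / (2 n)],
   so the product is at least [nu k! (n - 1 - k)! (l / (2 n)) ^ n]; then
   [n ^ n <= e ^ n n!] and [n! <= 4 ^ n k! (n - 1 - k)!] give the constant [8 e]. *)
Lemma prod_equispaced_ge (n : nat) (x a l nu : R) (d : 'I_n -> R) :
  0 < l <= 1 -> 0 < nu <= 1 ->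
  (forall j, nu <= d j) ->
  (forall j : 'I_n, `|x - (a + l * j%:R / n%:R)| <= d j) ->
  nu * (l / (8 * expR 1)) ^+ n <= \prod_(j < n) d j.
Proof.
move=> /andP[l0 l1] /andP[nu0 nu1] dnu dx.
case: n d dnu dx => [|n] d dnu dx; first by rewrite big_ord0 expr0 mulr1.
pose X (j : 'I_n.+1) : R := a + l * j%:R / n.+1%:R.
have [k _ kmin] : extremum_spec <=%R xpredT (fun j => `|x - X j|) _ :=
  arg_minP (i0 := ord0) (fun j => `|x - X j|) isT.
pose h : R := l / n.+1%:R / 2.
have n0 : 0 < n.+1%:R :> R by rewrite ltr0n.
have h0 : 0 < h by rewrite !divr_gt0.
have h1 : h <= 1.
  rewrite /h -mulrA -invfM ler_pdivrMr ?mulr_gt0// mul1r (le_trans l1)//.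
  by rewrite -natrM ler1n.
pose D (j : 'I_n.+1) : nat := maxn 1 ((j - k) + (k - j)).
(* The factor [h <= 1] is kept at [j = k] as well, so that the product contains the full power of
   [h]. *)
pose c (j : 'I_n.+1) : R := (if j == k then nu else 1) * (h * (D j)%:R).
have cd j : 0 <= c j <= d j.
  have c0 : 0 <= c j.
    apply: mulr_ge0; first by case: ifP => // _; exact: ltW.
    by rewrite mulr_ge0// ltW.
  rewrite c0 /c; case: ifPn => [/eqP->|jk].
    rewrite /D subnn maxn0 mulr1 (le_trans _ (dnu k))// -[leRHS]mulr1.
    by rewrite ler_wpM2l// ltW.
  rewrite mul1r; apply: le_trans (dx j).
  have -> : D j = ((j - k) + (k - j))%N.
    by apply/maxn_idPr; move: jk; rewrite -(inj_eq val_inj)/=; lia.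
  have e : h * ((j - k) + (k - j))%:R = `|X j - X k| / 2.
    have -> : ((j - k) + (k - j))%:R = `|j%:R - k%:R| :> R.
      have [kj|jk'] := leqP k j.
        by rewrite -natrB// ger0_norm// (eqP kj) addn0.
      rewrite distrC -natrB ?(ltnW jk')// ger0_norm//.
      by rewrite (eqP (ltnW jk')) add0n.
    rewrite /X opprD addrACA subrr add0r -!mulrA -mulrBr -mulrBl.
    rewrite !normrM (gtr0_norm l0) [`|n.+1%:R^-1|]gtr0_norm ?invr_gt0//.
    by rewrite /h; ring.
  rewrite e ler_pdivrMr// -/(X j).
  (* As [X k] is a nearest node to [x], the distance from [X j] to [X k] is at most twice that from
     [X j] to [x]. *)
  rewrite (_ : X j - X k = (x - X k) - (x - X j)); last by ring.
  apply: le_trans (ler_normB _ _) _.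
  by rewrite mulrDr mulr1 lerD//; exact: kmin.
apply: (@le_trans _ _ (\prod_(j < n.+1) c j)); last by apply: ler_prod => j _; exact: cd.
rewrite big_split/= [X in _ <= _ * X]big_split/= -big_mkcond/= (big_pred1 k)//.
rewrite prodr_const card_ord ler_wpM2l ?(ltW nu0)//.
have -> : \prod_(i < n.+1) (D i)%:R = (k`! * (n - k)`!)%:R :> R.
  rewrite -natr_prod -(prod_dist (ltn_ord k))/= big_mkord.
  by congr _%:R; apply: eq_bigr.
have kf := fact_split (ltn_ord k).
have ef := fact_expR n.+1.
have E0 : 0 < expR 1 :> R := expR_gt0 _.
have en : expR n.+1%:R = expR 1 ^+ n.+1 :> R by rewrite -expRM_natl mulr1.
rewrite en in ef.
have kf' : (n.+1)`!%:R <= 4 ^+ n.+1 * (k`! * (n - k)`!)%:R :> R.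
  by rewrite -natrX -natrM ler_nat.
move: kf' ef; set F := (k`! * _)%:R; set G := (n.+1)`!%:R => kf' ef.
have T8 : 0 < 8 ^+ n.+1 :> R by rewrite exprn_gt0.
have T2 : 0 < 2 ^+ n.+1 :> R by rewrite exprn_gt0.
have TN : 0 < n.+1%:R ^+ n.+1 :> R by rewrite exprn_gt0.
have TE : 0 < expR 1 ^+ n.+1 :> R by rewrite exprn_gt0.
have key : 2 ^+ n.+1 * n.+1%:R ^+ n.+1 <= 8 ^+ n.+1 * expR 1 ^+ n.+1 * F.
  rewrite (_ : 8 = 2 * 4 :> R); last by rewrite -natrM.
  rewrite exprMn -!mulrA ler_wpM2l ?(ltW T2)//; apply: le_trans ef _.
  by rewrite [_ * F]mulrC mulrA ler_wpM2r ?(ltW TE).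
rewrite /h !expr_div_n exprMn.
move: key T8 T2 TN TE; move: (8 ^+ _) (2 ^+ _) (n.+1%:R ^+ _) (expR 1 ^+ _) => a8 a2 aN aE.
move=> key T8 T2 TN TE; rewrite ler_pdivrMr ?mulr_gt0//.
rewrite (_ : _ * _ = l ^+ n.+1 * ((a8 * aE * F) / (a2 * aN))); last first.
  by field; rewrite !gt_eqF.
by rewrite ler_peMr ?exprn_ge0 ?(ltW l0)// ler_pdivlMr ?mulr_gt0// mul1r.
Qed.

End nodes.

Section arc_nodes.
Variable R : realType.

Lemma nsq_cx (z : C1 R) : nsq (cx z) = sqn z. Proof. by []. Qed.

Lemma cxB (y z : C1 R) : cx (y - z) = cx y - cx z.
Proof. by case: y z => [a b] [c d]; rewrite /cx/=; simpc. Qed.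

Lemma ivt_image (f : R -> R) (y : R) : continuous f ->
  Num.min (f 0) (f 1) <= y <= Num.max (f 0) (f 1) ->
  exists2 t, t \in `[0, 1] & f t = y.
Proof. by move=> cf; apply: IVT => //; exact: continuous_subspaceT. Qed.

(* Some coordinate of the arc is not constant, so by the intermediate value
   theorem the arc contains points whose coordinate is equally spaced. *)
Lemma arc_nodes (gamma : R -> C1 R) : continuous gamma ->
  {in `[0, 1] &, injective gamma} ->
  exists2 r, 0 < r <= 1 & forall (nu : R) (n : nat), 0 < nu <= 1 ->
    exists s : seq (C1 R), [/\ size s = n,
      forall a, a \in s -> exists2 t, t \in `[0, 1] & gamma t = a &
      forall z, (forall t, t \in `[0, 1] -> nu <= sqn (z - gamma t)) ->
        nu * r ^+ n <= \prod_(a <- s) sqn (z - a)].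
Proof.
move=> cg ig.
have in0 : 0 \in `[0, 1 : R] by rewrite in_itv/= lexx ler01.
have in1 : 1 \in `[0, 1 : R] by rewrite in_itv/= lexx ler01.
(* Injectivity separates the endpoints of the arc, so one of the two coordinates does; a coordinate
   does not increase distances. *)
have [c [cc ccn c01]] : exists c : C1 R -> R,
    [/\ continuous c, (forall y z, (c y - c z) ^+ 2 <= sqn (y - z)) & c (gamma 0) != c (gamma 1)].
  have [e1|n1] := eqVneq (gamma 0).1 (gamma 1).1; last first.
    exists fst; split => //; first by move=> z; exact: cvg_fst.
    by move=> y z; rewrite /sqn/= lerDl sqr_ge0.
  exists snd; split => //; first by move=> z; exact: cvg_snd.
    by move=> y z; rewrite /sqn/= lerDr sqr_ge0.
  apply/eqP => e2; have : gamma 0 = gamma 1.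
    by rewrite [LHS]surjective_pairing [RHS]surjective_pairing e1 e2.
  by move/(ig _ _ in0 in1)/eqP; rewrite eq_sym oner_eq0.
pose f t := c (gamma t).
have cf : continuous f by move=> t; apply: continuous_comp; [exact: cg|exact: cc].
pose al := Num.min (f 0) (f 1); pose l := Num.min 1 (Num.max (f 0) (f 1) - al).
have l0 : 0 < l.
  rewrite lt_min ltr01/= subr_gt0 /al /f.
  by case: (ltgtP (c (gamma 0)) (c (gamma 1))) c01.
have l1 : l <= 1 by rewrite ge_min lexx.
pose r := l / (8 * expR 1).
have E1 : 1 <= 8 * expR 1 :> R.
  have h1 : 1 <= expR 1 :> R by have := @expR_ge1Dx R 1; lra.
  by move: h1; lra.
have r0 : 0 < r by rewrite divr_gt0// mulr_gt0// expR_gt0.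
have r1 : r <= 1 by rewrite ler_pdivrMr ?(lt_le_trans ltr01)// mul1r (le_trans l1).
(* The estimate for equally spaced nodes concerns distances, whereas [sqn] is a squared distance;
   for the same reason it is applied below with the square root of [nu]. *)
exists (r ^+ 2); first by rewrite exprn_gt0// exprn_ile1// ltW.
move=> nu n /andP[nu0 nu1].
have /choice[t tP] (j : 'I_n) : exists t : R, t \in `[0, 1] /\ f t = al + l * j%:R / n%:R.
  have n0 : 0 < n%:R :> R by rewrite ltr0n; case: (n) j => // -[].
  have [|t tI tE] := @ivt_image f (al + l * j%:R / n%:R) cf; last by exists t.
  rewrite -/al lerDl divr_ge0 ?mulr_ge0 ?(ltW l0) ?(ltW n0)//=.
  rewrite -lerBrDl; apply: (@le_trans _ _ l); last by rewrite ge_min lexx orbT.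
  by rewrite ler_pdivrMr// ler_wpM2l ?(ltW l0)// ler_nat ltnW.
exists [seq gamma (t j) | j <- enum 'I_n]; split.
- by rewrite size_map size_enum_ord.
- by move=> a /mapP[j _ ->]; exists (t j) => //; have [] := tP j.
move=> z hz; rewrite big_map big_enum/=.
pose d (j : 'I_n) := Num.sqrt (sqn (z - gamma (t j))).
have snu : 0 < Num.sqrt nu <= 1.
  by rewrite sqrtr_gt0 nu0/= -sqrtr1 ler_wsqrtr.
have := @prod_equispaced_ge R n (c z) al l (Num.sqrt nu) d _ snu _ _.
rewrite l0 l1 => /(_ isT) h.
have {}h : Num.sqrt nu * r ^+ n <= \prod_(j < n) d j.
  apply: h => j; rewrite /d.
    by apply: ler_wsqrtr; apply: hz; have [] := tP j.
  have [_ <-] := tP j; rewrite -sqrtr_sqr; apply: ler_wsqrtr; exact: ccn.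
have -> : \prod_(j < n) sqn (z - gamma (t j)) = (\prod_(j < n) d j) ^+ 2.
  by rewrite -prodrXl; apply: eq_bigr => j _; rewrite sqr_sqrtr// sqn_ge0.
rewrite -[nu]sqr_sqrtr ?(ltW nu0)// -exprM mulnC exprM -exprMn.
rewrite ler_pXn2r// nnegrE ?prodr_ge0//; last by move=> j _; exact: sqrtr_ge0.
by rewrite mulr_ge0// ?sqrtr_ge0// exprn_ge0// ltW.
Qed.

Lemma hprod_small (s : seq (C1 R)) (A q : R) (p : C2 R) : 0 <= A ->
  (forall a, a \in s -> sqn a <= A) -> sqn p.1 <= q -> sqn p.2 <= q ->
  nsq (hprod s p) <= (2 * (1 + A) * q) ^+ size s.
Proof.
move=> A0 + p1 p2; elim: s => [|a s IH] sA.
  by rewrite /hprod big_nil expr0 /nsq/= expr1n expr0n addr0.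
rewrite hprod_cons nsqM exprS ler_pM ?nsq_ge0//; last first.
  by apply: IH => b bs; apply: sA; rewrite inE bs orbT.
rewrite -[- (cx a * _)]mulNr; apply: le_trans (nsqD_le _ _) _.
rewrite -mulrDr -mulrA ler_wpM2l// mulrDl mul1r lerD ?nsq_cx//.
rewrite nsqM (_ : nsq (- cx a) = sqn a); last first.
  by rewrite /nsq /sqn/= !sqrrN.
by rewrite ler_pM ?sqn_ge0// ?nsq_ge0//; apply: sA; rewrite inE eqxx.
Qed.

(** Controls the barrier on the outer side of the bidisc. Each factor is at least 1 because
    [|w|^2 <= 2 |w - a tau|^2 + 2 |a tau|^2]. *)
Lemma hprod_large (s : seq (C1 R)) (A : R) (p : C2 R) :
  (forall a, a \in s -> sqn a <= A) -> 2 * (A + 1) <= sqn p.1 -> sqn p.2 <= 1 ->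
  1 <= nsq (hprod s p).
Proof.
move=> + p1 p2; elim: s => [|a s IH] sA.
  by rewrite /hprod big_nil /nsq/= expr1n expr0n addr0.
rewrite hprod_cons nsqM -[1]mulr1 ler_pM//; last first.
  by apply: IH => b bs; apply: sA; rewrite inE bs orbT.
have aA : sqn a <= A by apply: sA; rewrite inE eqxx.
have := nsqD_le (cx p.1 - cx a * cx p.2) (cx a * cx p.2).
rewrite subrK nsqM !nsq_cx => h.
have ap : sqn a * sqn p.2 <= A.
  by rewrite -[A]mulr1 ler_pM ?sqn_ge0.
by move: h ap p1; move: (nsq _) (sqn a * _) (sqn p.1) => X Y Z; clear; lra.
Qed.

Lemma hprod_circle (s : seq (C1 R)) (p : C2 R) (z : C1 R) : sqn p.2 = 1 ->
  cx z * cx p.2 = cx p.1 -> nsq (hprod s p) = \prod_(a <- s) sqn (z - a).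
Proof.
move=> p2 zE; elim: s => [|a s IH].
  by rewrite /hprod !big_nil /nsq/= expr1n expr0n addr0.
rewrite hprod_cons big_cons nsqM IH; congr (_ * _).
by rewrite -zE -mulrBl nsqM nsq_cx p2 mulr1 -cxB.
Qed.

Lemma nsq_hprod_continuous (s : seq (C1 R)) : continuous (fun p => nsq (hprod s p)).
Proof.
have [c1 c2 c3 c4] := @coord_continuous R.
elim: s => [|a s IH].
  under [X in continuous X]eq_fun do rewrite /hprod big_nil.
  by move=> p; exact: cvg_cst.
under [X in continuous X]eq_fun do rewrite hprod_cons nsqM.
move=> p; apply: cvgM; last exact: IH.
have -> : (fun p : C2 R => nsq (cx p.1 - cx a * cx p.2)) =
    (fun p => (p.1.1 - (a.1 * p.2.1 - a.2 * p.2.2)) * (p.1.1 - (a.1 * p.2.1 - a.2 * p.2.2)) +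
              (p.1.2 - (a.1 * p.2.2 + a.2 * p.2.1)) * (p.1.2 - (a.1 * p.2.2 + a.2 * p.2.1))).
  by apply/funext => -[[x y] [u v]]; rewrite /nsq /cx/=; case: a => a b; simpc.
have k (b : R) (g : C2 R -> R) : continuous g -> b * g x @[x --> p] --> b * g p.
  by move=> cg; apply: cvgM; [exact: cvg_cst|exact: cg].
have d1 : (p.1.1 - (a.1 * p.2.1 - a.2 * p.2.2)) @[p --> p] --> p.1.1 - (a.1 * p.2.1 - a.2 * p.2.2).
  by apply: cvgB; [exact: c1|apply: cvgB; exact: k].
have d2 : (p.1.2 - (a.1 * p.2.2 + a.2 * p.2.1)) @[p --> p] --> p.1.2 - (a.1 * p.2.2 + a.2 * p.2.1).
  by apply: cvgB; [exact: c2|apply: cvgD; exact: k].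
by apply: cvgD; apply: cvgM.
Qed.

End arc_nodes.

(** * Upper bound for subsolutions *)

Section upper_bound.
Variable R : realType.
Implicit Types (u g : C2 R -> \bar R) (B f : C2 R -> R) (p q : C2 R).

Definition usc4 (D : set (C2 R)) u := forall p (a : R), D p -> (u p < a%:E)%E ->
  \forall q \near p, D q -> (u q < a%:E)%E.

Lemma usc4_bounded D u : compact D -> usc4 D u -> (forall p, D p -> (u p < +oo)%E) ->
  exists2 C, 0 <= C & forall p, D p -> (u p <= C%:E)%E.
Proof.
move=> cD su uf.
have := (@compact_near_coveringP _ D).1 cD R (+oo%R) (fun c q => D q -> (u q <= c%:E)%E).
case=> [p Dp|M [Mr MP]].
  have [a ua] : exists a : R, (u p < a%:E)%E.
    have := uf p Dp; case: (u p) => [r _||_] //; first by exists (r + 1); rewrite lte_fin ltrDl.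
    by exists 0; rewrite ltNy0.
  have h := su p a Dp ua.
  exists ([set q | D q -> (u q < a%:E)%E], [set c | a <= c]) => /=.
    by split; [exact: h|apply: nbhs_pinfty_ge; exact: num_real].
  move=> [q c] [/= h1 h2 Dq]; apply/ltW/(lt_le_trans (h1 Dq)).
  by rewrite lee_fin; exact: h2.
have M1 : M < Num.max 0 M + 1 by rewrite ltr_pwDr// le_max lexx orbT.
exists (Num.max 0 M + 1) => [|p Dp]; first by rewrite addr_ge0// le_max lexx.
exact: (MP _ M1 p Dp Dp).
Qed.

(** Positivity of the current is available only for [|tau| < 1], so mollifications stay away from
    the boundary. Semicontinuity and compactness carry the boundary bound to a layer inside, at the
    price of another [eta]. *)
Lemma usc4_layer (a eta : R) u B : usc4 (bidisc a 1) u -> continuous B -> 0 < eta ->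
  (forall p, bidisc a 1 p -> sqn p.2 = 1 -> (u p <= (B p + eta)%:E)%E) ->
  exists2 b, 0 < b < 1 &
    forall p, bidisc a 1 p -> b <= sqn p.2 -> (u p <= (B p + 2 * eta)%:E)%E.
Proof.
move=> su cB eta0 ub.
have := (@compact_near_coveringP _ (bidisc a 1)).1 (@bidisc_compact R a 1) R (1%R^'-)
  (fun c q => bidisc a 1 q -> c <= sqn q.2 -> (u q <= (B q + 2 * eta)%:E)%E).
case=> [p Dp|r /= r0 rP].
  have [p1|p1] := eqVneq (sqn p.2) 1.
    have up : (u p < (B p + 3 / 2 * eta)%:E)%E.
      by apply: le_lt_trans (ub p Dp p1) _; rewrite lte_fin; lra.
    have n1 := su p _ Dp up.
    have e2 : 0 < eta / 2 by rewrite divr_gt0.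
    have n2 : \forall q \near p, `|B p - B q| < eta / 2.
      by have /cvgrPdist_lt := cB p; apply.
    exists ([set q | (bidisc a 1 q -> (u q < (B p + 3 / 2 * eta)%:E)%E) /\
                      `|B p - B q| < eta / 2], setT) => /=.
      by split; [exact: filterI n1 n2|exact: filterT].
    move=> [q c] [/= [h1 h2] _ Dq _]; apply/ltW/(lt_le_trans (h1 Dq)).
    by rewrite lee_fin; move: h2; rewrite ltr_norml => /andP[]; lra.
  have p2 : sqn p.2 < 1 by rewrite lt_neqAle p1; case: Dp.
  pose m := (1 + sqn p.2) / 2.
  have m1 : sqn p.2 < m by rewrite /m; lra.
  have m2 : m < 1 by rewrite /m; lra.
  exists ([set q | sqn q.2 < m], [set c | m < c]) => /=.
    split; last exact: nbhs_left_gt.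
    exact: (nbhs_sublevel (@sqn2_continuous R) m1).
  by move=> [q c] [/= h1 h2 Dq /(lt_le_trans h2)]; rewrite ltNge (ltW h1).
pose b := Num.max (1 / 2) (1 - r / 2).
have b1 : b < 1 by rewrite gt_max; apply/andP; split; lra.
exists b; first by rewrite b1 andbT lt_max; apply/orP; left; lra.
move=> p Dp bp; apply: (rP b _ b1 p Dp Dp bp) => /=.
rewrite gtr0_norm ?subr_gt0//.
have : 1 - r / 2 <= b by rewrite le_max lexx orbT.
by lra.
Qed.

End upper_bound.

(** * Truncation of locally integrable potentials *)

Section truncation.
Variable R : realType.
Implicit Types (u g : C2 R -> \bar R) (f : C2 R -> R) (p q : C2 R) (eta : @form11 R).

Lemma supp_iter_derive (V : normedModType R) (f : V -> R) (K : set V) (vs : seq V) :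
  closed K -> (forall x, ~ K x -> f x = 0) ->
  forall x, ~ K x -> iter_derive vs f x = 0.
Proof.
move=> clK fK; elim: vs => [//|v vs IH] x nKx.
exact: (supp_derive v clK IH).
Qed.

Lemma test_functionS (V : normedModType R) (O O' : set V) (f : V -> R) : O `<=` O' ->
  test_function O f -> test_function O' f.
Proof.
by move=> OO [sf [K [cK KO z]]]; split => //; exists K; split => //; exact: subset_trans KO OO.
Qed.

Lemma test_formS (O O' : set (C2 R)) eta : O `<=` O' -> test_form O eta -> test_form O' eta.
Proof. by move=> OO [t1 t2 t3 t4]; split; exact: test_functionS OO _. Qed.

Lemma ddc_form_compact (O : set (C2 R)) eta : test_form O eta ->
  exists K, [/\ compact K, K `<=` O, forall p, ~ K p -> ddc_form eta p = 0 &
    [/\ forall p, ~ K p -> h11 eta p = 0, forall p, ~ K p -> h22 eta p = 0,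
        forall p, ~ K p -> h12re eta p = 0 & forall p, ~ K p -> h12im eta p = 0]].
Proof.
move=> [[_ [K1 [c1 O1 z1]]] [_ [K2 [c2 O2 z2]]] [_ [K3 [c3 O3 z3]]] [_ [K4 [c4 O4 z4]]]].
pose K := (K1 `|` K2) `|` (K3 `|` K4).
have cK : compact K by do 2!apply: compactU => //; exact: compactU.
have clK := compact_closed_normed cK.
have y1 p : ~ K p -> h11 eta p = 0 by move=> nK; apply: z1 => k; apply: nK; left; left.
have y2 p : ~ K p -> h22 eta p = 0 by move=> nK; apply: z2 => k; apply: nK; left; right.
have y3 p : ~ K p -> h12re eta p = 0 by move=> nK; apply: z3 => k; apply: nK; right; left.
have y4 p : ~ K p -> h12im eta p = 0 by move=> nK; apply: z4 => k; apply: nK; right; right.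
exists K; split => //.
  by move=> p [[/O1|/O2]|[/O3|/O4]].
move=> p nK; rewrite /ddc_form.
rewrite !(supp_iter_derive _ clK y1 nK) !(supp_iter_derive _ clK y2 nK).
by rewrite !(supp_iter_derive _ clK y3 nK) !(supp_iter_derive _ clK y4 nK) !addr0 subr0 mulr0 subr0 mulr0.
Qed.

Lemma ddc_form_continuous (O : set (C2 R)) eta : test_form O eta -> continuous (ddc_form eta).
Proof.
move=> [[s1 _] [s2 _] [s3 _] [s4 _]] p.
have c f v w : smooth f -> iter_derive [:: v; w] f x @[x --> p] --> iter_derive [:: v; w] f p.
  by move=> sf; exact: (smooth_continuous (smooth_derive v (smooth_derive w sf))).
rewrite /ddc_form; apply: cvgM; first exact: cvg_cst.
apply: cvgB; last (apply: cvgM; first exact: cvg_cst).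
  by apply: cvgD; [apply: cvgD; [apply: cvgD|]|]; exact: c.
by apply: cvgB; [apply: cvgD; [apply: cvgD|]|]; exact: c.
Qed.

(** A real function integrable on all of C^2 that agrees with [u] almost everywhere on [K]: [fine]
    replaces the infinite values, taken on a null set when [u] is integrable on [K], by 0. *)
Definition trunc (K : set (C2 R)) u p : R := fine ((u \_ K) p).

Lemma trunc_int4 (K : set (C2 R)) u : compact K -> leb4.-integrable K u -> int4 (trunc K u).
Proof.
move=> cK; have [mK _] := compact_leb4 cK.
move=> /(integrable_mkcond _ mK) iu.
have mu := measurable_int _ iu.
apply: (le_integrable measurableT _ _ iu).
  by apply/measurable_EFinP; apply: (measurableT_comp _ mu); exact: fine_measurable.
by move=> p _; rewrite /trunc /=; case: ((u \_ K) p) => [r||] //=; rewrite normr0 leey.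
Qed.

Lemma trunc_ae (K : set (C2 R)) u : compact K -> leb4.-integrable K u ->
  {ae leb4, forall p : M4 R, K p -> u p = (trunc K u p)%:E}.
Proof.
move=> cK iu; have [mK _] := compact_leb4 cK.
have := integrable_ae mK iu; apply: filterS => p h Kp.
by rewrite /trunc patchT ?inE// fineK//; exact: h.
Qed.

Lemma ddc_current4_trunc (O K : set (C2 R)) u eta : compact K -> leb4.-integrable K u ->
  test_form O eta -> (forall p, ~ K p -> ddc_form eta p = 0) ->
  ddc_current4 u eta = (I4 (fun p => trunc K u p * ddc_form eta p))%:E.
Proof.
move=> cK iu tf z; have [mK _] := compact_leb4 cK.
have cd := ddc_form_continuous tf.
have it := trunc_int4 cK iu.
have ii := int4M_cc it cd (ex_intro2 _ _ K cK z).
rewrite (I4E ii) /ddc_current4.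
have E p : (u p * (ddc_form eta p)%:E = (u \_ K) p * (ddc_form eta p)%:E)%E.
  by rewrite patchE; case: ifPn => // /negP; rewrite inE => /z ->; rewrite !mule0.
under eq_integral do rewrite E.
apply: ae_eq_integral => //.
- apply: emeasurable_funM; first by apply: measurable_int; exact/(integrable_mkcond _ mK)/iu.
  by apply/measurable_EFinP; exact: continuous_measurable4.
- by apply/measurable_EFinP; exact: int4_measurable.
have := trunc_ae cK iu; apply: filterS => p h _.
rewrite patchE; case: ifPn => [|/negP].
  by rewrite inE => Kp; rewrite (h Kp) EFinM.
by rewrite inE => /z ->; rewrite mulr0 mul0e.
Qed.

End truncation.

Section barrier_bound.
Variable R : realType.
Implicit Types (u g : C2 R -> \bar R) (f B : C2 R -> R) (p q y : C2 R).

(** Room for mollification: balls around the middle bidisc stay in the outer one, and balls around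
    its boundary stay in the layer where a bound is already known. *)
Lemma bidisc_margin (a0 a1 a2 b0 b1 b2 : R) : a0 < a1 < a2 -> b0 < b1 < b2 ->
  exists2 d, 0 < d & forall p y, bidisc a1 b1 p -> `|p - y| < d ->
    [/\ sqn y.1 < a2, sqn y.2 < b2, sqn p.1 = a1 -> a0 < sqn y.1 &
        sqn p.2 = b1 -> b0 < sqn y.2].
Proof.
move=> /andP[a01 a12] /andP[b01 b12].
pose c := Num.min (Num.min (a1 - a0) (a2 - a1)) (Num.min (b1 - b0) (b2 - b1)).
have c0 : 0 < c by rewrite !lt_min !subr_gt0 a01 a12 b01 b12.
have [d1 d10 h1] := compact_unif_continuous (@bidisc_compact R a1 b1)
  (fun x _ => @sqn1_continuous R x) c0.
have [d2 d20 h2] := compact_unif_continuous (@bidisc_compact R a1 b1)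
  (fun x _ => @sqn2_continuous R x) c0.
exists (Num.min d1 d2) => [|p y Qp]; first by rewrite lt_min d10.
rewrite lt_min => /andP[/(h1 _ _ Qp) k1 /(h2 _ _ Qp) k2].
case: Qp => q1 q2; move: k1 k2; rewrite !lt_min !ltr_norml.
move: q1 q2; move: (sqn p.1) (sqn p.2) (sqn y.1) (sqn y.2) => x1 x2 y1 y2.
move=> q1 q2 /andP[/andP[/andP[A1 A2] /andP[A3 A4]] _].
move=> /andP[_ /andP[/andP[B1 B2] /andP[B3 B4]]].
by split; [lra|lra|move=> E; lra|move=> E; lra].
Qed.

(** The bound is given only on the layer near the boundary. The maximum principle is applied on the
    intermediate bidisc [bidisc a1 b1], whose boundary lies in that layer, to mollifications of [u]
    truncated to the larger [K]. *)
Lemma barrier_ae u B (a0 a2 b0 eta k r : R) (q : C2 R) :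
  a0 < a2 -> b0 < 1 ->
  locally_integrable4 [set p : C2 R | sqn p.2 < 1] u ->
  (forall w, test_form [set p : C2 R | sqn p.2 < 1] w -> positive_form w ->
     (0 <= ddc_current4 u w)%E) ->
  continuous B -> levi_degenerate B -> (forall p, 0 <= B p) -> 0 < eta ->
  (forall p, bidisc a2 1 p -> a0 <= sqn p.1 \/ b0 <= sqn p.2 ->
     (u p <= (B p + 2 * eta)%:E)%E) ->
  (forall p, `|p - q| < r -> bidisc a0 b0 p /\ B p + 3 * eta <= k) ->
  {ae leb4, forall y : M4 R, `|(y : C2 R) - q| < r -> (u y <= k%:E)%E}.
Proof.
move=> a02 b01 li pos cB lB B0 eta0 bd kq.
pose a1 := (a0 + a2) / 2; pose b1 := (b0 + 1) / 2; pose b2 := (b1 + 1) / 2.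
have A : a0 < a1 < a2 by rewrite /a1; apply/andP; split; lra.
have Bb : b0 < b1 < b2 by rewrite /b2 /b1; apply/andP; split; lra.
have b21 : b2 < 1 by rewrite /b2 /b1; lra.
pose K := bidisc a2 b2; have cK : compact K := @bidisc_compact R a2 b2.
have KO : K `<=` [set p : C2 R | sqn p.2 < 1] by move=> p [_ h]; exact: le_lt_trans h b21.
have iK := li K cK KO; pose U := trunc K u; have iU : int4 U := trunc_int4 cK iK.
pose O' := [set p : C2 R | sqn p.1 < a2 /\ sqn p.2 < b2].
have pU : psh_dist O' U.
  move=> w tw pw; have [L [cL LO z _]] := ddc_form_compact tw.
  have tw' : test_form [set p : C2 R | sqn p.2 < 1] w.
    by apply: test_formS tw => p [_ h]; exact: lt_trans h b21.
  have := pos w tw' pw; rewrite (ddc_current4_trunc cK iK tw'); first by rewrite lee_fin.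
  by move=> p nK; apply: z => /LO[h1 h2]; apply: nK; split; exact: ltW.
have [d1 d10 h1] := bidisc_margin A Bb.
have [d2 d20 h2] := compact_unif_continuous (@bidisc_compact R a1 b1)
  (fun x _ => cB x) eta0.
pose d := Num.min d1 d2; have d0 : 0 < d by rewrite lt_min d10.
(* The truncation sends -oo to 0, whence the condition [0 <= x]; it holds in the application since
   [B] is nonnegative and [eta] positive. *)
have UB y x : K y -> (u y <= x%:E)%E -> 0 <= x -> U y <= x.
  move=> Ky; rewrite /U /trunc patchT ?inE//.
  by case: (u y) => [z|//|] /=; rewrite ?lee_fin.
pose S p := bidisc a0 b0 p /\ B p + 3 * eta <= k.
have mU e p : 0 < e < d -> S p -> moll U e p <= k * I4 (rho e).
  move=> /andP[e0 ed] [[p1 p2] pk].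
  have c0 := I4_rho_gt0 e0.
  have {ed}[ed1 ed2] : e < d1 /\ e < d2 by apply/andP; rewrite -lt_min.
  have bO x : bidisc a1 b1 x -> cball4 x e `<=` O'.
    move=> Qx y; rewrite /cball4/= distrC => xy.
    by have [] := h1 x y Qx (le_lt_trans xy ed1).
  have Qp : bidisc a1 b1 p.
    case/andP: A => A1 A2; case/andP: Bb => B1 B2.
    by split; [exact: le_trans p1 (ltW A1)|exact: le_trans p2 (ltW B1)].
  have bdry x : bidisc a1 b1 x -> sqn x.1 = a1 \/ sqn x.2 = b1 ->
      moll U e x <= I4 (rho e) * B x + I4 (rho e) * (3 * eta).
    move=> Qx x12; rewrite -mulrDr mulrC.
    (* Of the [3 * eta], two come from the layer and one from the oscillation of [B] over the
       mollification ball. *)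
    rewrite (_ : 3 * eta = 2 * (3 / 2 * eta)); last by lra.
    apply: moll_le_boundary => // y; rewrite distrC => xy.
    have [y1 y2 e1 e2] := h1 x y Qx (lt_trans xy ed1).
    have := h2 x y Qx (lt_trans xy ed2); rewrite ltr_norml => /andP[g1 g2].
    have By := B0 y.
    apply: (@le_trans _ _ (B y + 2 * eta)); last by clear -g1 g2; lra.
    apply: UB; first by split; exact: ltW.
      apply: bd; first by split; apply: ltW => //; exact: lt_trans y2 b21.
      by case: x12 => [/e1|/e2] /ltW; [left|right].
    by clear -By eta0; lra.
  have := moll_maximum iU pU cB lB c0 bO bdry Qp.
  move/le_trans; apply; rewrite -mulrDr mulrC.
  by apply: ler_wpM2r pk; exact: ltW.
have hae := moll_le_ae iU d0 kq mU.
have tae := trunc_ae cK iK.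
apply: filterS2 hae tae => y hy ty yq.
have [[y1 y2] _] := kq y yq.
rewrite ty; first by rewrite lee_fin; exact: hy.
case/andP: A => A1 A2; case/andP: Bb => B1 B2.
split; first exact: le_trans y1 (ltW (lt_trans A1 A2)).
exact: le_trans y2 (ltW (lt_trans B1 B2)).
Qed.

(** On a small ball the continuous [f] is constant up to [e], so the almost everywhere bound on the
    sum becomes one on [g], to which the essential-supremum property applies. *)
Lemma ess_sup_le f g (O : set (C2 R)) (k r : R) q : continuous f -> 0 < r ->
  (forall p, `|p - q| < r -> O p) ->
  (forall V, open V -> V `<=` O -> forall a : R,
    {ae leb4, forall p : M4 R, V p -> (g p <= a%:E)%E} -> forall p, V p -> (g p <= a%:E)%E) ->
  {ae leb4, forall y : M4 R, `|(y : C2 R) - q| < r -> ((f y)%:E + g y <= k%:E)%E} ->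
  ((f q)%:E + g q <= k%:E)%E.
Proof.
move=> cf r0 rO hg hae; apply/lee_addgt0Pr => e e0.
have /nbhs_ballP[d /= d0 dP] : \forall y \near q, `|f q - f y| < e.
  by have /cvgrPdist_lt := cf q; apply.
pose V := ball q (Num.min d r).
have m0 : 0 < Num.min d r by rewrite lt_min d0.
have Vd y : V y -> `|y - q| < r /\ `|f q - f y| < e.
  rewrite /V -ball_normE/= lt_min => /andP[h1 h2]; split; first by rewrite distrC.
  by apply: dP; rewrite -ball_normE.
have VO : V `<=` O by move=> y /Vd[h _]; exact: rO.
have oV : open V by exact: ball_open.
have := hg V oV VO (k - f q + e) _ q (ballxx _ m0).
move=> h; rewrite (_ : (k%:E + e%:E)%E = (f q)%:E + (k - f q + e)%:E)%E; last first.
  by rewrite -!EFinD; congr EFin; ring.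
apply: leeD2l; apply: h.
apply: filterS hae => y hy /Vd[y1 y2]; have := hy y1; move: y2.
rewrite ltr_norml => /andP[_ y2].
case: (g y) => [z||] h; [|by rewrite leye_eq in h|exact: leNye].
by move: h; rewrite -EFinD !lee_fin; lra.
Qed.

End barrier_bound.

Section arc_upper_bound.
Variable R : realType.
Implicit Types (u g : C2 R -> \bar R) (f B : C2 R -> R) (p q y : C2 R) (z : C1 R).

Lemma norm_lt_sqn z (d : R) : 0 < d -> sqn z < d ^+ 2 -> `|z| < d.
Proof.
move=> d0 h; have k (x : R) : x ^+ 2 <= sqn z -> `|x| < d.
  move=> xz; rewrite -(ltr_pXn2r (n := 2)) ?nnegrE// ?(ltW d0)// real_normK ?num_real//.
  exact: le_lt_trans xz h.
by rewrite prod_normE gt_max !k// ?lerDl ?lerDr sqr_ge0.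
Qed.

Lemma exp2_dominates (C e : R) : 0 < e -> exists n : nat, C / 2 ^+ n <= e.
Proof.
move=> e0; exists (Num.bound `|C / e|).
have n2 : 0 < 2 ^+ Num.bound `|C / e| :> R by rewrite exprn_gt0.
rewrite ler_pdivrMr// mulrC -ler_pdivrMr//.
apply: (@le_trans _ _ (Num.bound `|C / e|)%:R).
  by apply: le_trans (ler_norm _) _; apply/ltW/archi_boundP; exact: normr_ge0.
by rewrite -natrX ler_nat ltnW// ltn_expl.
Qed.

Lemma cx_circle p : sqn p.2 = 1 -> exists z, cx z * cx p.2 = cx p.1.
Proof.
case: p => [[a b] [c d]]; rewrite /sqn/= => h.
exists (a * c + b * d, b * c - a * d); rewrite /cx/=; simpc.
congr (_ +i* _)%C.
  by rewrite -[RHS]mulr1 -h; ring.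
by rewrite -[RHS]mulr1 -h; ring.
Qed.

Lemma arc_upper_bound (gamma : R -> C1 R) (v : C1 R -> R) :
  continuous gamma -> {in `[0, 1] &, injective gamma} -> continuous v ->
  (forall t, t \in `[0, 1] -> v (gamma t) = 0) ->
  exists2 q, 0 < q < 1 & forall f g (u := fun p => ((f p)%:E + g p)%E), continuous f ->
    (forall a, usc4 (bidisc a 1) u) ->
    (forall p, sqn p.2 <= 1 -> (u p < +oo)%E) ->
    (forall p z, sqn p.2 = 1 -> cx z * cx p.2 = cx p.1 -> (u p <= (v z)%:E)%E) ->
    locally_integrable4 [set p : C2 R | sqn p.2 < 1] u ->
    (forall w, test_form [set p : C2 R | sqn p.2 < 1] w -> positive_form w ->
       (0 <= ddc_current4 u w)%E) ->
    (forall V, open V -> V `<=` [set p : C2 R | sqn p.2 < 1] -> forall a : R,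
      {ae leb4, forall p : M4 R, V p -> (g p <= a%:E)%E} ->
      forall p, V p -> (g p <= a%:E)%E) ->
    forall p, sqn p.1 < q -> sqn p.2 < q -> (u p <= 0)%E.
Proof.
move=> cg ig cv vG.
have [A A0 hA] : exists2 A, 0 <= A & forall t, t \in `[0, 1] -> sqn (gamma t) <= A.
  have cs : continuous (fun t => sqn (gamma t)).
    by move=> t; apply: continuous_comp; [exact: cg|exact: sqn_continuous].
  have [c cI hc] := EVT_max ler01 (continuous_subspaceT cs).
  by exists (sqn (gamma c)); [exact: sqn_ge0|exact: hc].
have [r /andP[r0 r1] nodes] := arc_nodes cg ig.
have A1 : 0 < 4 * (1 + A) by rewrite mulr_gt0// ltr_wpDr.
(* Makes the base [2 * (1 + A) * q] of [hprod_small] equal to [r / 2], so that division by [r ^+ n]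
   leaves [2 ^- n]. *)
pose q := r / (4 * (1 + A)).
have q0 : 0 < q by rewrite divr_gt0.
have qE : 2 * (1 + A) * q = r / 2 by rewrite /q; field; rewrite gt_eqF// ltr_wpDr.
have q1 : q < 1 by rewrite ltr_pdivrMr// mul1r; apply: le_lt_trans r1 _; lra.
exists q => [|f g u cf su uf ub li pos ess p0 p01 p02]; first by rewrite q0 q1.
(* [a0] is the threshold of [hprod_large]; the gap up to [a2] is a layer on which the barrier
   already dominates. *)
pose a0 := 2 * (A + 1); pose a2 := a0 + 1.
have [C C0 hC] := usc4_bounded (@bidisc_compact R a2 1) (su a2)
  (fun p Dp => uf p (proj2 Dp)).
(* One [eta] bounds the barrier near the origin and three are lost in [barrier_ae]. *)
suff main eta : 0 < eta -> (u p0 <= (4 * eta)%:E)%E.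
  apply/lee_addgt0Pr => e e0; rewrite add0e.
  by have := main (e / 4); rewrite mulrCA divff ?pnatr_eq0// mulr1; apply; rewrite divr_gt0.
move=> eta0; pose G := [set gamma t | t in `[0, 1]%classic].
have cG : compact G.
  by apply: continuous_compact; [exact: continuous_subspaceT|exact: segment_compact].
have [d d0 hd] := compact_unif_continuous cG (fun x _ => cv x) eta0.
pose nu := Num.min 1 (d ^+ 2).
have nu0 : 0 < nu by rewrite lt_min ltr01 exprn_gt0.
have nu1 : nu <= 1 by rewrite ge_min lexx.
(* The degree is chosen last: [C] bounds the subsolution, and within squared distance [nu] of the
   arc [v] stays below [eta]. *)
have [n hn] := exp2_dominates (C / nu) eta0.
have [s [ss sG sP]] := nodes nu n (introT andP (conj nu0 nu1)).
have sA a : a \in s -> sqn a <= A by move=> /sG[t tI <-]; exact: hA.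
have rn : 0 < r ^+ n by rewrite exprn_gt0.
(* Turns the lower bound [nu * r ^+ n] of the product into [C]; moreover [K >= C], which serves
   where [|w|] is large. *)
pose K := C / nu / r ^+ n.
have K0 : 0 <= K by rewrite !divr_ge0 ?(ltW nu0) ?(ltW rn).
have KC : C <= K.
  rewrite /K ler_pdivlMr// ler_pdivlMr//.
  rewrite -mulrA ler_piMr// mulr_ile1 ?(ltW nu0) ?(ltW rn)//.
  by rewrite exprn_ile1// ltW.
pose B p := K * nsq (hprod s p).
have cB : continuous B.
  by move=> p; apply: cvgM; [exact: cvg_cst|exact: nsq_hprod_continuous].
have B0 p : 0 <= B p by rewrite mulr_ge0// nsq_ge0.
have lB : levi_degenerate B := @nsq_hprod_degenerate R s K K0.
have Bq p : sqn p.1 <= q -> sqn p.2 <= q -> B p <= eta.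
  move=> h1 h2; have := hprod_small A0 sA h1 h2; rewrite qE ss => h.
  apply: le_trans hn; apply: le_trans (ler_wpM2l K0 h) _.
  by rewrite /K expr_div_n mulrA divfK ?gt_eqF.
have ub1 p : bidisc a2 1 p -> sqn p.2 = 1 -> (u p <= (B p + eta)%:E)%E.
  move=> Dp p2; have [z zE] := cx_circle p2.
  (* Near the arc the boundary value [v] is at most [eta]; away from it the barrier exceeds the
     global bound [C]. *)
  have [[t [tI tz]]|far] := pselect (exists t, t \in `[0, 1] /\ sqn (z - gamma t) < nu).
    apply: le_trans (ub p z p2 zE) _; rewrite lee_fin.
    have : `|z - gamma t| < d.
      by apply: norm_lt_sqn => //; apply: lt_le_trans tz _; rewrite ge_min lexx orbT.
    rewrite distrC => /(hd (gamma t) z (ex_intro2 _ _ t tI erefl)).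
    rewrite (vG t tI) sub0r normrN => vz.
    by apply: le_trans (ler_norm _) (le_trans (ltW vz) _); rewrite lerDr.
  apply: le_trans (hC p Dp) _; rewrite lee_fin.
  apply: (@le_trans _ _ (B p)); last by rewrite lerDl ltW.
  rewrite /B (hprod_circle s p2 zE).
  have {}hz : nu * r ^+ n <= \prod_(a <- s) sqn (z - a).
    by apply: sP => t tI; rewrite leNgt; apply/negP => h; apply: far; exists t.
  apply: le_trans (ler_wpM2l K0 hz).
  by rewrite /K [nu * _]mulrC mulrA divfK ?gt_eqF// divfK ?gt_eqF.
have [b /andP[b0 b1] hb] := usc4_layer (su a2) cB eta0 ub1.
(* Raised to at least [q] so that the points near [p0] lie in [bidisc a0 b']. *)
pose b' := Num.max b q.
have b'1 : b' < 1 by rewrite gt_max b1.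
have a02 : a0 < a2 by rewrite /a2 ltrDl.
have bd p : bidisc a2 1 p -> a0 <= sqn p.1 \/ b' <= sqn p.2 -> (u p <= (B p + 2 * eta)%:E)%E.
  move=> Dp [h|h]; last by apply: hb => //; apply: le_trans h; rewrite le_max lexx.
  apply: le_trans (hC p Dp) _; rewrite lee_fin.
  apply: (@le_trans _ _ (B p)); last by rewrite lerDl mulr_ge0// ltW.
  apply: le_trans KC _; rewrite /B ler_peMr//.
  by apply: hprod_large sA h _; case: Dp.
have /nbhs_ballP[e /= e0 eP] : nbhs p0 [set y : C2 R | sqn y.1 < q /\ sqn y.2 < q].
  exact: filterI (nbhs_sublevel (@sqn1_continuous R) p01) (nbhs_sublevel (@sqn2_continuous R) p02).
have eP' p : `|p - p0| < e -> sqn p.1 < q /\ sqn p.2 < q.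
  by move=> h; apply: eP; rewrite -ball_normE/= distrC.
have qa0 : q <= a0 by rewrite /a0; move: q1 A0; clear; lra.
have hae := @barrier_ae R u B a0 a2 b' eta (4 * eta) e p0 a02 b'1 li pos cB lB B0 eta0 bd.
apply: (@ess_sup_le R f g [set p : C2 R | sqn p.2 < 1] (4 * eta) e p0 cf e0 _ ess).
  by move=> p /eP'[_ h]; exact: lt_trans h q1.
apply: hae => p /eP'[/ltW h1 /ltW h2]; split.
  by split; [exact: le_trans h1 qa0|apply: le_trans h2 _; rewrite le_max lexx orbT].
by have := Bq p h1 h2; clear; lra.
Qed.

End arc_upper_bound.

(** * Charts of the projective line *)

Section charts.
Variable R : realType.
Implicit Types (p q : C1 R) (z w : Cplx R) (e : R).

Lemma cplx_normE z : `|z| = (normc z)%:C%C :> R[i].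
Proof. by case: z => a b; rewrite normc_def. Qed.

Lemma normc_cplx p : normc (cplx p) = Num.sqrt (sqn p). Proof. by []. Qed.

Lemma normc_cplx_sqr p : normc (cplx p) ^+ 2 = sqn p.
Proof. by rewrite normc_cplx sqr_sqrtr// sqn_ge0. Qed.

Lemma normc_lt z e : (`|z| < e%:C%C :> Cplx R) = (normc z < e).
Proof. by rewrite (cplx_normE z : `|z| = _ :> Cplx R) -ltcR. Qed.

Lemma cplx_gt0P (e : Cplx R) : 0 < e -> exists2 r, 0 < r & e = (r%:C)%C.
Proof.
case: e => a b; rewrite (ltcE 0 _)/= => /andP[/eqP-> a0]; by exists a.
Qed.

Definition uncplx z : C1 R := (complex.Re z, complex.Im z).
Lemma uncplxK z : cplx (uncplx z) = z. Proof. by case: z. Qed.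

Lemma cplxB p q : cplx p - cplx q = cplx (p - q).
Proof. by case: p q => [a b] [c d]; rewrite /cplx/=; simpc. Qed.

Lemma cplx_continuous : continuous (@cplx R).
Proof.
move=> p; apply/cvgrPdist_lt => _ /cplx_gt0P[e e0 ->].
have e2 : 0 < e ^+ 2 by rewrite exprn_gt0.
have : \forall q \near p, sqn (p - q) < e ^+ 2.
  have c : (fun q : C1 R => p - q) @ p --> p - p.
    by apply: cvgB; [exact: cvg_cst|exact: cvg_id].
  have n : nbhs (p - p) [set z | sqn z < e ^+ 2].
    by apply: (nbhs_sublevel (@sqn_continuous R)); rewrite subrr /sqn/= expr0n addr0.
  exact: (c _ n).
apply: filterS => q h; rewrite cplxB normc_lt normc_cplx.
by rewrite -[e]ger0_norm ?(ltW e0)// -sqrtr_sqr ltr_sqrt.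
Qed.

Lemma normc_continuous : continuous (fun z : Cplx R => normc z).
Proof.
move=> z; have F : Filter (nbhs z) := nbhs_filter z.
apply/(cvgrPdist_lt) => e e0.
have e0' : 0 < (e%:C)%C :> Cplx R by rewrite (ltcR 0 e).
have : \forall w \near z, `|z - w| < (e%:C)%C :> Cplx R.
  by have := nbhsx_ballx z _ e0'; rewrite -ball_normE.
apply: filterS => w; rewrite normc_lt => zw; apply: le_lt_trans zw.
have h (x y : Cplx R) : normc x - normc y <= normc (x - y).
  by rewrite lerBlDr -{1}(subrK y x); exact: le_normcD.
by rewrite ler_norml h lerNl opprB; have := h w z; rewrite -(normcN (z - w)) opprB => ->.
Qed.

Lemma cdisc_compact e : compact [set z : Cplx R | normc z <= e].
Proof.
pose K : set (C1 R) := [set p | normc (cplx p) <= e].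
have -> : [set z : Cplx R | normc z <= e] = @cplx R @` K.
  apply/seteqP; split => [z h|_ [p h <-] //].
  by exists (uncplx z); rewrite /K /mkset uncplxK.
apply: continuous_compact; first exact: continuous_subspaceT (@cplx_continuous).
have sK : K `<=` `[- e, e]%classic `*` `[- e, e]%classic.
  move=> [x y]; rewrite /K/= => h.
  have k (a b : R) : Num.sqrt (a ^+ 2 + b ^+ 2) <= e -> a \in `[- e, e].
    move=> h'; rewrite in_itv/= -ler_norml; apply: le_trans h'.
    by rewrite -sqrtr_sqr ler_wsqrtr// lerDl sqr_ge0.
  by split; [exact: (k x y)|apply: (k y x); rewrite addrC].
apply: subclosed_compact sK; last by apply: compact_setX; exact: segment_compact.
apply: closed_sublevel => p.
exact: (@continuous_comp _ _ _ (@cplx R) (fun z : Cplx R => normc z) p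
  (@cplx_continuous p) (@normc_continuous _)).
Qed.

Lemma normc_gt0 z : (0 < normc z) = (z != 0).
Proof. by rewrite -ltcR -cplx_normE normr_gt0. Qed.

Lemma cplx_neq0 p : 0 < sqn p -> cplx p != 0.
Proof. by rewrite -normc_cplx_sqr; apply: contraTN => /eqP ->; rewrite normc0 expr0n ltxx. Qed.

Lemma compact_cplx_bounded (K : set (Cplx R)) : compact K ->
  exists2 M, 0 < M & forall z, K z -> normc z < M.
Proof.
move=> cK.
have := (@compact_near_coveringP _ K).1 cK R (+oo%R) (fun c z => normc z < c).
case=> [z Kz|M [Mr MP]].
  exists ([set w | normc w < normc z + 1], [set c | normc z + 1 <= c]) => /=.
    split; last by apply: nbhs_pinfty_ge; exact: num_real.
    by apply: (nbhs_sublevel normc_continuous); rewrite /= ltrDl.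
  by move=> [w c] [/= h1 h2]; exact: lt_le_trans h1 h2.
have M1 : M < Num.max 0 M + 1 by rewrite ltr_pwDr// le_max lexx orbT.
exists (Num.max 0 M + 1) => [|z Kz]; first by rewrite ltr_wpDl// le_max lexx.
exact: (MP _ M1 z Kz).
Qed.

Lemma nbhs_infty e : nbhs (None : P1 R) [set x | forall z, x = Some z -> e < normc z].
Proof.
exists [set z : Cplx R | normc z <= e].
  split; first exact: cdisc_compact.
  exact: (@closed_sublevel R (Cplx R) (fun z => normc z) e normc_continuous).
move=> _ [[z /= nz <-] _ [<-]|->//].
by rewrite ltNge; exact/negP.
Qed.

Lemma chart_w_continuous : continuous (@chart_w R).
Proof.
move=> w; have [->|w0] := eqVneq w 0.
  rewrite /continuous_at {2}/chart_w eqxx => A [K [cK clK] KA].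
  have [M M0 KM] := compact_cplx_bounded cK.
  have : nbhs (0 : Cplx R) [set z | normc z < M^-1].
    by apply: (nbhs_sublevel normc_continuous); rewrite normc0 invr_gt0.
  apply: filterS => z zM; apply: KA; rewrite /chart_w.
  have [_|z0] := eqVneq z 0; [by right|left; exists z^-1 => // /KM].
  rewrite normcV => zM'.
  have nz : 0 < normc z by rewrite normc_gt0.
  by move: zM' zM; rewrite invf_plt ?posrE// => h1 /(lt_trans h1); rewrite ltxx.
have F : Filter (nbhs w) := nbhs_filter w.
have n0 : \forall z \near w, z != 0.
  have cN : continuous (fun z : Cplx R => - normc z).
    by move=> z; exact: continuousN (@normc_continuous z).
  have : nbhs w [set z | - normc z < 0].
    by apply: (nbhs_sublevel cN); rewrite oppr_lt0 normc_gt0.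
  by apply: filterS => z; rewrite /= oppr_lt0 normc_gt0.
have : Some z^-1 @[z --> w] --> (Some w^-1 : P1 R).
  by move=> U nU; exact: (inv_continuous w0 nU).
rewrite /continuous_at {2}/chart_w (negbTE w0); apply: cvg_trans.
apply: near_eq_cvg; apply: filterS n0 => z z0.
by rewrite /chart_w (negbTE z0).
Qed.

Lemma chart_continuous (c : Cplx R -> P1 R) : atlas c -> continuous c.
Proof.
by move=> [->|->]; [exact: one_point_compactification_some_continuous|exact: chart_w_continuous].
Qed.

Lemma prod_chart_continuous (c : Cplx R -> P1 R) : atlas c -> continuous (prod_chart c).
Proof.
move=> /chart_continuous cc p.
have h1 : {for p, continuous (fun p : C2 R => c (cplx p.1))}.
  apply: (@continuous_comp _ _ _ (fun p : C2 R => cplx p.1) c); last exact: cc.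
  apply: (@continuous_comp _ _ _ fst (@cplx R)); [exact: cvg_fst|exact: cplx_continuous].
have h2 : {for p, continuous (fun p : C2 R => cplx p.2)}.
  apply: (@continuous_comp _ _ _ snd (@cplx R)); [exact: cvg_snd|exact: cplx_continuous].
move=> A [[A1 A2] [/= n1 n2] sA].
have F := nbhs_filter p.
have m1 : nbhs p [set q : C2 R | A1 (c (cplx q.1))] := h1 _ n1.
have m2 : nbhs p [set q : C2 R | A2 (cplx q.2)] := h2 _ n2.
by apply: filterS2 m1 m2 => q q1 q2; apply: sA.
Qed.

Lemma disc_cplx p : disc (cplx p) <-> sqn p < 1.
Proof.
have -> : disc (cplx p) = (normc (cplx p) < 1) :> Prop by rewrite -normc_lt.
by rewrite -(normc_cplx_sqr p) expr_lt1 ?sqrtr_ge0.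
Qed.

Lemma closed_disc_cplx p : closed_disc (cplx p) <-> sqn p <= 1.
Proof.
have -> : closed_disc (cplx p) = (normc (cplx p) <= 1) :> Prop.
  by rewrite /closed_disc/= (cplx_normE (cplx p) : `|cplx p| = _ :> Cplx R) -lecR.
by rewrite -(normc_cplx_sqr p) expr_le1 ?sqrtr_ge0.
Qed.

Lemma circle_cplx p : sqn p = 1 -> circle (cplx p).
Proof.
move=> h; rewrite /circle/= (cplx_normE (cplx p) : `|cplx p| = _ :> Cplx R).
by rewrite normc_cplx h sqrtr1.
Qed.

Lemma cylinder_preimage (c : Cplx R -> P1 R) :
  prod_chart c @^-1` (setT `*` disc) = [set p : C2 R | sqn p.2 < 1].
Proof.
apply/seteqP; split => p /=; first by case=> _ /disc_cplx.
by move=> h; split => //; exact/disc_cplx.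
Qed.

Lemma fs_potentialE p : fs_potential (cplx p) = ln (1 + sqn p).
Proof. by rewrite /fs_potential normc_cplx_sqr. Qed.

Lemma fs_continuous : continuous (fun p : C1 R => fs_potential (cplx p)).
Proof.
have -> : (fun p : C1 R => fs_potential (cplx p)) = (fun p => ln (1 + sqn p)).
  by apply/funext => p; rewrite fs_potentialE.
move=> p; apply: (@continuous_comp _ _ _ (fun p : C1 R => 1 + sqn p) (@ln R)).
  by apply: cvgD; [exact: cvg_cst|exact: sqn_continuous].
by apply: continuous_ln; rewrite ltr_wpDr ?sqn_ge0.
Qed.

Lemma fs1_continuous : continuous (fun p : C2 R => fs_potential (cplx p.1)).
Proof.
move=> p; apply: (@continuous_comp _ _ _ fst (fun p : C1 R => fs_potential (cplx p))).
  exact: cvg_fst.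
exact: fs_continuous.
Qed.

(** In the coordinate w multiplication by tau becomes division by tau, so [z] stands for
    [w / tau]. *)
Lemma rotate_chart_w (p : C2 R) (z : C1 R) : sqn p.2 = 1 -> cx z * cx p.2 = cx p.1 ->
  rotate (cplx p.2) (chart_w (cplx p.1)) = chart_w (cplx z).
Proof.
move=> p2 zE; have zE' : cplx z * cplx p.2 = cplx p.1 := zE.
have t0 : cplx p.2 != 0 by apply: cplx_neq0; rewrite p2.
rewrite -zE' /chart_w mulf_eq0 (negbTE t0) orbF; case: eqP => [//|_ /=].
by rewrite invfM mulrA mulrC mulrA mulVf// mul1r.
Qed.

End charts.

Section envelope_upper_bound.
Variable R : realType.
Implicit Types (phi : P1 R -> R) (psi : P1 R * Cplx R -> \bar R).

Lemma usc4_potential (c : Cplx R -> P1 R) psi (a : R) : atlas c ->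
  (forall p, (setT `*` closed_disc) p -> psi p != +oo%E) ->
  upper_semicontinuous_on (setT `*` closed_disc) psi ->
  usc4 (bidisc a 1) (prod_potential c psi).
Proof.
move=> ac fin usc p b [_ p2]; rewrite /prod_potential.
have Sp : (setT `*` closed_disc) (prod_chart c p) by split => //; exact/closed_disc_cplx.
move=> ub.
(* A real [d] above [psi] splits the strict inequality into one for the semicontinuous [psi] and one
   for the continuous potential; the value -oo of [psi] is allowed. *)
have [d pd db] : exists2 d : R, (psi (prod_chart c p) < d%:E)%E & fs_potential (cplx p.1) + d < b.
  move: ub (fin _ Sp); case: (psi _) => [r| |] //.
    rewrite -EFinD lte_fin => h _; exists (r + (b - fs_potential (cplx p.1) - r) / 2).
      by rewrite lte_fin; lra.
    by lra.
  by move=> _ _; exists (b - fs_potential (cplx p.1) - 1); [exact: ltNyr|lra].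
have ld : ((- d)%:E < - psi (prod_chart c p))%E by rewrite EFinN lteN2.
have [V] := usc (prod_chart c p) (- d) ld.
have e0 : 0 < b - d - fs_potential (cplx p.1) by lra.
move=> /(nbhs_subspace_ex _ Sp)[W nW VW] VP.
have n1 : nbhs p (prod_chart c @^-1` W) by exact: (prod_chart_continuous ac nW).
have n2 : nbhs p [set q : C2 R | fs_potential (cplx q.1) < b - d].
  by apply: (nbhs_sublevel (@fs1_continuous R)); lra.
apply: filterS2 n1 n2 => q h1 h2 [_ q2].
have Sq : (setT `*` closed_disc) (prod_chart c q) by split => //; exact/closed_disc_cplx.
have [Vq _] : (V `&` (setT `*` closed_disc)) (prod_chart c q) by rewrite VW.
have := VP _ Vq.
rewrite EFinN lteN2 => h; move: h2 => /= h2.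
case: (psi _) h => [r| |] // h; last by rewrite ltNyr.
by move: h; rewrite -EFinD !lte_fin; lra.
Qed.

Lemma subsolution_le0 phi : smooth_P1 phi ->
  (forall w : Cplx R, - fs_potential w <= phi (chart_w w)) ->
  is_arc [set w : Cplx R | phi (chart_w w) = - fs_potential w] ->
  exists2 q, 0 < q < 1 & forall psi, subsolution phi psi ->
    forall p : C2 R, sqn p.1 < q -> sqn p.2 < q -> (prod_potential (@chart_w R) psi p <= 0)%E.
Proof.
move=> sphi phi_ge [gamma [sg ig gE]].
pose v (z : C1 R) := fs_potential (cplx z) + phi (chart_w (cplx z)).
have cv : continuous v.
  move=> z; apply: cvgD; first exact: fs_continuous.
  by apply: (smooth_continuous (sphi (@chart_w R) _)); right.
have vG t : t \in `[0, 1] -> v (gamma t) = 0.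
  move=> tI; have : [set w : Cplx R | phi (chart_w w) = - fs_potential w] (cplx (gamma t)).
    by rewrite gE; exists t.
  by rewrite /v/= => ->; rewrite subrr.
have [q q01 hq] := arc_upper_bound (smooth_continuous sg) ig cv vG.
exists q => // psi [fin usc pos ess bd].
have aw : atlas (@chart_w R) by right.
have [li cu] := pos _ aw; rewrite cylinder_preimage in li cu.
apply: (hq (fun p => fs_potential (cplx p.1)) (fun p => psi (prod_chart (@chart_w R) p))).
- exact: fs1_continuous.
- by move=> a; exact: usc4_potential.
- move=> p p2; have := fin (prod_chart (@chart_w R) p) _.
  move=> /(_ _)/wrap[]; first by split => //; exact/closed_disc_cplx.
  by case: (psi _) => [r| |] //= _; rewrite ?ltry ?ltNyr.
- move=> p z p2 zE; have := bd (chart_w (cplx p.1)) _ (circle_cplx p2).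
  rewrite (rotate_chart_w p2 zE) /v EFinD.
  have -> : fs_potential (cplx z) = fs_potential (cplx p.1).
    by rewrite !fs_potentialE -(nsq_cx p.1) -zE nsqM !nsq_cx p2 mulr1.
  by move=> h; apply: leeD2l.
- exact: li.
- exact: cu.
- by move=> V oV VO; apply: ess => //; rewrite cylinder_preimage.
Qed.

End envelope_upper_bound.

(** * Integration by parts and radial subsolutions *)

Section log_potential.
Variables (R : realType) (a c : R).
Hypothesis a0 : 0 < a.
Implicit Types (p v w : C2 R) (F h : C2 R -> R).

Definition logden p : R := sqn p.1 + a.
Definition lognum v p : R := 2 * (v.1.1 * p.1.1 + v.1.2 * p.1.2).
(** Up to a constant, the Fubini-Study potential in a rescaled coordinate; adding [fs_potential] to
    a [radial] function gives this shape in both charts. *)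
Definition logf p : R := ln (logden p) + c.

Lemma logden_gt0 p : 0 < logden p. Proof. by rewrite ltr_wpDl ?sqn_ge0. Qed.

Lemma logden_derive p v : differentiable logden p /\ is_derive p v logden (lognum v p).
Proof.
have [d0 D0] := coord_derive (@Ordinal 4 0 isT) p v.
have [d1 D1] := coord_derive (@Ordinal 4 1 isT) p v.
have E : logden = (coord4 (@Ordinal 4 0 isT) * coord4 (@Ordinal 4 0 isT) +
    coord4 (@Ordinal 4 1 isT) * coord4 (@Ordinal 4 1 isT)) + cst a by [].
have E2 : lognum v p = (p.1.1 *: v.1.1 + p.1.1 *: v.1.1 + (p.1.2 *: v.1.2 + p.1.2 *: v.1.2)) + 0.
  by rewrite /lognum /GRing.scale/=; ring.
rewrite E E2; split.
  exact: (differentiableD (differentiableD (differentiableM d0 d0) (differentiableM d1 d1)) (differentiable_cst _ _)).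
exact: (is_deriveD (is_deriveD (is_deriveM D0 D0) (is_deriveM D1 D1)) (is_derive_cst _ _ _)).
Qed.

Lemma lognum_derive p v w : differentiable (lognum v) p /\
  is_derive p w (lognum v) (2 * (v.1.1 * w.1.1 + v.1.2 * w.1.2)).
Proof.
have [d0 D0] := coord_derive (@Ordinal 4 0 isT) p w.
have [d1 D1] := coord_derive (@Ordinal 4 1 isT) p w.
have E : lognum v = (2 * v.1.1) *: coord4 (@Ordinal 4 0 isT) + (2 * v.1.2) *: coord4 (@Ordinal 4 1 isT).
  by apply/funext => q; rewrite /lognum /coord4 !fctE /GRing.scale/=; ring.
have E2 : 2 * (v.1.1 * w.1.1 + v.1.2 * w.1.2) = (2 * v.1.1) *: w.1.1 + (2 * v.1.2) *: w.1.2.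
  by rewrite /GRing.scale/=; ring.
rewrite E E2; split.
  exact: (differentiableD (differentiableZ _ d0) (differentiableZ _ d1)).
have e0 := is_deriveZ (2 * v.1.1) D0.
have e1 := is_deriveZ (2 * v.1.2) D1.
exact: (is_deriveD e0 e1).
Qed.

Lemma logf_derive p v : differentiable logf p /\ is_derive p v logf (lognum v p * (logden p)^-1).
Proof.
have [d D] := logden_derive p v.
have [dl Dl] := derive_comp d D (is_derive1_ln (logden_gt0 p)).
have -> : logf = (fun p => ln (logden p)) + cst c by [].
split; first exact: (differentiableD dl (differentiable_cst _ _)).
have := is_deriveD Dl (is_derive_cst c p v).
by rewrite addr0.
Qed.

Definition loghess v w p : R :=
  2 * (v.1.1 * w.1.1 + v.1.2 * w.1.2) * (logden p)^-1 - lognum v p * lognum w p * (logden p)^-1 ^+ 2.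

Lemma logf_deriveE v : 'D_v logf = fun p => lognum v p * (logden p)^-1.
Proof. by apply/funext => p; have [_ [_ ->]] := logf_derive p v. Qed.

Lemma logden_inv_derive p w : differentiable (fun p => (logden p)^-1) p /\
  is_derive p w (fun p => (logden p)^-1) (lognum w p * (- (logden p)^-1 ^+ 2)).
Proof.
have [d D] := logden_derive p w.
have n0 : logden p != 0 by rewrite gt_eqF// logden_gt0.
apply: (derive_comp d D); have := @is_deriveV R id (logden p) 1 1 n0 (is_derive_id _ _).
by rewrite [_ *: 1]mulr1 exprVn.
Qed.

Lemma logf_derive2 p v w : differentiable ('D_v logf) p /\
  is_derive p w ('D_v logf) (loghess v w p).
Proof.
have [d1 D1] := lognum_derive p v w.
have [d2 D2] := logden_inv_derive p w.
rewrite logf_deriveE; split; first exact: (differentiableM d1 d2).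
have := is_deriveM D1 D2; congr (is_derive _ _ _ _).
by rewrite /loghess /GRing.scale/=; ring.
Qed.

Lemma logf_derive2E v w : 'D_w ('D_v logf) = loghess v w.
Proof. by apply/funext => p; have [_ [_ ->]] := logf_derive2 p v w. Qed.

Lemma loghess_continuous v w : continuous (loghess v w).
Proof.
move=> p; have cn u : {for p, continuous (lognum u)}.
  by apply: differentiable_continuous; have [] := lognum_derive p u 0.
have cd : {for p, continuous (fun p => (logden p)^-1)}.
  by apply: differentiable_continuous; have [] := logden_inv_derive p 0.
apply: cvgB.
  by apply: cvgM; [exact: cvg_cst|exact: cd].
by apply: cvgM; [apply: cvgM; exact: cn|apply: cvgM; exact: cd].
Qed.

End log_potential.

Section parts.
Variable R : realType.
Implicit Types (p v w : C2 R) (F h : C2 R -> R).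

Lemma I4_by_parts F h v : (forall p, differentiable F p) -> continuous ('D_v F) ->
  (forall p, differentiable h p) -> continuous ('D_v h) -> csupp h ->
  I4 (fun p => F p * 'D_v h p) = - I4 (fun p => 'D_v F p * h p).
Proof.
move=> dF cF dh ch sh.
have chh : continuous h by move=> p; exact: differentiable_continuous.
have cFF : continuous F by move=> p; exact: differentiable_continuous.
have E : 'D_v (F * h) = fun p => F p * 'D_v h p + 'D_v F p * h p.
  apply/funext => p; rewrite deriveM; [|exact: diff_derivable|exact: diff_derivable].
  by rewrite /GRing.scale/= [h p * _]mulrC.
have [K cK zh] := sh; have clK := compact_closed_normed cK.
have i1 : int4 (fun p => F p * 'D_v h p).
  by apply: int4_mulcc => //; exists K => //; exact: (supp_derive v clK zh).
have i2 : int4 (fun p => 'D_v F p * h p) by exact: int4_mulcc.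
have [] := @I4_derive0 R (F * h) v.
- by move=> p; exact: differentiableM.
- rewrite E => p; apply: cvgD; (apply: cvgM; [|]).
  + exact: cFF. + exact: ch. + exact: cF. + exact: chh.
- by exists K => // p nK; rewrite /= fctE (zh p nK) mulr0.
move=> _; rewrite E (I4D i1 i2) => /eqP; rewrite addr_eq0 => /eqP; exact.
Qed.

Lemma I4_by_parts2 F h v w : (forall p, differentiable F p) ->
  (forall p, differentiable ('D_v F) p) -> continuous ('D_w ('D_v F)) ->
  smooth h -> csupp h ->
  I4 (fun p => F p * iter_derive [:: v; w] h p) = I4 (fun p => 'D_w ('D_v F) p * h p).
Proof.
move=> dF dF2 cH sm [K cK zh].
have clK := compact_closed_normed cK.
have sw := smooth_derive w sm.
rewrite /= (I4_by_parts dF _ _ _ _).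
- rewrite (I4_by_parts dF2 _ _ _ _) ?opprK//.
  + by move=> p; exact: smooth_differentiable.
  + exact: smooth_continuous sw.
  + by exists K.
- by move=> p; apply: differentiable_continuous.
- by move=> p; exact: smooth_differentiable.
- exact: smooth_continuous (smooth_derive v sw).
- by exists K => // p nK; exact: (supp_derive w clK zh nK).
Qed.

End parts.

Section log_current.
Variables (R : realType) (a c : R).
Hypothesis a0 : 0 < a.
Implicit Types (p v w : C2 R) (eta : @form11 R).

Lemma logf_continuous : continuous (@logf R a c).
Proof. by move=> p; apply: differentiable_continuous; have [] := logf_derive c a0 p 0. Qed.

Lemma logf_parts (h : C2 R -> R) v w (O : set (C2 R)) : test_function O h ->
  int4 (fun p => logf a c p * iter_derive [:: v; w] h p) /\
  I4 (fun p => logf a c p * iter_derive [:: v; w] h p) = I4 (fun p => loghess a v w p * h p).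
Proof.
move=> [sh [K [cK _ zh]]]; have clK := compact_closed_normed cK.
split.
  apply: int4_mulcc; first exact: logf_continuous.
    exact: (smooth_continuous (smooth_derive v (smooth_derive w sh))).
  by exists K => // p; exact: supp_iter_derive.
rewrite -(logf_derive2E c a0); apply: I4_by_parts2 => //.
- by move=> p; have [] := logf_derive c a0 p 0.
- by move=> p; have [] := logf_derive2 c a0 p v 0.
- by rewrite (logf_derive2E c a0); exact: loghess_continuous.
- by exists K.
Qed.

Lemma logf_parts0 (h : C2 R -> R) v w (O : set (C2 R)) : test_function O h ->
  v.1 = 0 \/ w.1 = 0 ->
  int4 (fun p => logf a c p * iter_derive [:: v; w] h p) /\
  I4 (fun p => logf a c p * iter_derive [:: v; w] h p) = 0.
Proof.
move=> th vw; have [ii ->] := logf_parts v w th; split => //.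
rewrite -(I4_0 R); apply: eq_I4 => p; rewrite /loghess /lognum.
by case: vw => ->; rewrite /= !(mul0r, mulr0, addr0, subr0).
Qed.

(** The Laplacian of [ln (|w|^2 + a)] in the first variable. *)
Definition fubini_study_density p : R := 4 * a / (sqn p.1 + a) ^+ 2.

Lemma fubini_study_density_ge0 p : 0 <= fubini_study_density p.
Proof. by apply: divr_ge0; [exact: mulr_ge0 (ler0n _ 4) (ltW a0)|exact: sqr_ge0]. Qed.

Lemma fubini_study_density_continuous : continuous fubini_study_density.
Proof.
move=> p; apply: cvgM; first exact: cvg_cst.
apply: cvgV; first by rewrite expf_neq0// gt_eqF// (logden_gt0 a0).
have h : {for p, continuous (fun p : C2 R => sqn p.1 + a)}.
  by apply: cvgD; [exact: sqn1_continuous|exact: cvg_cst].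
exact: (continuousM h h).
Qed.

Let sumform (k a1 a2 a3 a4 b1 b2 b3 b4 f : R) :
  f * (k * (a1 + a2 + a3 + a4 - 2 * (b1 + b2 + b3 - b4))) =
  k * (f * a1 + f * a2 + (f * a3 + f * a4) - 2 * (f * b1 + f * b2 + (f * b3 - f * b4))).
Proof. ring. Qed.

Let I4_combination (k : R) (f1 f2 f3 f4 g1 g2 g3 g4 : C2 R -> R) :
  int4 f1 -> int4 f2 -> int4 f3 -> int4 f4 -> int4 g1 -> int4 g2 -> int4 g3 -> int4 g4 ->
  I4 f3 = 0 -> I4 f4 = 0 -> I4 g1 = 0 -> I4 g2 = 0 -> I4 g3 = 0 -> I4 g4 = 0 ->
  I4 (fun p => k * (f1 p + f2 p + (f3 p + f4 p) - 2 * (g1 p + g2 p + (g3 p - g4 p)))) =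
  k * (I4 f1 + I4 f2).
Proof.
move=> i1 i2 i3 i4 i5 i6 i7 i8 E3 E4 E5 E6 E7 E8.
have i12 := int4D i1 i2; have i34 := int4D i3 i4.
have i56 := int4D i5 i6; have i78 := int4B i7 i8.
have ia := int4D i12 i34; have ib := int4D i56 i78.
have j1 := int4Z 2 ib; have j2 := int4B ia j1.
rewrite (I4Z _ j2) (I4B ia j1) (I4Z 2 ib) (I4D i12 i34) (I4D i56 i78) (I4D i1 i2).
rewrite (I4D i3 i4) (I4D i5 i6) (I4B i7 i8) E3 E4 E5 E6 E7 E8.
by rewrite !(addr0, subr0, mulr0).
Qed.

Let sum_hess (x y s h : R) : s = x ^+ 2 + y ^+ 2 + a -> s != 0 ->
  (2 * (1 * 1 + 0 * 0) * s^-1 - 2 * (1 * x + 0 * y) * (2 * (1 * x + 0 * y)) * s^-1 ^+ 2) * h +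
  (2 * (0 * 0 + 1 * 1) * s^-1 - 2 * (0 * x + 1 * y) * (2 * (0 * x + 1 * y)) * s^-1 ^+ 2) * h =
  4 * a / s ^+ 2 * h.
Proof.
move=> sE s0; have {sE}-> : a = s - x ^+ 2 - y ^+ 2 by rewrite sE; ring.
by field.
Qed.

(** As [logf] is constant in the second variable, only the two pure second derivatives in the first
    variable survive, and their sum is the density. This one formula serves for the positivity of
    radial functions, for the limit [ln |z|^2] and for the failure of maximal rank. *)
Lemma I4_logf_ddc eta (O : set (C2 R)) : test_form O eta ->
  I4 (fun p => logf a c p * ddc_form eta p) =
  (2 * pi)^-1 * I4 (fun p => fubini_study_density p * h22 eta p).
Proof.
move=> [t1 t2 t3 t4].
pose ex : C2 R := ((1, 0), (0, 0)); pose ey : C2 R := ((0, 1), (0, 0)).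
pose es : C2 R := ((0, 0), (1, 0)); pose et : C2 R := ((0, 0), (0, 1)).
have [i1 E1] := logf_parts ex ex t2; have [i2 E2] := logf_parts ey ey t2.
have z1 : es.1 = 0 by []. have z2 : et.1 = 0 by [].
have [i3 E3] := logf_parts0 t1 (or_introl z1 : es.1 = 0 \/ es.1 = 0).
have [i4 E4] := logf_parts0 t1 (or_introl z2 : et.1 = 0 \/ et.1 = 0).
have [i5 E5] := logf_parts0 t3 (or_intror z1 : ex.1 = 0 \/ es.1 = 0).
have [i6 E6] := logf_parts0 t3 (or_intror z2 : ey.1 = 0 \/ et.1 = 0).
have [i7 E7] := logf_parts0 t4 (or_intror z2 : ex.1 = 0 \/ et.1 = 0).
have [i8 E8] := logf_parts0 t4 (or_intror z1 : ey.1 = 0 \/ es.1 = 0).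
under eq_I4 => p do rewrite /ddc_form sumform.
apply: (etrans (I4_combination (2 * pi)^-1 i1 i2 i3 i4 i5 i6 i7 i8 E3 E4 E5 E6 E7 E8)).
congr (_ * _); apply: (etrans (congr2 +%R E1 E2)).
have [s2 [K [cK _ zK]]] := t2.
have ih v : int4 (fun p => loghess a v v p * h22 eta p).
  apply: int4_mulcc; [exact: loghess_continuous|exact: smooth_continuous|by exists K].
rewrite -(I4D (ih ex) (ih ey)); apply: eq_I4 => -[[x y] q].
apply: sum_hess; first by [].
by rewrite gt_eqF// (logden_gt0 a0 ((x, y), q)).
Qed.

End log_current.

Section radial_subsolution.
Variable R : realType.
Implicit Types (phi : P1 R -> R) (d k : R) (z w : Cplx R).

Lemma continuous_locally_integrable4 (F : C2 R -> R) (O : set (C2 R)) :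
  continuous F -> locally_integrable4 O (fun p => (F p)%:E).
Proof. by move=> cF K cK _; exact: continuous_compact_integrable. Qed.

Lemma I4_ddc_current4 (F : C2 R -> R) (eta : @form11 R) (O : set (C2 R)) :
  continuous F -> test_form O eta ->
  ddc_current4 (fun p => (F p)%:E) eta = (I4 (fun p => F p * ddc_form eta p))%:E.
Proof.
move=> cF tf; have [K [cK _ z _]] := ddc_form_compact tf.
by rewrite I4E//; apply: int4_mulcc cF (ddc_form_continuous tf) _; exists K.
Qed.

(* [ln (1 + d |w|^2) - k - fs_potential w] in the coordinate [w = 1 / z]. *)
Definition radial d k (x : P1 R) : R :=
  if x is Some z then ln (normc z ^+ 2 + d) - ln (1 + normc z ^+ 2) - k else - k.

Lemma normc_ge0 z : 0 <= normc z. Proof. by rewrite -lecR -cplx_normE normr_ge0. Qed.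

Lemma radial_chart_w d k w : 0 < d ->
  radial d k (chart_w w) = ln (1 + d * normc w ^+ 2) - ln (1 + normc w ^+ 2) - k.
Proof.
move=> d0; rewrite /chart_w; have [->|w0] := eqVneq w 0.
  by rewrite normc0 expr0n/= mulr0 addr0 subrr sub0r.
rewrite /radial normcV exprVn.
have n0 : 0 < normc w ^+ 2 by rewrite exprn_gt0// normc_gt0.
move: n0; move: (normc w ^+ 2) => n n0.
have -> : n^-1 + d = (1 + d * n) / n by field; rewrite gt_eqF.
have -> : 1 + n^-1 = (1 + n) / n by field; rewrite gt_eqF.
have h1 : 0 < 1 + d * n by rewrite addr_gt0// mulr_gt0.
have h2 : 0 < 1 + n by rewrite addr_gt0.
by rewrite !ln_div ?posrE//; lra.
Qed.

(** Neighbourhoods of infinity are defined through complements of compact sets of the z-line; this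
    lets continuity there be checked in the coordinate w. *)
Lemma nbhs_infty_chart_w (A : set (P1 R)) :
  nbhs (0 : Cplx R) (@chart_w R @^-1` A) -> nbhs (None : P1 R) A.
Proof.
move=> n0; have A0 : A None by have := nbhs_singleton n0; rewrite /= /chart_w eqxx.
have /nbhs_ballP[_ /cplx_gt0P[r r0 ->] rA] := n0.
have := nbhs_infty r^-1; apply: filterS => -[z h|//].
have {}h : r^-1 < normc z := h z erefl.
have nz : 0 < normc z by apply: lt_trans h; rewrite invr_gt0.
have z0 : z != 0 by rewrite -normc_gt0.
have -> : Some z = chart_w z^-1 by rewrite /chart_w invr_eq0 (negbTE z0) invrK.
apply: rA; rewrite -ball_normE/= sub0r normrN normc_lt normcV.
by rewrite invf_plt ?posrE.
Qed.

Lemma continuous_ln_affine (a b : R) : 0 < a -> 0 <= b ->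
  continuous (fun z : Cplx R => ln (a + b * normc z ^+ 2)).
Proof.
move=> a0 b0 z; apply: (@continuous_comp _ _ _ (fun z : Cplx R => a + b * normc z ^+ 2) (@ln R)).
  apply: (@continuous_comp _ _ _ (fun z : Cplx R => normc z) (fun r : R => a + b * r ^+ 2)).
    exact: normc_continuous.
  apply: cvgD; first exact: cvg_cst.
  apply: cvgM; first exact: cvg_cst.
  exact: exprn_continuous.
by apply: continuous_ln; rewrite ltr_wpDr// mulr_ge0// sqr_ge0.
Qed.

Lemma radial_continuous d k : 0 < d -> continuous (radial d k).
Proof.
move=> d0 x; have F := nbhs_filter x.
case: x F => [z|] F A nA.
  have : {for z, continuous (fun z => ln (d + 1 * normc z ^+ 2) - ln (1 + 1 * normc z ^+ 2) - k)}.
    apply: continuousB; last exact: cst_continuous.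
    by apply: continuousB; exact: continuous_ln_affine.
  have E : (fun z => ln (d + 1 * normc z ^+ 2) - ln (1 + 1 * normc z ^+ 2) - k) =
      radial d k \o Some.
    by apply/funext => y; rewrite /radial/= !mul1r [d + _]addrC.
  by rewrite E => /(_ A nA).
apply: nbhs_infty_chart_w.
have : {for 0, continuous (fun w : Cplx R => ln (1 + d * normc w ^+ 2) - ln (1 + 1 * normc w ^+ 2) - k)}.
  apply: continuousB; last exact: cst_continuous.
  by apply: continuousB; apply: continuous_ln_affine => //; exact: ltW.
have E : (fun w => ln (1 + d * normc w ^+ 2) - ln (1 + 1 * normc w ^+ 2) - k) =
    radial d k \o @chart_w R.
  by apply/funext => y; rewrite /= radial_chart_w// mul1r.
rewrite E => /(_ A); apply.
by rewrite /= /chart_w eqxx.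
Qed.

End radial_subsolution.

Section radial_subsolution_lemmas.
Variable R : realType.
Implicit Types (phi : P1 R -> R) (d k : R) (z w : Cplx R) (c : Cplx R -> P1 R).

(** The parameter [a] is [d] in the coordinate z and [d^-1] in the coordinate w, since [ln (1 + d
    |w|^2) = ln (|w|^2 + d^-1) + ln d]. *)
Lemma radial_potential d k c : 0 < d -> atlas c ->
  exists2 a, 0 < a & exists b, forall p : C2 R,
    prod_potential c (fun x => (radial d k x.1)%:E) p = (logf a b p)%:E.
Proof.
move=> d0 [->|->].
  exists d => //; exists (- k) => p; rewrite /prod_potential fs_potentialE -EFinD.
  by congr EFin; rewrite /prod_chart/radial /= sqr_sqrtr ?sqn_ge0// /logf /logden; ring.
exists d^-1; first by rewrite invr_gt0.
exists (ln d - k) => p; rewrite /prod_potential fs_potentialE -EFinD.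
congr EFin; rewrite /prod_chart /= radial_chart_w// normc_cplx_sqr /logf /logden.
have s0 := sqn_ge0 p.1.
have -> : 1 + d * sqn p.1 = (sqn p.1 + d^-1) * d by field; rewrite gt_eqF.
by rewrite lnM ?posrE ?ltr_wpDl ?invr_gt0//; ring.
Qed.

Lemma radial_rotate d k (tau : Cplx R) (x : P1 R) : circle tau ->
  radial d k (rotate tau x) = radial d k x.
Proof.
case: x => [z|//]; rewrite /circle/= (cplx_normE tau : `|tau| = _ :> Cplx R) => -[t1].
by rewrite normcM t1 mul1r.
Qed.

Lemma positive_form_h22 (eta : @form11 R) p : positive_form eta -> 0 <= h22 eta p.
Proof.
move=> /(_ p 0 1); rewrite normc0 normc1.
by rewrite expr1n (expr0n R 2) !(mulr0, mul0r) mulr1 !add0r.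
Qed.

Lemma radial_subsolution phi d k : 0 < d -> (forall x, radial d k x <= phi x) ->
  subsolution phi (fun x => (radial d k x.1)%:E).
Proof.
move=> d0 le_phi; split => //.
- move=> x r; rewrite -EFinN lte_fin => h.
  have Fx := nbhs_filter (x : P1 R * Cplx R).
  have n1 : nbhs (x.1 : P1 R) [set y | radial d k y < - r].
    by apply: (nbhs_sublevel (@radial_continuous R d k d0)); move: h; lra.
  have n2 : nbhs (x : P1 R * Cplx R) [set y | radial d k y.1 < - r].
    exists ([set y | radial d k y < - r], setT) => /=.
      by split => //; exact: filterT.
    by move=> y [].
  exists [set y | radial d k y.1 < - r].
    have [xS|xS] := nbhs_subspaceP (setT `*` closed_disc) (x : subspace (setT `*` closed_disc)).
      by apply: filterS n2 => y hy _.
    by move=> y /= ->; move: h; lra.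
  by move=> y /= hy; rewrite lte_fin; lra.
- move=> c ac; have [a a0 [b E]] := radial_potential k d0 ac.
  have {E}-> : prod_potential c (fun x => (radial d k x.1)%:E) = (fun p => (logf a b p)%:E).
    by apply/funext.
  have cl := @logf_continuous R a b a0.
  split; first exact: continuous_locally_integrable4.
  move=> eta te pe; rewrite (I4_ddc_current4 cl te) lee_fin (@I4_logf_ddc R a b a0 _ _ te).
  apply: mulr_ge0; first by rewrite invr_ge0 mulr_ge0 ?pi_ge0.
  apply: I4_ge0 => p; apply: mulr_ge0; first exact: fubini_study_density_ge0.
  exact: positive_form_h22.
(* A continuous function exceeding [a] at [p] exceeds it on an open set, which is not negligible. *)
- move=> c ac O oO _ a hae p Op; rewrite lee_fin leNgt; apply/negP => ap.
  pose G (q : C2 R) : R := radial d k (c (cplx q.1)).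
  have cG : continuous (fun q => - G q).
    move=> q; apply: (@continuous_comp _ _ _ G (fun x : R => - x)); last exact: opp_continuous.
    apply: (@continuous_comp _ _ _ (fun q : C2 R => c (cplx q.1)) (radial d k)); last exact: radial_continuous.
    apply: (@continuous_comp _ _ _ (fun p : C2 R => cplx p.1) c); last exact: chart_continuous.
    by apply: (@continuous_comp _ _ _ fst (@cplx R)); [exact: cvg_fst|exact: cplx_continuous].
  have oV : open (O `&` [set q | - G q < - a]).
    by apply: openI => //; exact: (open_sublevel (- a) cG).
  have Vp : (O `&` [set q | - G q < - a]) p by split => //; rewrite /= ltrN2.
  apply: (open_not_negligible oV Vp); apply: negligibleS hae => q [Oq /=].
  by rewrite ltrN2 => aq h; have := h Oq; rewrite lee_fin leNgt aq.
- by move=> z tau ct; rewrite lee_fin -(radial_rotate d k z ct); exact: le_phi.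
Qed.

End radial_subsolution_lemmas.

Section envelope_lower_bound.
Variable R : realType.
Implicit Types (d k : R) (z w : Cplx R).

Lemma disc_compact (r : R) : compact [set p : C1 R | sqn p <= r].
Proof.
pose I : set R := `[- Num.sqrt r, Num.sqrt r]%classic.
have sI : [set p : C1 R | sqn p <= r] `<=` I `*` I.
  move=> [x y] /= h; split; rewrite /I /= in_itv/= -ler_norml.
    exact: le_sqrt_sqn h.
  by apply: (@le_sqrt_sqn _ _ x); rewrite addrC.
apply: subclosed_compact sI; last by apply: compact_setX; exact: segment_compact.
exact: closed_sublevel (@sqn_continuous R).
Qed.

Variable phi : P1 R -> R.
Hypothesis sphi : smooth_P1 phi.
Hypothesis phi_ge : forall w, - fs_potential w <= phi (chart_w w).
Hypothesis arc : is_arc [set w : Cplx R | phi (chart_w w) = - fs_potential w].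

(** For [|w|^2 <= A] the constant [ln (1 + d * A)] pushes the radial function below
    [- fs_potential]; for larger [|w|] the strict gap above [- fs_potential] absorbs [d]. *)
Lemma radial_le_phi :
  exists A m, [/\ 0 < A, 0 < m &
    forall d, 0 < d <= m -> forall x, radial d (ln (1 + d * A)) x <= phi x].
Proof.
have [gamma [sg ig gE]] := arc.
have cg := smooth_continuous sg.
have cs : continuous (fun t => sqn (gamma t)).
  by move=> t; apply: continuous_comp; [exact: cg|exact: sqn_continuous].
have [t0 _ ht0] := EVT_max ler01 (continuous_subspaceT cs).
(* The margin 1 puts the arc strictly inside [|w|^2 < A], so the inequality for [phi] is strict
   where [0 < |z|^2 <= A^-1]. *)
pose A := sqn (gamma t0) + 1.
have A0 : 0 < A by rewrite ltr_wpDl ?sqn_ge0.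
have gA t : t \in `[0, 1] -> sqn (gamma t) < A.
  by move=> /ht0 h; apply: le_lt_trans h _; rewrite ltrDl.
(* In the coordinate z the strict inequality reads [ln |z|^2 - ln (1 + |z|^2) < phi]. Exponentiating
   removes the singularity at [z = 0], so the gap [E] has a positive minimum on a compact disc; this
   minimum is the admissible [m]. *)
pose E (p : C1 R) := expR (phi (chart_z (cplx p))) * (1 + sqn p) - sqn p.
have cE : continuous E.
  have cphi : continuous (fun p : C1 R => phi (chart_z (cplx p))).
    by apply: (smooth_continuous (@sphi (@chart_z R) _)); left.
  move=> p; apply: cvgB; last exact: sqn_continuous.
  apply: cvgM; last by apply: cvgD; [exact: cvg_cst|exact: sqn_continuous].
  apply: (@continuous_comp _ _ _ (fun p : C1 R => phi (chart_z (cplx p))) (@expR R)).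
    exact: cphi.
  exact: continuous_expR.
have E0 p : sqn p <= A^-1 -> 0 < E p.
  move=> pA; have s0 := sqn_ge0 p; have s1 : 0 < 1 + sqn p by rewrite ltr_wpDr.
  have [p0|pn0] := eqVneq (sqn p) 0.
    by rewrite /E p0 addr0 mulr1 subr0 expR_gt0.
  have sp : 0 < sqn p by rewrite lt_neqAle eq_sym pn0.
  have z0 := cplx_neq0 sp.
  have cE' : chart_z (cplx p) = chart_w (cplx p)^-1.
    by rewrite /chart_w invr_eq0 (negbTE z0) invrK.
  have nE : normc (cplx p)^-1 ^+ 2 = (sqn p)^-1.
    by rewrite normcV exprVn normc_cplx_sqr.
  have : - ln (1 + (sqn p)^-1) < phi (chart_z (cplx p)).
    rewrite -nE cE' lt_neqAle phi_ge andbT; apply/eqP => /esym h.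
    have : [set w : Cplx R | phi (chart_w w) = - fs_potential w] (cplx p)^-1 by [].
    rewrite gE => -[t tI tE]; have := gA t tI.
    rewrite -normc_cplx_sqr tE nE ltNge; apply/negP; rewrite negbK.
    by rewrite -[A]invrK lef_pV2// posrE ?invr_gt0.
  rewrite -ltr_expR expRN lnK ?posrE; last by rewrite addr_gt0// invr_gt0.
  rewrite (_ : (1 + (sqn p)^-1)^-1 = sqn p / (1 + sqn p)); last by field; rewrite !gt_eqF//.
  by rewrite ltr_pdivrMr// /E subr_gt0.
have D0 : [set p : C1 R | sqn p <= A^-1] !=set0.
  by exists 0; rewrite /= /sqn/= expr0n addr0 invr_ge0 ltW.
have [p /set_mem pD pmin] := compact_EVT_min D0 (@disc_compact A^-1) (continuous_subspaceT cE).
exists A, (E p); split => //; first exact: E0.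
move=> d /andP[d0 dE].
have k0 : 0 <= ln (1 + d * A) by rewrite ln_ge0// lerDl mulr_ge0 ?ltW.
have inner w : normc w ^+ 2 <= A -> radial d (ln (1 + d * A)) (chart_w w) <= phi (chart_w w).
  move=> wA; rewrite radial_chart_w//; apply: le_trans (phi_ge w).
  rewrite /fs_potential addrAC gerDr subr_le0 ler_ln ?posrE.
  - by rewrite lerD2l ler_wpM2l// ltW.
  - by rewrite ltr_wpDr// mulr_ge0 ?sqr_ge0// ltW.
  - by rewrite addr_gt0// mulr_gt0.
case=> [z|]; last first.
  have := inner 0; rewrite /chart_w eqxx normc0 expr0n/=; apply.
  exact: ltW.
have [z0|z0] := leP (normc z ^+ 2) A^-1; last first.
  have zn0 : z != 0.
    apply/eqP => h; move: z0; rewrite h normc0 expr0n/=.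
    by rewrite ltNge invr_ge0 ltW.
  have -> : Some z = chart_w z^-1 by rewrite /chart_w invr_eq0 (negbTE zn0) invrK.
  apply: inner; rewrite normcV exprVn.
  by rewrite -[A]invrK lef_pV2 ?posrE ?invr_gt0 ?ltW// (lt_trans _ z0) ?invr_gt0.
have zE := uncplxK z.
have n0 : 0 <= normc z ^+ 2 by exact: sqr_ge0.
have sE : sqn (uncplx z) = normc z ^+ 2 by rewrite -normc_cplx_sqr zE.
have hE : E p <= E (uncplx z) by apply: pmin; apply: mem_set; rewrite /= sE.
have {}hE : E p <= expR (phi (Some z)) * (1 + normc z ^+ 2) - normc z ^+ 2.
  by move: hE; rewrite {2}/E zE sE.
have {hE dE} : normc z ^+ 2 + d <= expR (phi (Some z)) * (1 + normc z ^+ 2).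
  by rewrite addrC -lerBrDr; exact: le_trans dE hE.
have h1 : 0 < 1 + normc z ^+ 2 by rewrite ltr_wpDr.
have h2 : 0 < normc z ^+ 2 + d by rewrite ltr_wpDl.
have h3 : 0 < expR (phi (Some z)) * (1 + normc z ^+ 2) by rewrite mulr_gt0 ?expR_gt0.
rewrite -(ler_ln h2 h3).
rewrite lnM ?posrE ?expR_gt0// expRK /radial.
move: k0; move: (ln _) (ln _) (ln _) => X Y Z; clear; lra.
Qed.

Lemma weak_solution_ge :
  forall p : C2 R, (0 <= prod_potential (@chart_w R) (weak_solution phi) p)%E.
Proof.
move=> p; have [A [m [A0 m0 h]]] := radial_le_phi.
apply/lee_addgt0Pr => e e0.
pose d := Num.min m (e / A).
have d0 : 0 < d by rewrite lt_min m0 divr_gt0.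
have dm : 0 < d <= m by rewrite d0 ge_min lexx.
pose k := ln (1 + d * A).
have ke : k <= e.
  have : d * A <= e by rewrite -ler_pdivlMr// ge_min lexx orbT.
  have dA : 0 <= d * A by rewrite mulr_ge0 ?ltW.
  by have := @le_ln1Dx R (d * A); rewrite /k => /(_ _)/le_trans; apply; lra.
have sub := @radial_subsolution R phi d k d0 (h d dm).
have : ((radial d k (chart_w (cplx p.1)))%:E <= weak_solution phi (prod_chart (@chart_w R) p))%E.
  apply: ereal_sup_ubound.
  by exists (fun x => (radial d k x.1)%:E).
move=> hw; apply: (@le_trans _ _ (fs_potential (cplx p.1) + radial d k (chart_w (cplx p.1)) + e)%:E).
  rewrite lee_fin radial_chart_w// /fs_potential.
  have : 0 <= ln (1 + d * normc (cplx p.1) ^+ 2).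
    by rewrite ln_ge0// lerDl mulr_ge0 ?sqr_ge0// ltW.
  by move: ke; clear; lra.
by rewrite !EFinD; apply: leeD => //; apply: leeD2l.
Qed.

Lemma weak_solution_eq :
  exists2 q, 0 < q < 1 & forall p : C2 R, sqn p.1 < q -> sqn p.2 < q ->
    prod_potential (@chart_w R) (weak_solution phi) p = 0%E.
Proof.
have [q q01 hq] := subsolution_le0 sphi phi_ge arc.
exists q => // p p1 p2; apply/eqP; rewrite eq_le weak_solution_ge// andbT.
have : (weak_solution phi (prod_chart (@chart_w R) p) <= (- fs_potential (cplx p.1))%:E)%E.
  apply: ub_ereal_sup => _ [psi sub <-]; have := hq psi sub p p1 p2.
  rewrite /prod_potential; case: (psi _) => [r| |] h; [|by rewrite leye_eq in h|exact: leNye].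
  by move: h; rewrite -EFinD !lee_fin; lra.
move=> h; apply: le_trans (leeD2l _ h) _.
by rewrite -EFinD subrr.
Qed.

End envelope_lower_bound.

(** * Vanishing of the current near infinity *)

Section vanishing_currents.
Variable R : realType.
Implicit Types (u : C2 R -> \bar R) (eta : @form11 R) (O : set (C2 R)).

Lemma eq_on_current O u (F : C2 R -> R) : continuous F ->
  (forall p, O p -> u p = (F p)%:E) ->
  locally_integrable4 O u /\
  forall eta, test_form O eta ->
    ddc_current4 u eta = (I4 (fun p => F p * ddc_form eta p))%:E.
Proof.
move=> cF uF; split.
  move=> K cK KO; have [mK _] := compact_leb4 cK.
  apply: eq_integrable (continuous_locally_integrable4 cF cK KO) => //.
  by move=> p; rewrite inE => /KO /uF.
move=> eta te; rewrite -(I4_ddc_current4 cF te) /ddc_current4.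
apply: eq_integral => p _; have [K [_ KO z _]] := ddc_form_compact te.
have [/KO/uF->//|/z->] := pselect (K p).
by rewrite !mule0.
Qed.

Lemma zero_current O u : (forall p, O p -> u p = 0%E) ->
  locally_integrable4 O u /\ forall eta, test_form O eta -> ddc_current4 u eta = 0%E.
Proof.
move=> u0; have [li cu] := @eq_on_current O u (cst 0) (@cst_continuous _ _ _) u0.
split => // eta /cu ->; congr EFin.
by apply: etrans (I4_0 R); apply: eq_I4 => p; exact: mul0r.
Qed.

Let ln_increment (s d b : R) : 0 < b -> b < s -> 0 < d ->
  `|ln s - ln (s + d)| <= d / b.
Proof.
move=> b0 bs d0; have s0 : 0 < s := lt_trans b0 bs.
have sd : 0 < s + d by rewrite addr_gt0.
rewrite distrC -ln_div ?posrE// (_ : (s + d) / s = 1 + d / s); last by field; rewrite gt_eqF.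
have ds : 0 < d / s by rewrite divr_gt0.
rewrite ger0_norm; last by rewrite ln_ge0// lerDl ltW.
apply: le_trans (le_ln1Dx _) _; first by lra.
by rewrite ler_pM2l// lef_pV2 ?posrE// ltW.
Qed.

Lemma log_current O u (b : R) : 0 < b -> (forall p, O p -> b < sqn p.1) ->
  (forall p, O p -> u p = (ln (sqn p.1))%:E) ->
  locally_integrable4 O u /\ forall eta, test_form O eta -> ddc_current4 u eta = 0%E.
Proof.
move=> b0 Ob uln.
(* Cutting off at [b] extends [ln |z|^2] from [O] to a continuous function on all of C^2. *)
pose m (p : C2 R) : R := Num.max b (sqn p.1).
have mE p : O p -> m p = sqn p.1 by move=> /Ob/ltW; exact: max_r.
have m0 p : 0 < m p by apply: lt_le_trans b0 _; rewrite le_max lexx.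
have cm : continuous m.
  move=> p; apply: (@continuous_max _ _ (cst b) _ p); first exact: cst_continuous.
  exact: sqn1_continuous.
pose F p := ln (m p).
have cF : continuous F.
  move=> p; apply: (@continuous_comp _ _ _ m (@ln R)); first exact: cm.
  exact: continuous_ln.
have [li cu] := @eq_on_current O u F cF (fun p Op => etrans (uln p Op) (congr1 (fun x => (ln x)%:E) (esym (mE p Op)))).
split => // eta te; rewrite (cu eta te); congr EFin.
have [K [cK KO z [_ z22 _ _]]] := ddc_form_compact te.
have cd := ddc_form_continuous te.
have sd : csupp (ddc_form eta) by exists K.
have id := int4_cc cd sd.
have c22 : continuous (h22 eta) by case: te => _ [s _] _ _; exact: smooth_continuous.
have s22 : csupp (h22 eta) by exists K.
have i22 := int4_cc c22 s22.
pose X := I4 (fun p => `|ddc_form eta p|); pose Y := I4 (fun p => `|h22 eta p|).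
have X0 : 0 <= X by exact: I4_ge0.
have Y0 : 0 <= Y by exact: I4_ge0.
have pi0 : 0 <= (2 * pi)^-1 :> R by rewrite invr_ge0 mulr_ge0 ?pi_ge0.
(* The first term is the cost of replacing [ln s] by [ln (s + d)], the second bounds the density
   [4 d / (s + d)^2]; both are linear in [d], which tends to 0. *)
suff main d : 0 < d ->
    `|I4 (fun p => F p * ddc_form eta p)| <= d * (b^-1 * X + (2 * pi)^-1 * (4 * b^-1 ^+ 2 * Y)).
  apply/eqP; rewrite -normr_eq0 eq_le normr_ge0 andbT; apply/ler_addgt0Pr => e e0.
  rewrite add0r; set T := _ + _ in main.
  have T0 : 0 <= T by rewrite addr_ge0// ?mulr_ge0// ?invr_ge0 ?(ltW b0)// sqr_ge0.
  apply: le_trans (main (e / (T + 1)) _) _; first by rewrite divr_gt0// ltr_wpDl.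
  rewrite mulrAC ler_pdivrMr; last by rewrite ltr_wpDl.
  by rewrite ler_wpM2l ?(ltW e0)// lerDl.
move=> d0.
have cl := @logf_continuous R d 0 d0.
have i1 := int4_mulcc cF cd sd; have i2 := int4_mulcc cl cd sd.
have i3 := int4_mulcc (fubini_study_density_continuous d0) c22 s22.
have B1 : `|I4 (fun p => F p * ddc_form eta p) - I4 (fun p => logf d 0 p * ddc_form eta p)|
    <= d / b * X.
  rewrite -(I4B i1 i2); apply: le_trans (I4_norm (int4B i1 i2)) _.
  rewrite /X -(I4Z _ (int4_norm id)).
  apply: I4_le; [exact: int4_norm (int4B i1 i2)|exact: (int4Z _ (int4_norm id))|move=> p].
  rewrite -mulrBl normrM; have [/KO Op|/z ->] := pselect (K p); last by rewrite normr0 !mulr0.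
  apply: ler_wpM2r; first exact: normr_ge0.
  by rewrite /F (mE p Op) /logf addr0; exact: (ln_increment b0 (Ob p Op) d0).
have B2 : `|I4 (fun p => fubini_study_density d p * h22 eta p)| <= d * (4 * b^-1 ^+ 2) * Y.
  apply: le_trans (I4_norm i3) _; rewrite /Y -(I4Z _ (int4_norm i22)).
  apply: I4_le; [exact: int4_norm i3|exact: (int4Z _ (int4_norm i22))|move=> p].
  rewrite normrM; have [/KO Op|/z22 ->] := pselect (K p); last by rewrite normr0 !mulr0.
  apply: ler_wpM2r; first exact: normr_ge0.
  rewrite ger0_norm; last exact: fubini_study_density_ge0.
  have bs := Ob p Op; have s0 : 0 < sqn p.1 + d by rewrite addr_gt0// (lt_trans b0).
  rewrite /fubini_study_density [4 * d]mulrC -mulrA; apply: ler_wpM2l; first exact: ltW.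
  apply: ler_wpM2l => //; rewrite -exprVn ler_pXn2r ?nnegrE ?invr_ge0 ?(ltW b0) ?(ltW s0)//.
  by rewrite lef_pV2 ?posrE//; move: bs d0; clear; lra.
have E := @I4_logf_ddc R d 0 d0 eta O te.
move: B1 B2; rewrite E; set T := I4 _; set U := I4 _ => B1 B2.
have B3 : `|(2 * pi)^-1 * U| <= (2 * pi)^-1 * (d * (4 * b^-1 ^+ 2) * Y).
  by rewrite normrM (ger0_norm pi0); exact: ler_wpM2l.
have := ler_normD (T - (2 * pi)^-1 * U) ((2 * pi)^-1 * U); rewrite subrK.
move/le_trans; apply; apply: le_trans (lerD B1 B3) _.
by rewrite le_eqVlt; apply/orP; left; apply/eqP; ring.
Qed.

End vanishing_currents.

Section flat_neighbourhood.
Variable R : realType.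
Implicit Types (phi : P1 R -> R) (psi : P1 R * Cplx R -> \bar R) (q : R).

(** The bidisc [|w|^2 < q], [|tau|^2 < q] around the point [(None, 0)], written in terms of z, with
    infinity satisfying the first condition vacuously. *)
Definition infty_nbhd q : set (P1 R * Cplx R) :=
  [set x | (forall z, x.1 = Some z -> (Num.sqrt q)^-1 < normc z) /\ normc x.2 < Num.sqrt q].

Lemma infty_nbhd_open q : open (infty_nbhd q).
Proof.
rewrite openE => -[x t] [/= hx ht].
have n2 : nbhs t [set y : Cplx R | normc y < Num.sqrt q].
  exact: (nbhs_sublevel (@normc_continuous R) ht).
have n1 : nbhs x [set y : P1 R | forall z, y = Some z -> (Num.sqrt q)^-1 < normc z].
  case: x hx => [z|] hx; last exact: nbhs_infty.
  have cN : continuous (fun z : Cplx R => - normc z).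
    by move=> y; exact: continuousN (@normc_continuous R y).
  have : nbhs z [set y : Cplx R | - normc y < - (Num.sqrt q)^-1].
    by apply: (nbhs_sublevel cN); rewrite ltrN2; exact: hx.
  have F := nbhs_filter z.
  move=> n; rewrite /nbhs/=; apply: filterS n => y /=.
  by rewrite ltrN2 => h w [<-].
exists ([set y : P1 R | forall z, y = Some z -> (Num.sqrt q)^-1 < normc z],
  [set y : Cplx R | normc y < Num.sqrt q]) => //.
Qed.

Lemma normc_lt_sqrt q (p : C1 R) : 0 < q -> (normc (cplx p) < Num.sqrt q) = (sqn p < q).
Proof. by move=> q0; rewrite normc_cplx ltr_sqrt. Qed.

Lemma infty_nbhd_chart_w q (p : C2 R) : 0 < q ->
  infty_nbhd q (prod_chart (@chart_w R) p) -> sqn p.1 < q /\ sqn p.2 < q.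
Proof.
move=> q0 [/= h1 h2]; rewrite normc_lt_sqrt// in h2; split => //.
rewrite -normc_cplx_sqr; have [E|w0] := eqVneq (cplx p.1) 0.
  by rewrite E normc0 expr0n.
have := h1 (cplx p.1)^-1; rewrite /chart_w (negbTE w0) => /(_ erefl).
have n0 : 0 < normc (cplx p.1) by rewrite normc_gt0.
have s0 : 0 < Num.sqrt q by rewrite sqrtr_gt0.
by rewrite normcV (ltf_pV2 s0 n0) normc_lt_sqrt// normc_cplx_sqr.
Qed.

Lemma infty_nbhd_chart_z q (p : C2 R) : 0 < q ->
  infty_nbhd q (prod_chart (@chart_z R) p) -> q^-1 < sqn p.1 /\ sqn p.2 < q.
Proof.
move=> q0 [/= h1 h2]; rewrite normc_lt_sqrt// in h2; split => //.
have := h1 (cplx p.1) erefl; rewrite -normc_cplx_sqr.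
have s0 : 0 < Num.sqrt q by rewrite sqrtr_gt0.
rewrite -[q in X in _ -> X]sqr_sqrtr ?(ltW q0)// -exprVn => h.
by rewrite ltr_pXn2r ?nnegrE ?invr_ge0 ?(ltW s0) ?normc_ge0.
Qed.

Lemma current_eq0_infty_nbhd q psi : 0 < q ->
  (forall p : C2 R, sqn p.1 < q -> sqn p.2 < q -> prod_potential (@chart_w R) psi p = 0%E) ->
  current_eq0 (infty_nbhd q) psi.
Proof.
move=> q0 h c [->|->]; last first.
  by apply: zero_current => p /(infty_nbhd_chart_w q0)[]; exact: h.
(* In the coordinate z the hypothesis gives [psi = - ln (1 + |z|^-2)], so the potential is [ln (1 +
   |z|^2) - ln (1 + |z|^-2) = ln |z|^2]. *)
have qV0 : 0 < q^-1 by rewrite invr_gt0.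
apply: (log_current qV0) => p /(infty_nbhd_chart_z q0)[p1 p2] //.
have s0 : 0 < sqn p.1 := lt_trans qV0 p1.
have z0 := cplx_neq0 s0.
have nE : sqn (uncplx (cplx p.1)^-1) = (sqn p.1)^-1.
  by rewrite -normc_cplx_sqr uncplxK normcV exprVn normc_cplx_sqr.
have := h (uncplx (cplx p.1)^-1, p.2); rewrite /= nE => /(_ _ p2).
have lq : (sqn p.1)^-1 < q by rewrite invf_plt ?posrE.
move=> /(_ lq); rewrite /prod_potential !fs_potentialE /= nE.
have -> : prod_chart (@chart_w R) (uncplx (cplx p.1)^-1, p.2) = prod_chart (@chart_z R) p.
  by rewrite /prod_chart/= uncplxK /chart_w invr_eq0 (negbTE z0) invrK.
case: (psi _) => [r| |] //; rewrite -!EFinD => -[rE].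
have {rE}-> : r = - ln (1 + (sqn p.1)^-1) by apply/eqP; rewrite -addr_eq0 addrC; exact/eqP.
have -> : 1 + (sqn p.1)^-1 = (1 + sqn p.1) / sqn p.1 by field; rewrite gt_eqF.
have s1 : 0 < 1 + sqn p.1 by rewrite addr_gt0.
by congr EFin; rewrite (ln_div s1 s0) opprB addrC subrK.
Qed.

End flat_neighbourhood.

(** * Failure of maximal rank *)

Section product_test_function.
Variables (R : realType) (r : R).
Hypothesis r0 : 0 < r.
Implicit Types (z v : C1 R) (p : C2 R).

Let b := bump (- r) r.

Definition bump2 z : R := b z.1 * b z.2.

Lemma rho_bump2 p : rho r p = bump2 p.1 * bump2 p.2.
Proof. by rewrite /rho /prod4 /bump2 /b mulrA. Qed.

Lemma bump2_ge0 z : 0 <= bump2 z.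
Proof. exact: mulr_ge0 (bump_ge0 _ _ _) (bump_ge0 _ _ _). Qed.

Lemma bump2_0_gt0 : 0 < bump2 0.
Proof. by apply: mulr_gt0; apply: bump_gt0; rewrite /= oppr_lt0 r0. Qed.

Lemma bump2_supp z : bump2 z != 0 -> `|z.1| < r /\ `|z.2| < r.
Proof.
move=> h; split; rewrite ltr_norml; apply: contraNT h => /bump_out h.
  by rewrite /bump2 /b h mul0r.
by rewrite /bump2 /b h mulr0.
Qed.

(** Smoothness of [bump2] is inherited from four variables: up to a constant it is the restriction
    of [rho] to the plane [tau = 0]. *)
Definition slice z : C2 R := (z, 0).

Lemma slice_linear : linear slice.
Proof. by move=> k x y; apply: injective_projections; rewrite //= [k *: 0]scaler0 addr0. Qed.

HB.instance Definition _ := GRing.isLinear.Build R (C1 R) (C2 R) *:%R slice slice_linear.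

Lemma slice_continuous : continuous slice.
Proof.
move=> z A [[A1 A2] [/= n1 n2] sA].
by apply: filterS n1 => y y1; apply: sA; split => //=; exact: nbhs_singleton n2.
Qed.

Lemma slice_derive (g : C2 R -> R) v : 'D_v (g \o slice) = 'D_(slice v) g \o slice.
Proof.
apply/funext => z; rewrite /derive /=.
suff -> : (fun h : R => h^-1 *: (g (slice (h *: v + z)) - g (slice z))) =
    (fun h : R => h^-1 *: (g (h *: slice v + slice z) - g (slice z))) by [].
by apply/funext => h; rewrite -linearZ -linearD.
Qed.

Lemma slice_smooth (g : C2 R -> R) : prod4_class g -> smooth (g \o slice).
Proof.
move=> cg; apply: (smooth_class (P := fun f => exists2 g, prod4_class g & f = g \o slice)).
- move=> f [h ch ->] z; apply: differentiable_comp.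
    by apply: linear_differentiable; exact: slice_continuous.
  by have [d _] := prod4_class_derive ch; exact: d.
- move=> f v [h ch ->]; exists ('D_(slice v) h); last exact: slice_derive.
  by have [_ d] := prod4_class_derive ch; exact: d.
- by exists g.
Qed.

Lemma rho_class0 : prod4_class (rho r).
Proof. by apply: prod4_prod; exact: cinf_bump. Qed.

Lemma bump2_smooth : smooth bump2.
Proof.
have -> : bump2 = (fun p => (bump2 0)^-1 * rho r p) \o slice.
  apply/funext => z; rewrite /= rho_bump2 /= mulrCA mulVf ?mulr1//.
  by rewrite gt_eqF// bump2_0_gt0.
by apply: slice_smooth; apply: prod4_scale; exact: rho_class0.
Qed.

Lemma bump2_box : compact (`[- r, r]%classic `*` `[- r, r]%classic : set (C1 R)) /\
  forall z, ~ (`[- r, r]%classic `*` `[- r, r]%classic) z -> bump2 z = 0.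
Proof.
split; first by apply: compact_setX; exact: segment_compact.
move=> z nz; apply/eqP; apply: contra_notT nz => /bump2_supp[h1 h2].
by split; rewrite /= in_itv/= -ler_norml ltW.
Qed.

Lemma derive_prod_const (f k : C1 R -> R) v p : (forall z, differentiable f z) ->
  'D_((v, 0) : C2 R) (fun p => f p.1 * k p.2) p = 'D_v f p.1 * k p.2.
Proof.
move=> df; have dv : derivable f p.1 v by exact: diff_derivable.
apply/cvg_lim => //.
have c : (fun h : R => h^-1 *: (f (h *: v + p.1) - f p.1) * k p.2) @ 0^' --> 'D_v f p.1 * k p.2.
  by apply: cvgM; [exact: dv|exact: cvg_cst].
suff -> : (fun h : R => h^-1 *: (((fun p => f p.1 * k p.2) \o shift p) (h *: ((v, 0) : C2 R)) - f p.1 * k p.2)) =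
  (fun h : R => h^-1 *: (f (h *: v + p.1) - f p.1) * k p.2) by [].
apply/funext => h; rewrite /= [h *: 0]scaler0 add0r.
by rewrite -mulrBl /GRing.scale/= mulrA.
Qed.

(** With [h22] alone, the pairing with a function of the first variable factors into a planar
    pairing with [bump2] and an integral over the second variable. *)
Definition rho_form : @form11 R := Form11 (fun=> 0) (rho r) (fun=> 0) (fun=> 0).

Lemma rho_test_form : test_form setT rho_form.
Proof.
have z : test_function [set: C2 R] (fun=> 0 : R).
  split; last by exists set0; split => //; exact: compact0.
  apply: (smooth_class (P := fun f => f = cst 0)) => //.
    by move=> f -> x; exact: differentiable_cst.
  by move=> f v ->; apply/funext => x; exact: derive_cst.
split=> //; split; first by apply: prod4_class_smooth; exact: rho_class0.
by have [K cK zK] := rho_csupp0 r; exists K.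
Qed.

(** The factor 2 reconciles the normalisations [(2 * pi)^-1] of [ddc_form] and [(4 * pi)^-1] of
    [ddc_fun]. *)
Lemma ddc_rho_form p : ddc_form rho_form p = ddc_fun bump2 p.1 * (2 * bump2 p.2).
Proof.
have z (s : seq (C2 R)) : iter_derive s (fun=> 0 : R) p = 0.
  exact: (@supp_iter_derive R (C2 R) (fun=> 0 : R) set0 s closed0 (fun _ _ => erefl) p (fun x => x)).
have d2 v : iter_derive [:: (v, 0) : C2 R; (v, 0) : C2 R] (rho r) p =
    iter_derive [:: v; v] bump2 p.1 * bump2 p.2.
  have E : rho r = (fun p => bump2 p.1 * bump2 p.2) by apply/funext => q; exact: rho_bump2.
  have E1 : 'D_((v, 0) : C2 R) (rho r) = (fun p => 'D_v bump2 p.1 * bump2 p.2).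
    rewrite E; apply/funext => q; apply: derive_prod_const => y.
    exact: (smooth_differentiable _ bump2_smooth).
  rewrite /= E1; apply: derive_prod_const => y.
  exact: (smooth_differentiable _ (smooth_derive _ bump2_smooth)).
rewrite /ddc_form /rho_form; cbn [h11 h22 h12re h12im].
rewrite !z; have h (k A B C : R) : k != 0 -> (2 * k)^-1 * (A * C + B * C + 0 + 0 - 2 * (0 + 0 + 0 - 0)) =
    (4 * k)^-1 * (A + B) * (2 * C).
  by move=> k0; field.
have e1 : iter_derive [:: ((1, 0), (0, 0)) : C2 R; ((1, 0), (0, 0))] (rho r) p =
  iter_derive [:: (1, 0) : C1 R; (1, 0)] bump2 p.1 * bump2 p.2 := d2 (1, 0).
have e2 : iter_derive [:: ((0, 1), (0, 0)) : C2 R; ((0, 1), (0, 0))] (rho r) p =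
  iter_derive [:: (0, 1) : C1 R; (0, 1)] bump2 p.1 * bump2 p.2 := d2 (0, 1).
by rewrite e1 e2 h// gt_eqF// pi_gt0.
Qed.

End product_test_function.

Section fubini_study_positive.
Variable R : realType.

Lemma bump2_integrable (r : R) : 0 < r ->
  (@leb2 R).-integrable setT (fun z : M2 R => (bump2 r z)%:E).
Proof.
move=> r0; pose I : set (M1 R) := `[- r, r]%classic.
have cb : continuous (bump (- r) r) by apply: cinf_continuous; exact: cinf_bump.
have rr : - r <= r by lra.
have [c _ hc] := EVT_max rr (continuous_subspaceT cb).
pose C := bump (- r) r c; have C0 : 0 <= C by exact: bump_ge0.
have [mI2 fI2] := leb2_box r.
have mb : measurable_fun setT (bump (- r) r : M1 R -> M1 R).
  exact: continuous_measurable_fun.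
have mb2 : measurable_fun setT (bump2 r : M2 R -> M1 R).
  apply: measurable_funM.
    exact: (measurableT_comp mb measurable_fst).
  exact: (measurableT_comp mb measurable_snd).
have [iI _] := integrable_indic_lty mI2 fI2.
apply: (le_integrable measurableT _ _ (integrableZl measurableT (C * C) iI)).
  exact/measurable_EFinP.
move=> z _; rewrite /= lee_fin (ger0_norm (bump2_ge0 r z)).
apply: le_trans (ler_norm _); rewrite indicE.
case: (boolP (z \in _)) => [|nz].
  rewrite inE => -[/= z1 z2]; rewrite mulr1.
  by apply: ler_pM; [exact: bump_ge0|exact: bump_ge0|exact: hc|exact: hc].
rewrite mulr0 le_eqVlt; apply/orP; left; apply: contraNT nz => /bump2_supp[h1 h2].
by rewrite inE; split; rewrite /I/= in_itv/= -ler_norml ltW.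
Qed.

(** The planar pairing is extracted from the four-dimensional integration by parts: by Fubini the
    pairing with [rho_form] is the planar one times [B], the integral of [2 * bump2]. *)
Lemma ddc_fs_bump2_gt0 (r : R) : 0 < r <= 1 / 2 ->
  (0 < ddc_current2 (fun p : C1 R => (fs_potential (cplx p))%:E) (bump2 r))%E.
Proof.
move=> /andP[r0 r2].
have te := @rho_test_form R r.
have E := @I4_logf_ddc R 1 0 ltr01 (rho_form r) setT te.
have pos : 0 < I4 (fun p => logf 1 0 p * ddc_form (rho_form r) p).
  rewrite E; apply: mulr_gt0; first by rewrite invr_gt0 mulr_gt0 ?pi_gt0.
  apply: lt_le_trans (I4_rho_gt0 r0) _.
  have cd := @fubini_study_density_continuous R 1 ltr01.
  have idr := int4_mulcc cd (@rho_continuous R r) (rho_csupp0 r).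
  apply: I4_le idr _ => [|p /=]; first exact: int4_rho0.
  have [->|pn0] := eqVneq (rho r p) 0; first by rewrite mulr0.
  rewrite ler_peMl ?rho_ge0// /fubini_study_density.
  have s0 := sqn_ge0 p.1.
  (* Since [r <= 1 / 2] the support lies in [|w|^2 <= 1], where the density [4 / (|w|^2 + 1)^2] is
     at least 1. *)
  have s1 : sqn p.1 <= 1.
    have : bump2 r p.1 != 0 by apply: contra pn0; rewrite rho_bump2 => /eqP ->; rewrite mul0r.
    move=> /bump2_supp[h1 h2]; have k (x : R) : `|x| < r -> x ^+ 2 <= 1 / 2.
      rewrite ltr_norml => /andP[x1 x2].
      have : 0 <= (1 / 2 - x) * (1 / 2 + x) by apply: mulr_ge0; lra.
      by rewrite expr2; lra.
    by have := lerD (k _ h1) (k _ h2); rewrite /sqn => h; apply: le_trans h _; lra.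
  rewrite ler_pdivlMr ?exprn_gt0//; last by lra.
  rewrite mul1r mulr1; have -> : 4 = 2 ^+ 2 :> R by rewrite -natrX.
  by rewrite ler_pXn2r// ?nnegrE; lra.
pose a (z : C1 R) := fs_potential (cplx z) * ddc_fun (bump2 r) z.
pose G (p : M4 R) : R := a p.1 * (2 * bump2 r p.2).
have GE p : logf 1 0 p * ddc_form (rho_form r) p = G p.
  rewrite (ddc_rho_form r0) /G /a fs_potentialE /logf /logden addr0 mulrA.
  by rewrite [1 + _]addrC.
have iG : int4 G.
  have [K [cK _ z _]] := ddc_form_compact te.
  rewrite (_ : G = fun p => logf 1 0 p * ddc_form (rho_form r) p); last first.
    by apply/funext => p; rewrite GE.
  apply: int4_mulcc (ddc_form_continuous te) _; last by exists K.
  exact: (@logf_continuous R 1 0 ltr01).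
have ib := integrableZl measurableT 2 (bump2_integrable r0).
pose B := fine (\int[leb2]_z (2%:E * (bump2 r z)%:E))%E.
have BE : (\int[leb2]_z (2%:E * (bump2 r z)%:E))%E = B%:E.
  by rewrite fineK//; exact: integrable_fin_num.
have B0 : 0 <= B.
  by apply: fine_ge0; apply: integral_ge0 => z _; rewrite -EFinM lee_fin mulr_ge0 ?bump2_ge0.
have FE z : fubini_F (@leb2 R) (EFin \o G) z = (B * a z)%:E.
  rewrite /fubini_F mulrC EFinM -BE -integralZl//.
have iBa : (@leb2 R).-integrable setT (fun z : M2 R => (B * a z)%:E).
  by have := integrable_fubini_F iG; congr (integrable _ _ _); apply/funext.
have IG : (\int[leb2]_z (B * a z)%:E)%E =
    (I4 (fun p => logf 1 0 p * ddc_form (rho_form r) p))%:E.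
  rewrite (eq_I4 GE) (I4E iG); apply: etrans _ (integral12_prod_meas1 iG).
  by apply: eq_integral => z _; exact: esym (FE z).
(* If [B] vanished, so would the four-dimensional integral, which is positive. *)
have Bn0 : B != 0.
  apply/eqP => B00; move: IG; rewrite B00; under eq_integral do rewrite mul0r.
  by rewrite integral0 => -[h]; move: pos; rewrite -h ltxx.
have Bp : 0 < B by rewrite lt_neqAle eq_sym Bn0.
have E2 : ddc_current2 (fun p : C1 R => (fs_potential (cplx p))%:E) (bump2 r) =
    (B^-1%:E * \int[leb2]_z (B * a z)%:E)%E.
  rewrite -integralZl//; apply: eq_integral => z _.
  by rewrite -!EFinM (mulKf Bn0).
rewrite E2; apply: mule_gt0; first by rewrite lte_fin invr_gt0.
by rewrite IG lte_fin.
Qed.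

Lemma weak_solution_not_maximal_rank (psi : P1 R * Cplx R -> \bar R) (q : R) : 0 < q < 1 ->
  (forall p : C2 R, sqn p.1 < q -> sqn p.2 < q -> prod_potential (@chart_w R) psi p = 0%E) ->
  ~ maximal_rank psi.
Proof.
move=> /andP[q0 q1] h /(_ 0) mr.
have c0 : closed_disc (0 : Cplx R) by rewrite /closed_disc/= normr0.
have [_ [eps eps0 H]] := mr c0.
(* The square of half-side [r] lies in [|w|^2 < q] because [2 r^2 = q^2 / 2 < q], and [q < 1] gives
   [r <= 1 / 2]. *)
pose r := q / 2; have r0 : 0 < r by rewrite divr_gt0.
have r2 : 0 < r <= 1 / 2 by rewrite r0 /r; lra.
have tf : test_function setT (bump2 r).
  split; first exact: bump2_smooth.
  by have [cK zK] := bump2_box r; exists (`[- r, r]%classic `*` `[- r, r]%classic).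
have aw : atlas (@chart_w R) by right.
have := H _ aw _ tf (@bump2_ge0 R r).
rewrite [X in (_ <= X)%E](_ : _ = 0%E); last first.
  rewrite /ddc_current2 (eq_integral (fun=> 0%E)) ?integral0// => p _.
  have [pq|pq] := ltP (sqn p) q.
    have := h (p, (0, 0)) pq; rewrite /= /sqn/= expr0n addr0 => /(_ q0).
    by rewrite /prod_potential /potential /= => ->; rewrite mul0e.
  have [cK zK] := bump2_box r; have clK := compact_closed_normed cK.
  have nK : ~ (`[- r, r]%classic `*` `[- r, r]%classic) p.
    case: p pq => x y; rewrite /sqn/= => pq [/=].
    rewrite !in_itv/= => /andP[x1 x2] /andP[y1 y2].
    have hx : 0 <= (r - x) * (r + x) by apply: mulr_ge0; lra.
    have hy : 0 <= (r - y) * (r + y) by apply: mulr_ge0; lra.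
    have hr : r * r < q / 2 by rewrite /r; nra.
    by move: pq hx hy hr; rewrite !expr2; clear; lra.
  by rewrite /ddc_fun !(supp_iter_derive _ clK zK nK) addr0 mulr0 mule0.
by rewrite leNgt mule_gt0// ddc_fs_bump2_gt0.
Qed.

End fubini_study_positive.

Theorem theorem2p1 (R : realType) (phi : P1 R -> R)
  (phi_smooth : smooth_P1 phi)
  (phi_pos : omega_ddc_gt0 phi)
  (phi_ge : forall w : Cplx R, - fs_potential w <= phi (chart_w w))
  (phi_arc : is_arc [set w : Cplx R | phi (chart_w w) = - fs_potential w]) :
  ~ maximal_rank (weak_solution phi) /\
  exists S : set (P1 R * Cplx R),
    [/\ open S, S !=set0, S `<=` setT `*` disc &
        current_eq0 S (weak_solution phi)].

Proof.
have [q q01 h] := weak_solution_eq phi_smooth phi_ge phi_arc.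
have q0 : 0 < q by case/andP: q01.
split; first exact: weak_solution_not_maximal_rank q01 h.
exists (infty_nbhd q); split.
- exact: infty_nbhd_open.
- have h0 : normc (0 : Cplx R) < Num.sqrt q.
    by rewrite normc0 sqrtr_gt0.
  by exists (None, 0); split; [|exact: h0].
- move=> [x t] [_ /= ht]; split => //=.
  rewrite -(uncplxK t); apply/disc_cplx.
  move: ht; rewrite -(uncplxK t) normc_lt_sqrt// => /lt_trans; apply.
  by case/andP: q01.
exact: current_eq0_infty_nbhd.
Qed.
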